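(* Let $G$ be a graph, let $f\colon G\to G$ be a continuous map with zero topological entropy, and let $\langle x,y\rangle\in G\times G$ with $x\neq y$. Then the following statements are equivalent: (1) $\langle x,y\rangle$ is an NS-pair for $f$; (2) $\langle x,y\rangle$ is an IN-pair for $f$; (3) $\langle x,y\rangle$ is an IT-pair for $f$.
   Context: An arc is a space homeomorphic to $[0,1]$. A graph is a continuum (compact connected metric space) $G$ which is a union of finitely many arcs, any two of which are either disjoint or intersect in at most one common endpoint. A graph map is a continuous map $f\colon G\to G$. A subgraph of $G$ is a subset of $G$ that is itself a graph (in particular closed and non-degenerate). A subgraph $K$ of $G$ is periodic (for $f$) with period $k\in\mathbb{N}=\{1,2,\dots\}$ if $K,f(K),\dots,f^{k-1}(K)$ are pairwise disjoint and $f^k(K)=K$. The $\omega$-limit set of $x$ is $\omega_f(x)=\bigcap_{n\ge1}\overline{\{f^m(x): m\ge n\}}$, and $\omega(f)=\bigcup_{x\in G}\omega_f(x)$. A pair $\langle x,y\rangle\in G\times G$ with $x\ne y$ is an NS-pair for $f$ if $x,y\in\omega(f)$ and there exists a sequence $(J_n)_{n=1}^\infty$ of periodic subgraphs (for $f$) with periods $(m_n)_{n=1}^\infty$ such that $J_n\supset J_{n+1}$ for all $n$, $\lim_{n\to\infty}m_n=\infty$, and $x,y\in J_n$ for all $n\in\mathbb{N}$. For subsets $A_1,\dots,A_k\subset G$, a set $I\subset\mathbb{N}$ is an independence set of $\{A_1,\dots,A_k\}$ if for every non-empty finite $J\subset I$ and every $S\in\{1,\dots,k\}^J$ one has $\bigcap_{i\in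 J}f^{-i}(A_{S(i)})\neq\emptyset$. A pair $\langle x,y\rangle$ is an IN-pair (resp. an IT-pair) for $f$ if for all neighborhoods $U_1$ of $x$ and $U_2$ of $y$, $\{U_1,U_2\}$ has arbitrarily large finite independence sets (resp. has an infinite independence set). *)

(* Defs.v *)
From HB Require Import structures.
From mathcomp Require Import all_boot all_order all_algebra.
From mathcomp Require Import finmap.
From mathcomp Require Import all_classical all_reals all_analysis.
Import Order.TTheory GRing.Theory Num.Theory.
Import numFieldNormedType.Exports.

Set Implicit Arguments.
Unset Strict Implicit.
Unset Printing Implicit Defensive.

Local Open Scope classical_set_scope.
Local Open Scope ring_scope.

(* [A], with the subspace topology, is homeomorphic to [0, 1], by a
   homeomorphism [h] (with inverse [g]) sending 0 to [a] and 1 to [b]. *)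
Definition arc_with_endpoints (R : realType) (T : metricType R)
    (A : set T) (a b : T) : Prop :=
  exists (h : R -> T) (g : T -> R),
    [/\ {within `[0, 1], continuous h} /\ {within A, continuous g},
        (forall t, t \in `[0, 1] -> A (h t) /\ g (h t) = t),
        (forall z, A z -> g z \in `[0, 1] /\ h (g z) = z)
      & h 0 = a /\ h 1 = b].

(* A non-empty continuum which is a finite union of arcs. All notions are
   intrinsic to [G] as a subspace of [T], so that this predicate is also the
   notion of subgraph when [T] itself is a graph. *)
Definition is_graph (R : realType) (T : metricType R) (G : set T) : Prop :=
  [/\ G !=set0, compact G, connected G &
    exists (n : nat) (A : 'I_n -> set T) (a b : 'I_n -> T),
      [/\ forall i, arc_with_endpoints (A i) (a i) (b i),
          G = \bigcup_i A i &
          forall i j, i <> j ->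
            A i `&` A j = set0 \/
            exists c, [/\ A i `&` A j = [set c],
                          c = a i \/ c = b i & c = a j \/ c = b j]]].

Definition periodic_subgraph (R : realType) (T : metricType R) (f : T -> T)
    (K : set T) (k : nat) : Prop :=
  [/\ is_graph K, (0 < k)%N,
      trivIset `I_k (fun i => iter i f @` K)
    & iter k f @` K = K].

Definition omega_limit_of (T : topologicalType) (f : T -> T) (x : T) : set T :=
  \bigcap_(n in [set n | (1 <= n)%N])
    closure [set iter m f x | m in [set m | (n <= m)%N]].

Definition omega_limit (T : topologicalType) (f : T -> T) : set T :=
  \bigcup_x omega_limit_of f x.

Definition NS_pair (R : realType) (T : metricType R) (f : T -> T)
    (x y : T) : Prop :=
  [/\ x <> y, omega_limit f x, omega_limit f y &
    exists (J : nat -> set T) (m : nat -> nat),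
      [/\ forall n, periodic_subgraph f (J n) (m n),
          forall n, J n.+1 `<=` J n,
          m @ \oo --> \oo
        & forall n, J n x /\ J n y]].

Definition independence_set (T : Type) (f : T -> T) (k : nat)
    (A : 'I_k -> set T) (I : set nat) : Prop :=
  I `<=` [set n | (0 < n)%N] /\
  forall J : set nat, finite_set J -> J !=set0 -> J `<=` I ->
  forall S : nat -> 'I_k,
    \bigcap_(i in J) (iter i f @^-1` A (S i)) !=set0.

Definition IN_pair (T : topologicalType) (f : T -> T) (x y : T) : Prop :=
  forall U1 U2 : set T, nbhs x U1 -> nbhs y U2 ->
  forall N : nat, exists2 I : {fset nat}, (N <= #|` I|)%N &
    independence_set f (tnth [tuple U1; U2]) [set` I].

Definition IT_pair (T : topologicalType) (f : T -> T) (x y : T) : Prop :=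
  forall U1 U2 : set T, nbhs x U1 -> nbhs y U2 ->
  exists2 I : set nat, infinite_set I &
    independence_set f (tnth [tuple U1; U2]) I.

(* Topological entropy of Adler, Konheim and McAndrew, through open covers. *)

Definition open_cover (T : topologicalType) (U : set (set T)) : Prop :=
  (forall A, U A -> open A) /\ \bigcup_(A in U) A = [set: T].

(* The cover consisting of the sets
   A_0 n f^-1(A_1) n ... n f^-(n-1)(A_(n-1)) with all A_i in [U]. *)
Definition iterated_join (T : Type) (f : T -> T) (U : set (set T)) (n : nat) :
    set (set T) :=
  [set \bigcap_(i < n) (iter i f @^-1` A i) |
     A in [set A : nat -> set T | forall i, U (A i)]].

(* The minimal cardinality of a finite subcover, +oo if there is none. *)
Definition cover_number (R : realType) (T : Type) (U : set (set T)) : \bar R :=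
  ereal_inf [set (#|` V|%:R)%:E | V in
    [set V : {fset (set T)} |
      [set` V] `<=` U /\ \bigcup_(A in [set` V]) A = [set: T]]].

(* By subadditivity the upper limit is a limit when [T] is compact and [f]
   is continuous; the term of index 0 is irrelevant. *)
Definition cover_entropy (R : realType) (T : Type) (f : T -> T)
    (U : set (set T)) : \bar R :=
  limn_esup (fun n : nat =>
    ((n%:R^-1)%:E * lne (cover_number R (iterated_join f U n)))%E).

Definition topological_entropy (R : realType) (T : topologicalType)
    (f : T -> T) : \bar R :=
  ereal_sup [set cover_entropy R f U | U in @open_cover T].

(* Main.v *)
(* A chart is an arc in the graph whose interior is open, and a germ at [x] is
   a chart starting at [x].

   NS => IT. For nested periodic subgraphs [J_n] containing [x] and [y], the
   cycles inside an open edge are linearly ordered. A short arc from [x] to a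
   point of an orbit accumulating at [x] meets members of a deep cycle with
   different phases, so its iterates cover the members of that cycle lying
   in between; the same holds at [y]. Choosing the leftmost member of the
   cycle, iterates of both arcs cover a common [J_k]; iterating this
   construction realizes all words over the two neighbourhoods.

   IN => NS. By a Sauer-Shelah argument the words over two neighbourhoods are
   realized from, and returning to, a single germ [c] at [x]. Few words are
   realized along an arc unless one of the iterates alternates several times
   between the two neighbourhoods; so some late iterate maps two disjoint short
   arcs of [c] over a common set: either an initial segment of [c] (inner), at
   all scales, or [c] minus an initial segment (outer), at all scales. If one of the common sets has an orbit which
   sweeps an initial segment of [c] infinitely often, then [f] has a horseshoe
   and positive entropy. A monotone family of forward invariant sets with
   boundedly many components changes only near finitely many points, and an
   orbit confined there shadows the orbit of [x], so it cannot visit [x] and [y]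
   at the same time; hence the sweeping takes place in the outer case, and in
   the inner case when the orbits of the segments [c [0, e]] have boundedly many
   components. In the remaining case the components of the closures of these
   orbits are permuted cyclically with unbounded periods, and the maximal
   invariant subsets of those containing [x] are the required subgraphs. *)

Require Import Defs.
From HB Require Import structures.
From mathcomp Require Import all_boot all_order all_algebra.
From mathcomp Require Import finmap zify ring lra.
From mathcomp Require Import all_classical all_reals all_analysis.
Import Order.TTheory GRing.Theory Num.Theory.
Import numFieldNormedType.Exports.
Set Implicit Arguments.
Unset Strict Implicit.
Unset Printing Implicit Defensive.
Local Open Scope classical_set_scope.
Local Open Scope ring_scope.

(** * Charts *)

Section Charts.
Context (R : realType) (T : metricType R).
Implicit Types (h : R -> T) (S : set T).

(** Branch points rule out interval arguments on the whole graph. The one local tool is that a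
    connected set which meets an open arc and also leaves it fills the arc up to one of its ends.
    Which end is filled cannot be prescribed: this is the origin of the inner and outer cases, and
    the reason why three arcs are produced in order to have two of the same kind. Zero entropy
    enters only through [no_horseshoe], where the two sets may have different covering times. The
    finiteness statements rest on one fact: a union of [N] connected sets cannot alternate with its
    complement more than [N] times along a chart. In the last case two obstacles remain. Closures of
    different components can touch, which is repaired by passing to a smaller scale. A component is
    mapped into itself but perhaps not onto, which is repaired by its maximal invariant subset.
    Membership of [x] in the limit set is read off the inner coverings at [x]; that of [y] follows
    by exchanging the two points. *)

Definition ioo h (a b : R) : set T := h @` [set s | a < s < b].
Definition icc h (a b : R) : set T := h @` [set s | a <= s <= b].

(** Continuity is asked on the whole line, which avoids subspace topologies; only the values on
    [0, 1] matter. Openness says that branch points of the graph can lie only at the two ends. *)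
Definition chart h :=
  [/\ continuous h,
      forall s t, 0 <= s <= 1 -> 0 <= t <= 1 -> h s = h t -> s = t
    & forall a b, 0 <= a -> b <= 1 -> open (ioo h a b)].

Lemma icc_compact h a b : continuous h -> compact (icc h a b).
Proof.
move=> ch; rewrite /icc -[[set s | _]]set_itvcc.
apply: continuous_compact; last exact: segment_compact.
exact: continuous_subspaceT.
Qed.

Lemma icc_closed h a b : continuous h -> closed (icc h a b).
Proof.
move=> ch; apply: compact_closed; first exact: metric_hausdorff.
exact: icc_compact.
Qed.

Lemma icc_connected h a b : continuous h -> connected (icc h a b).
Proof.
move=> ch; rewrite /icc -[[set s | _]]set_itvcc.
apply: connected_continuous_connected; first exact: segment_connected.
exact: continuous_subspaceT.
Qed.

(** The part of [S] in the open arc is relatively clopen: open because the arc is, closed because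
    missing both ends lets [icc] replace [ioo]. This plays the role of the intermediate value
    theorem and needs nothing about the graph outside the chart. *)
Lemma trap h S (g s g' : R) : chart h -> connected S -> 0 <= g -> g' <= 1 ->
  g < s < g' -> S (h s) -> ~ S (h g) -> ~ S (h g') -> S `<=` ioo h g g'.
Proof.
move=> [ch hi ho] cS g0 g1 /andP[gs sg'] Ss Sg Sg'.
suff -> : S = S `&` ioo h g g' by apply: subIsetr.
apply/esym/cS.
- by exists (h s); split => //; exists s => //=; rewrite gs.
- by exists (ioo h g g') => //; exact: ho.
- exists (icc h g g'); first exact: icc_closed.
  apply/seteqP; split => z [Sz [u /= /andP[u1 u2] uz]].
    by split => //; exists u => //=; rewrite !ltW.
  split => //; exists u => //=; rewrite !lt_neqAle u1 u2 !andbT.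
  apply/andP; split; apply/eqP => e.
    by apply: Sg; rewrite e uz.
  by apply: Sg'; rewrite -e uz.
Qed.

Lemma chart_inj h s t : chart h -> 0 <= s <= 1 -> 0 <= t <= 1 ->
  h s = h t -> s = t.
Proof. by case=> _ + _; apply. Qed.

Lemma chart_cont h : chart h -> continuous h. Proof. by case. Qed.

Lemma ioo_mem h a b s : chart h -> 0 <= a -> b <= 1 -> 0 <= s <= 1 ->
  ioo h a b (h s) -> a < s < b.
Proof.
move=> ch a0 b1 s01 [u /= uab us].
have -> // : s = u.
by apply: (chart_inj ch) => //; case/andP: uab => ? ?; apply/andP; split; lra.
Qed.

Lemma icc_mem h a b s : chart h -> 0 <= a -> b <= 1 -> 0 <= s <= 1 ->
  icc h a b (h s) -> a <= s <= b.
Proof.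
move=> ch a0 b1 s01 [u /= uab us].
have -> // : s = u.
by apply: (chart_inj ch) => //; case/andP: uab => ? ?; apply/andP; split; lra.
Qed.

Lemma trap_out h S (g s g' : R) z : chart h -> connected S -> 0 <= g ->
  g' <= 1 -> g < s < g' -> S (h s) -> S z -> ~ ioo h g g' z ->
  S (h g) \/ S (h g').
Proof.
move=> hc cS g0 g1 gsg Ss Sz nz; apply: contrapT => /not_orP[a b].
by apply: nz; exact: (trap hc cS g0 g1 gsg Ss a b).
Qed.

(** Missing one point on each side of [s] would trap [S] between them, away from [z]. *)
Lemma leave h S (s d : R) z : chart h -> connected S -> d <= 1 -> 0 < s < d ->
  S (h s) -> S z -> ~ ioo h 0 d z ->
  (forall u, 0 < u <= s -> S (h u)) \/ (forall u, s <= u < d -> S (h u)).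
Proof.
move=> hc cS d1 /andP[s0 sd] Ss Sz nz.
apply: contrapT => /not_orP[/existsNP[u /not_implyP[/andP[u0 us] Su]]].
move=> /existsNP[v /not_implyP[/andP[sv vd] Sv]].
have us' : u < s by rewrite lt_neqAle us andbT; apply/eqP => e; apply: Su; rewrite e.
have sv' : s < v by rewrite lt_neqAle sv andbT; apply/eqP => e; apply: Sv; rewrite -e.
have [] := @trap_out h S u s v z hc cS _ _ _ Ss Sz _ => //.
- exact: ltW.
- lra.
- by rewrite us'.
- move=> [w /= /andP[w1 w2] wz]; apply: nz; exists w => //=; apply/andP; split; lra.
Qed.

Lemma between h S a b (u w v : R) : chart h -> connected S -> 0 <= a ->
  b <= 1 -> S `<=` ioo h a b -> a < u -> v < b -> S (h u) -> S (h v) ->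
  u <= w <= v -> S (h w).
Proof.
move=> hc cS a0 b1 Sab au vb Su Sv /andP[uw wv]; apply: contrapT => Sw.
have uw' : u < w by rewrite lt_neqAle uw andbT; apply/eqP => e; apply: Sw; rewrite -e.
have Sa : ~ S (h a).
  move=> /Sab /(ioo_mem hc a0 b1) => aab; suff : a < a < b by rewrite ltxx.
  by apply: aab; apply/andP; split; lra.
have w1 : w <= 1 by lra.
have auw : a < u < w by rewrite au.
have : a < v < w.
  apply: (@ioo_mem h) => //; first by apply/andP; split; lra.
  exact: (trap hc cS a0 w1 auw Su Sa Sw).
by move=> /andP[_]; lra.
Qed.

(** If [s] is missing, then [S] has points [s2 < s] and [s1 > s]. It cannot pass through [s], so it
    must fill everything below [s2]. *)
Lemma initial_arc h S : chart h -> connected S ->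
  (forall e, 0 < e -> exists2 s, 0 < s < e & S (h s)) ->
  exists2 d, 0 < d <= 1 & forall s, 0 < s < d -> S (h s).
Proof.
move=> hc cS acc.
have [s1 /andP[s10 s11] Ss1] := acc 1 ltr01.
have [all_in|/existsNP[s /not_implyP[/andP[s0 ss1] Ss]]] :=
  pselect (forall s, 0 < s < s1 -> S (h s)).
  by exists s1 => //; rewrite s10 ltW.
have [s2 /andP[s20 s2s] Ss2] := acc s s0.
exists s2; first by apply/andP; split; lra.
move=> u /andP[u0 us2].
have [| | | |//|//] := @trap_out h S u s2 s (h s1) hc cS _ _ _ Ss2 Ss1 _; [lra|lra|lra|].
move=> /(ioo_mem hc) H; have : u < s1 < s by apply: H; lra.
lra.
Qed.

End Charts.

(** * Words and independence *)

Section Words.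
Context (W : Type).
Implicit Types (Z : set W) (P Q : nat -> set W) (I J : seq nat).

Definition realizes P Q (s : nat -> bool) I (z : W) :=
  forall i, i \in I -> if s i then P i z else Q i z.

Definition indep Z P Q I := forall s : nat -> bool,
  exists2 z, Z z & realizes P Q s I z.

Lemma indep_sub Z P Q I J : {subset J <= I} -> indep Z P Q I -> indep Z P Q J.
Proof. by move=> JI ind s; have [z Zz rz] := ind s; exists z => // i /JI /rz. Qed.

Lemma indep_subZ Z Z' P Q I : Z `<=` Z' -> indep Z P Q I -> indep Z' P Q I.
Proof. by move=> ZZ' ind s; have [z /ZZ' Zz rz] := ind s; exists z. Qed.

Definition glue I1 (s1 s2 : nat -> bool) i := if i \in I1 then s1 i else s2 i.

Lemma indep_glue Z P Q I1 I2 s1 : uniq (I1 ++ I2) -> indep Z P Q (I1 ++ I2) ->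
  indep [set z | Z z /\ realizes P Q s1 I1 z] P Q I2.
Proof.
rewrite cat_uniq => /and3P[_ /hasPn d _] ind s2.
have [z Zz rz] := ind (glue I1 s1 s2); exists z.
  split => // i i1; have := rz i; rewrite mem_cat i1 /glue i1 /=; exact.
by move=> i i2; have := rz i; rewrite mem_cat i2 orbT /glue (negbTE (d _ i2)); exact.
Qed.

(** Induction on the colours. If the first colour misses a word [s1] on the first [a] indices,
    fixing [s1] there leaves all words on the remaining indices to points of the other colours. *)
Lemma shatter (C : eqType) (cs : seq C) (col : W -> C) a Z P Q I :
  uniq I -> (size cs * a <= size I)%N -> (forall z, Z z -> col z \in cs) ->
  indep Z P Q I -> exists c J, [/\ {subset J <= I}, uniq J, (a <= size J)%N &
    indep [set z | Z z /\ col z = c] P Q J].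
Proof.
elim: cs Z I => [|c cs IH] Z I uI sI Zc ind.
  by have [z /Zc] := ind xpredT.
rewrite /= mulSn in sI.
have uI' := uI; rewrite -(cat_take_drop a I) in uI'.
have [h|] := pselect (indep [set z | Z z /\ col z = c] P Q (take a I)).
  exists c, (take a I); split => //; [exact: mem_take|exact: take_uniq|].
  by rewrite size_takel//; lia.
move=> /existsNP[s1 ns1].
have ind' := ind; rewrite -(cat_take_drop a I) in ind'.
have [||z [Zz rz]|c' [J [JI uJ sJ indJ]]] := IH _ (drop a I) _ _ _
    (indep_glue s1 uI' ind').
- exact: drop_uniq.
- by rewrite size_drop; lia.
- have := Zc z Zz; rewrite inE => /orP[/eqP e|//].
  by exfalso; apply: ns1; exists z.
- exists c', J; split => //; first by move=> i /JI /mem_drop.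
  by apply: indep_subZ indJ => z [[]].
Qed.

End Words.

Lemma pigeon_seq (C : eqType) (cs : seq C) (col : nat -> C) a (I : seq nat) :
  uniq I -> (size cs * a <= size I)%N -> (0 < size I)%N ->
  (forall i, i \in I -> col i \in cs) ->
  exists c J, [/\ {subset J <= I}, uniq J, (a <= size J)%N &
    forall i, i \in J -> col i = c].
Proof.
elim: cs I => [|c cs IH] I uI sI I0 Ic.
  by case: I I0 Ic {uI sI} => // i I _ /(_ i); rewrite mem_head => /(_ isT).
have [le|lt] := leqP a (count (fun i => col i == c) I).
  exists c, [seq i <- I | col i == c]; split.
  - by move=> i; rewrite mem_filter => /andP[].
  - exact: filter_uniq.
  - by rewrite size_filter.
  - by move=> i; rewrite mem_filter => /andP[/eqP].
pose I' := [seq i <- I | col i != c].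
have sI' : (size I' = size I - count (fun i => col i == c) I)%N.
  rewrite size_filter -(count_predC (fun i => col i == c) I) addKn.
  by apply: eq_count.
rewrite /= mulSn in sI.
have [||||c' [J [JI uJ sJ Jc]]] := IH I'.
- exact: filter_uniq.
- by rewrite sI'; lia.
- by rewrite sI'; lia.
- move=> i; rewrite mem_filter => /andP[ic /Ic]; rewrite inE.
  by rewrite (negbTE ic).
- by exists c', J; split => // i /JI; rewrite mem_filter => /andP[].
Qed.

Section Split.
Context (W : Type).
Implicit Types (Z : set W) (P Q : nat -> set W) (I J : seq nat).

Definition subI a Z P Q I := exists J,
  [/\ {subset J <= I}, uniq J, (a <= size J)%N & indep Z P Q J].

(* Each word [s] on the second block selects a subset of the first block on
   which the alternative letter [P'] is independent; by [shatter] the same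
   subset [J] serves all words on a large part of the second block. Either
   [J] can be extended, or a fixed word on [J] forces the letter [P]. *)
Lemma split_letter a b : exists k, forall Z P P' Q I, uniq I ->
  (k <= size I)%N -> indep Z (fun i => P i `|` P' i) Q I ->
  subI a Z P Q I \/ subI b Z P' Q I.
Proof.
elim: b => [|b [k1 IH]].
  exists 0%N => Z P P' Q I _ _ ind; right; exists [::]; split => // s.
  by have [z Zz _] := ind s; exists z.
(* Masks of the first block are the colours for [shatter], words on that block those for
   [pigeon_seq]. The successor keeps [I3] non-empty even when [a] is 0. *)
pose N2 := (#|{: k1.-tuple bool}| * (#|{: {ffun 'I_k1 -> bool}}| * a.+1))%N.
exists (k1 + N2)%N => Z P P' Q I uI sI ind.
have [done|nleft] := pselect (subI a Z P Q I); [by left|right].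
pose I1 := take k1 I; pose I2 := drop k1 I.
have eI : I = I1 ++ I2 by rewrite cat_take_drop.
have sI1 : size I1 = k1 by rewrite size_takel//; lia.
have uI12 : uniq (I1 ++ I2) by rewrite -eI.
have uI21 : uniq (I2 ++ I1) by rewrite uniq_catC.
have ind21 : indep Z (fun i => P i `|` P' i) Q (I2 ++ I1).
  by apply: indep_sub ind => i; rewrite eI !mem_cat orbC.
pose PP i : set W := P i `|` P' i.
pose good (s : nat -> bool) (t : k1.-tuple bool) :=
  (b <= size (mask t I1))%N /\
  indep [set z | Z z /\ realizes PP Q s I2 z] P' Q (mask t I1).
have tP s : exists t, good s t.
  have [|||[J [JI uJ sJ indJ]]] := IH _ P P' Q I1 _ _ (indep_glue s uI21 ind21).
  - exact: take_uniq.
  - by rewrite sI1.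
  - move=> [J [JI uJ sJ indJ]]; exfalso; apply: nleft; exists J; split => //.
      by move=> i /JI iI; rewrite eI mem_cat iI.
    by apply: indep_subZ indJ => z [].
  have st : size [seq i \in J | i <- I1] == k1 by rewrite size_map sI1.
  exists (Tuple st) => /=.
  have em : mask [seq i \in J | i <- I1] I1 =i J.
    rewrite -filter_mask => i; rewrite mem_filter andb_idr//; exact: JI.
  split; last by apply: indep_sub indJ => i; rewrite em.
  apply: leq_trans sJ _; apply: uniq_leq_size => // i; by rewrite em.
pose col s := projT1 (cid (tP s)).
have colP s : good s (col s) by rewrite /col; case: cid.
have [||||t [I3 [I32 uI3 sI3 ind3]]] := @shatter (nat -> bool) _
  (enum {: k1.-tuple bool}) col (#|{: {ffun 'I_k1 -> bool}}| * a.+1) setT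
  (fun i => [set s | s i]) (fun i => [set s | ~~ s i]) I2.
- by move: uI12; rewrite cat_uniq => /and3P[].
- rewrite -cardE -/N2 size_drop; lia.
- by move=> s _; rewrite mem_enum.
- by move=> s; exists s => // i _; case: ifPn.
pose J : seq nat := mask t I1.
have JI1 : {subset J <= I1} by move=> i /mem_mask.
have uJ : uniq J by apply: mask_uniq; exact: take_uniq.
have dJ i : i \in I2 -> i \notin J.
  move=> i2; apply/negP => /JI1 i1; move: uI12.
  by rewrite cat_uniq => /and3P[_ /hasPn /(_ i i2)]; rewrite /= i1.
have star s3 s1 : exists z, [/\ Z z, realizes PP Q s3 I3 z & realizes P' Q s1 J z].
  have [s [_ cs] rs] := ind3 s3.
  have [_] := colP s; rewrite cs => /(_ s1)[z [Zz rz] rz'].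
  exists z; split => // i i3; have := rz i (I32 i i3); have := rs i i3.
  by case: (s3 i) => /=; case: (s i).
have bJ : (b <= size J)%N.
  have [s [_ cs] rs] := ind3 xpredT.
  by have [] := colP s; rewrite cs.
have [[p p3 pP]|np] := pselect (exists2 p, p \in I3 & forall s1,
    exists z, [/\ Z z, realizes P' Q s1 J z & P' p z]).
  exists (p :: J); split => /=.
  - move=> i; rewrite inE eI mem_cat => /predU1P[->|/JI1->//].
    by rewrite (I32 p p3) orbT.
  - by rewrite uJ dJ// I32.
  - by rewrite ltnS.
  - move=> s; case sp : (s p).
      have [z [Zz rz Pz]] := pP s; exists z => // i.
      by rewrite inE => /predU1P[->|/rz//]; rewrite sp.
    have [z [Zz rz rz']] := star s s; exists z => // i.
    by rewrite inE => /predU1P[->|/rz'//]; have := rz p p3; rewrite sp.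
(* The excluding word is recorded as a function of positions in [I1]. These form a finite type, so
   one word excludes [P'] at many indices [p]. *)
have wP p : exists s1 : {ffun 'I_k1 -> bool}, p \in I3 -> forall z, Z z ->
    realizes P' Q (fun i => nth false [seq s1 j | j <- enum 'I_k1] (index i I1)) J z -> ~ P' p z.
  have [p3|] := boolP (p \in I3); last by exists [ffun=> false].
  have [s1 Hs1] : exists s1, forall z, Z z -> realizes P' Q s1 J z -> ~ P' p z.
    apply: contrapT => /forallNP H; apply: np; exists p => // s1.
    have /existsNP[z /not_implyP[Zz /not_implyP[rz /contrapT Pz]]] := H s1.
    by exists z.
  exists [ffun j : 'I_k1 => s1 (nth 0%N I1 j)] => _ z Zz rz; apply: Hs1 => // i iJ.
  have i1 := JI1 i iJ.
  have ii : (index i I1 < k1)%N by rewrite -sI1 index_mem.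
  have := rz i iJ; rewrite (nth_map (Ordinal ii)) ?size_enum_ord// ffunE.
  by rewrite nth_enum_ord// nth_index.
pose wc p := projT1 (cid (wP p)).
have [|||c [I4 [I43 uI4 sI4 I4c]]] := @pigeon_seq _
    (enum {: {ffun 'I_k1 -> bool}}) wc a.+1 I3 uI3.
- by rewrite -cardE.
- apply: leq_trans sI3; rewrite muln_gt0 andbT.
  by apply/card_gt0P; exists [ffun=> false].
- by move=> i _; rewrite mem_enum.
exfalso; apply: nleft; exists I4; split => //.
- by move=> i /I43 /I32 i2; rewrite eI mem_cat i2 orbT.
- exact: ltnW.
move=> s.
have [z [Zz rz rz']] := star s
  (fun i => nth false [seq c j | j <- enum 'I_k1] (index i I1)).
exists z => // i i4.
have := projT2 (cid (wP i)) (I43 i i4) z Zz; rewrite -/(wc i) (I4c i i4) => /(_ rz').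
by have := rz i (I43 i i4); case: (s i) => // -[].
Qed.

Lemma split_letters (C : eqType) (cs : seq C) a : exists k,
  forall Z (P : C -> nat -> set W) Q I, uniq I -> (k <= size I)%N ->
  indep Z (fun i => [set z | exists2 c, c \in cs & P c i z]) Q I ->
  exists2 c, c \in cs & subI a Z (P c) Q I.
Proof.
elim: cs => [|c cs [k IH]].
  exists 1%N => Z P Q [//|i I] _ _ /(_ xpredT)[z _ /(_ i)].
  by rewrite mem_head => /(_ isT)[].
have [k' k'P] := split_letter a k.
exists k' => Z P Q I uI sI ind.
have [||] := k'P Z (P c) (fun i => [set z | exists2 c, c \in cs & P c i z]) Q I uI sI.
- move=> s; have [z Zz rz] := ind s; exists z => // i /rz.
  by case: (s i) => //= -[c']; rewrite inE => /predU1P[->|c'cs] Pz; [left|right; exists c'].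
- by exists c => //; rewrite mem_head.
move=> [J [JI uJ sJ indJ]].
have [c' c'cs [J' [J'J uJ' sJ' indJ']]] := IH _ _ _ _ uJ sJ indJ.
exists c'; first by rewrite inE c'cs orbT.
by exists J'; split => // i /J'J /JI.
Qed.

End Split.

(** * Horseshoes *)

Section Horseshoe.
Context (R : realType) (T : topologicalType) (f : T -> T).

Lemma horseshoe_itinerary (K : bool -> set T) N :
  (forall b, K b !=set0) ->
  (forall b b', K b' `<=` iter N f @` K b) ->
  forall q (s : nat -> bool), exists2 z, K (s 0%N) z &
    forall i, (i < q)%N -> K (s i) (iter (N * i) f z).
Proof.
move=> K0 KK; elim=> [|q IH] s.
  by have [z Kz] := K0 (s 0%N); exists z.
have [z Kz zs] := IH (fun i => s i.+1).
have [w Kw wz] := KK (s 0%N) (s 1%N) z Kz.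
exists w => // -[|i] iq; first by rewrite muln0.
by rewrite mulnS addnC iterD wz; exact: zs.
Qed.

Definition disjoint_cover (K : bool -> set T) : set (set T) :=
  [set A | exists b, A = ~` K b].

(** At time [N * j] a member of the join avoids one of the two sets, which fixes the letter [j] of
    every chosen point in it. So it contains at most one of the [2 ^ q] points. *)
Lemma horseshoe_cover_number (K : bool -> set T) N q : (0 < N)%N ->
  (forall b, K b !=set0) -> K false `&` K true = set0 ->
  (forall b b', K b' `<=` iter N f @` K b) ->
  (((2 ^ q)%:R%:E : \bar R) <=
    cover_number R (iterated_join f (disjoint_cover K) (N * q)%N))%E.
Proof.
move=> N0 K0 dK KK; apply: le_ereal_inf_tmp => _ [V [VU Vc] <-].
rewrite lee_fin ler_nat.
pose word (w : {ffun 'I_q -> bool}) (i : nat) : bool :=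
  if insub i is Some j then w j else false.
have ptP w : exists z, forall i, (i < q)%N -> K (word w i) (iter (N * i) f z).
  by have [z _ zs] := horseshoe_itinerary K0 KK q (word w); exists z.
pose pt w := projT1 (cid (ptP w)).
have ptE w i : (i < q)%N -> K (word w i) (iter (N * i) f (pt w)).
  by rewrite /pt; case: cid => z /= zs; exact: zs.
have elP w : exists A : V, (val A) (pt w).
  have : [set: T] (pt w) by [].
  by rewrite -Vc => -[A AV Az]; exists (FSetSub AV).
pose el w := projT1 (cid (elP w)).
have elE w : (val (el w)) (pt w) by rewrite /el; case: cid.
have inj : injective el.
  move=> w w' e; apply/ffunP => j; apply: contrapT => wj.
  have [A AU eA] := VU _ (valP (el w)).
  have jN : (N * j < N * q)%N by rewrite ltn_mul2l N0 ltn_ord.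
  have Ew := elE w; have Ew' := elE w'; rewrite -e in Ew'.
  rewrite -eA in Ew Ew'.
  have [b Ab] := AU (N * j)%N.
  have := Ew _ jN; have := Ew' _ jN; rewrite /preimage /= Ab.
  have := ptE w j (ltn_ord j); have := ptE w' j (ltn_ord j).
  rewrite /word valK.
  by clear Ab; move: wj; case: (w j); case: (w' j) => //; case: b.
have := leq_card el inj; rewrite card_ffun card_bool card_ord.
by rewrite -cardfE.
Qed.

Lemma horseshoe_entropy (K : bool -> set T) N : (0 < N)%N ->
  (forall b, closed (K b)) ->
  (forall b, K b !=set0) -> K false `&` K true = set0 ->
  (forall b b', K b' `<=` iter N f @` K b) ->
  topological_entropy R f <> 0%E.
Proof.
move=> N0 Kcl K0 dK KK.
pose U := disjoint_cover K.
have Uc : open_cover U.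
  split; first by move=> _ [b ->]; exact: closed_openC.
  apply/seteqP; split => // z _; have [Kz|Kz] := pselect (K false z).
    exists (~` K true); first by exists true.
    by move=> Kz'; have : (K false `&` K true) z by []; rewrite dK.
  by exists (~` K false) => //; exists false.
pose c : R := ln 2 / N%:R.
have c0 : 0 < c by rewrite divr_gt0 ?ltr0n// ln_gt0// ltr1n.
suff cle : (c%:E <= cover_entropy R f U)%E.
  move=> e0.
  have := le_trans cle (@ereal_sup_ubound _
      [set cover_entropy R f U | U in @open_cover T] _ (ex_intro2 _ _ U Uc erefl)).
  by rewrite -/(topological_entropy R f) e0 lee_fin leNgt c0.
rewrite /cover_entropy limn_esup_lim; apply: lime_ge; first exact: is_cvg_esups.
apply: nearW => n; apply: ereal_sup_ge.
(* The upper limit is bounded below along multiples of [N], where the cover number is at least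
   [2 ^ n.+1]. *)
pose m := (N * n.+1)%N.
exists ((m%:R^-1)%:E * lne (cover_number R (iterated_join f U m)))%E.
  by exists m => //=; rewrite /m; nia.
apply: (@le_trans _ _ ((m%:R^-1)%:E * lne ((2 ^ n.+1)%:R%:E))%E).
  rewrite lne_EFin ?ltr0n ?expn_gt0// natrX lnXn ?ltr0n// -EFinM lee_fin.
  suff -> : c = m%:R^-1 * (ln 2 *+ n.+1) by [].
  rewrite /m /c natrM -mulr_natr; field.
  by rewrite !pnatr_eq0 -lt0n N0 andbT addrC natr1 pnatr_eq0.
rewrite lee_pmul2l ?lte_fin ?invr_gt0 ?ltr0n /m; [|by []|nia].
rewrite lee_lne.
  exact: horseshoe_cover_number.
all: rewrite in_itv/= leey andbT.
  by rewrite lee_fin ler0n.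
apply: le_trans (horseshoe_cover_number n.+1 N0 K0 dK KK).
by rewrite lee_fin ler0n.
Qed.

End Horseshoe.

Section Covering.
Context (T : Type) (f : T -> T).

Lemma iter_mul_cover (A B : set T) a n : (0 < n)%N ->
  A `<=` iter a f @` A -> B `<=` iter a f @` A ->
  B `<=` iter (a * n) f @` A.
Proof.
move=> + AA BA; elim: n => // -[|n] IH _.
  by rewrite muln1.
move=> z /(IH isT)[w /AA[u Au uw] wz]; exists u => //.
by rewrite mulnS addnC iterD uw.
Qed.

End Covering.

Section NoHorseshoe.
Context (R : realType) (T : topologicalType).

Definition no_horseshoe (f : T -> T) := forall (A B : set T) (a b : nat),
  closed A -> closed B -> A !=set0 -> B !=set0 -> A `&` B = set0 ->
  (0 < a)%N -> (0 < b)%N ->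
  A `|` B `<=` iter a f @` A -> A `|` B `<=` iter b f @` B -> False.

(** Each set also covers itself, so it can wait: both coverings are available at the common time
    [a * b]. *)
Lemma zero_entropy_no_horseshoe (f : T -> T) :
  topological_entropy R f = 0%E -> no_horseshoe f.
Proof.
move=> e0 A B a b clA clB A0 B0 dAB a0 b0 AB BA; move: e0.
apply: (@horseshoe_entropy R T f (fun c => if c then B else A) (a * b)%N).
- by rewrite muln_gt0 a0.
- by case.
- by case.
- by [].
- have sub C D : C `|` D `<=` iter a f @` C -> (C `<=` iter a f @` C) * (D `<=` iter a f @` C).
    by move=> H; split => z Hz; apply: H; [left|right].
  have subB : (A `<=` iter b f @` B) * (B `<=` iter b f @` B).
    by split => z Hz; apply: BA; [left|right].
  have subA := sub _ _ AB.
  move=> [] [] /=.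
  - by rewrite mulnC; apply: (@iter_mul_cover _ f B _ b a a0); case: subB.
  - by rewrite mulnC; apply: (@iter_mul_cover _ f B _ b a a0); case: subB.
  - by apply: (@iter_mul_cover _ f A _ a b b0); case: subA.
  - by apply: (@iter_mul_cover _ f A _ a b b0); case: subA.
Qed.

End NoHorseshoe.

(** * The atlas of a graph *)

Section Graph.
Context (R : realType) (T : metricType R).

Definition clamp (s : R) : R := Num.max 0 (Num.min s 1).

Lemma clamp01 s : 0 <= clamp s <= 1.
Proof.
by rewrite /clamp maxEle minEle; case: (lerP s 1) => ?; case: ifP => ?; apply/andP; split; lra.
Qed.

Lemma clamp_id s : 0 <= s <= 1 -> clamp s = s.
Proof.
by rewrite /clamp maxEle minEle => /andP[s0 s1]; rewrite s1 s0.
Qed.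

Lemma clamp_continuous : continuous clamp.
Proof.
move=> s; apply: (@continuous_max R R (fun=> 0) (fun s => Num.min s 1)).
  exact: cvg_cst.
by apply: (@continuous_min R R id (fun=> 1)); [exact: cvg_id|exact: cvg_cst].
Qed.

(* The arcs of a graph, parametrized by charts extended constantly to the
   whole line. *)
Definition graph_atlas n (h : 'I_n -> R -> T) (g : 'I_n -> T -> R) :=
  [/\ forall i, chart (h i),
      forall z, exists i s, 0 <= s <= 1 /\ z = h i s,
      forall i, {within icc (h i) 0 1, continuous (g i)},
      forall i s, 0 <= s <= 1 -> g i (h i s) = s &
      forall i j s t, i <> j -> 0 <= s <= 1 -> 0 <= t <= 1 -> h i s = h j t ->
        [/\ s = 0 \/ s = 1, t = 0 \/ t = 1 &
          forall s' t' : R, 0 <= s' <= 1 -> 0 <= t' <= 1 -> h i s' = h j t' ->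
            h i s' = h i s]].

Lemma graph_has_atlas : is_graph [set: T] ->
  exists n (h : 'I_n -> R -> T) g, graph_atlas h g.
Proof.
move=> [_ _ _ [n [A [a [b [arcs cover cap]]]]]].
pose h0 i := projT1 (cid (arcs i)).
have h0P i : exists g : T -> R, [/\ {within `[0, 1], continuous (h0 i)} /\ {within A i, continuous g},
    (forall t : R, t \in `[0, 1] -> A i (h0 i t) /\ g (h0 i t) = t),
    (forall z, A i z -> g z \in `[0, 1] /\ h0 i (g z) = z)
    & h0 i 0 = a i /\ h0 i 1 = b i].
  exact: (projT2 (cid (arcs i))).
pose g i := projT1 (cid (h0P i)).
have gP i : [/\ {within `[0, 1], continuous (h0 i)} /\ {within A i, continuous (g i)},
    (forall t : R, t \in `[0, 1] -> A i (h0 i t) /\ g i (h0 i t) = t),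
    (forall z, A i z -> g i z \in `[0, 1] /\ h0 i (g i z) = z)
    & h0 i 0 = a i /\ h0 i 1 = b i].
  exact: (projT2 (cid (h0P i))).
pose h i s := h0 i (clamp s).
have mem01 (s : R) : 0 <= s <= 1 -> s \in `[0, 1] by rewrite in_itv.
have hc i : continuous (h i).
  have [[ch _] _ _ _] := gP i; move=> s.
  apply: (@cvg_comp _ _ _ clamp (h0 i) _ (within `[0, 1]%classic (nbhs (clamp s)))).
    move=> U /= /clamp_continuous; rewrite !nbhs_simpl /=.
    by apply: filterS => t; apply => /=; apply: mem01; exact: clamp01.
  have /subspace_continuousP := ch; apply.
  by apply: mem01; exact: clamp01.
have hA i : icc (h i) 0 1 = A i.
  have [_ hA gA _] := gP i.
  apply/seteqP; split => z.
    by move=> [s /= s01 <-]; rewrite /h clamp_id//; have [] := hA s (mem01 s s01).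
  move=> /gA[g01 <-]; exists (g i z); last by rewrite /h clamp_id.
  by move: g01; rewrite in_itv.
have gh i (s : R) : 0 <= s <= 1 -> g i (h i s) = s.
  by move=> s01; have [_ + _ _] := gP i => /(_ s (mem01 s s01))[_]; rewrite /h clamp_id.
have hab i (s : R) : 0 <= s <= 1 -> h i s = a i \/ h i s = b i -> s = 0 \/ s = 1.
  move=> s01; have [_ _ _ [<- <-]] := gP i.
  have e0 : h0 i 0 = h i 0 by rewrite /h clamp_id// lexx ler01.
  have e1 : h0 i 1 = h i 1 by rewrite /h clamp_id// lexx ler01.
  rewrite e0 e1 => -[] /(congr1 (g i)); rewrite !gh ?lexx ?ler01//; tauto.
have capP i j (s t : R) : i <> j -> 0 <= s <= 1 -> 0 <= t <= 1 -> h i s = h j t ->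
    [/\ s = 0 \/ s = 1, t = 0 \/ t = 1 &
      forall s' t' : R, 0 <= s' <= 1 -> 0 <= t' <= 1 -> h i s' = h j t' ->
        h i s' = h i s].
  move=> ij s01 t01 e.
  have inA k (u : R) : 0 <= u <= 1 -> A k (h k u) by move=> u01; rewrite -hA; exists u.
  have Aij : (A i `&` A j) (h i s) by split; [exact: inA|rewrite e; exact: inA].
  have [c0|[c [ec ci cj]]] := cap i j ij; first by rewrite c0 in Aij.
  have es : h i s = c by rewrite ec in Aij.
  split.
  - by apply: (hab i) => //; rewrite es.
  - by apply: (hab j) => //; rewrite -e es.
  - move=> s' t' s'01 t'01 e'; rewrite es.
    have : (A i `&` A j) (h i s') by split; [exact: inA|rewrite e'; exact: inA].
    by rewrite ec.
have hcov z : exists i (s : R), 0 <= s <= 1 /\ z = h i s.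
  have : [set: T] z by [].
  by rewrite cover => -[i _]; rewrite -hA => -[s s01 <-]; exists i, s.
exists n, h, g; split => //; last by move=> i; rewrite hA; have [[]] := gP i.
move=> i; split => //; first by move=> s t s01 t01 /(congr1 (g i)); rewrite !gh.
move=> u v u0 v1 /=.
have [uv|vu] := ltP u v; last first.
  suff -> : ioo (h i) u v = set0 by exact: open0.
  by rewrite -subset0 => z [s /= /andP[us sv] _]; move: (lt_trans us sv); rewrite ltNge vu.
(* The complement of the open arc is a finite union of closed arcs, since the other arcs meet this
   one only at its ends. *)
pose D := icc (h i) 0 u `|` icc (h i) v 1 `|`
  \bigcup_(j in [set j | j != i]) icc (h j) 0 1.
suff -> : ioo (h i) u v = ~` D.
  apply: closed_openC; apply: closedU.
    by apply: closedU; exact: icc_closed.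
  by apply: closed_bigcup => [|j _];  [exact: finite_finset|];  exact: icc_closed.
apply/seteqP; split => z.
  move=> [w /= /andP[uw wv] wz]; have w01 : 0 <= w <= 1.
    by rewrite (le_trans u0 (ltW uw)) (le_trans (ltW wv) v1).
  move=> [[[s /= s01 sz]|[s /= s01 sz]]|[j /= ji [s /= s01 sz]]].
  - have /andP[s0 su] := s01; have s11 : 0 <= s <= 1.
      by rewrite s0 (le_trans su)// ltW// (lt_le_trans uv).
    have e : s = w by rewrite -(gh i s)// sz -wz gh.
    by move: uw; rewrite -e ltNge su.
  - have /andP[vs s1] := s01; have s11 : 0 <= s <= 1.
      by rewrite s1 (le_trans _ vs)// ltW// (le_lt_trans u0).
    have e : s = w by rewrite -(gh i s)// sz -wz gh.
    by move: wv; rewrite -e ltNge vs.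
  - have [|//|//||w01' _ _] := capP i j w s.
    + by move=> ij; rewrite ij eqxx in ji.
    + by rewrite wz sz.
    + case: w01' => e; move: uw wv; rewrite e; first by rewrite ltNge u0.
      by rewrite (ltNge 1) v1.
move=> /not_orP[/not_orP[n1 n2] n3].
have [j [s [s01 zs]]] := hcov z.
have ji : j = i.
  by apply: contrapT => /eqP ji; apply: n3; exists j => //; exists s.
subst j; exists s => //=; apply/andP; split.
- by rewrite ltNge; apply/negP => su; apply: n1; exists s => //=; case/andP: s01 => ->.
- by rewrite ltNge; apply/negP => su; apply: n2; exists s => //=; case/andP: s01 => _ ->; rewrite su.
Qed.

End Graph.

(** * Sets with few components *)

Section Alternation.
Context (R : realType) (T : metricType R).
Implicit Types (h : R -> T) (E F : set T).

(** The pieces may be empty or overlap: only an upper bound on the number of components matters. *)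
Definition Nconn N E := exists C : nat -> set T,
  (forall i, (i < N)%N -> connected (C i)) /\ E = \bigcup_(i in `I_N) C i.

(** Two of the [N + 1] points of [E] share a connected piece, and the right one is trapped between
    its two neighbours outside [E]. The last outside point closes the trap around the last inside
    one. *)
Lemma Nconn_alternation N E h (a : nat -> R) : chart h -> Nconn N E ->
  (forall i, 0 < a i < 1) ->
  (forall i, (i < N.*2.+1)%N -> a i < a i.+1) ->
  (forall i, (i <= N)%N -> E (h (a i.*2))) ->
  (forall i, (i <= N)%N -> ~ E (h (a i.*2.+1))) -> False.
Proof.
move=> hc [C [Cc ->]] a01 ainc Ein Eout.
have mono i j : (i < j <= N.*2.+1)%N -> a i < a j.
  elim: j => [|j IH]; first by rewrite ltn0.
  rewrite ltnS => /andP[ij jN]; have [e|ne] := eqVneq i j.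
    by rewrite e; apply: ainc.
  apply: lt_trans (IH _) (ainc j _) => //; lia.
have cP (i : 'I_N.+1) : exists c : 'I_N, C c (h (a i.*2)).
  have iN : (i <= N)%N by rewrite -ltnS ltn_ord.
  by have [c /= cN Cc'] := Ein i iN; exists (Ordinal cN).
pose c i := projT1 (cid (cP i)).
have cE i : C (c i) (h (a i.*2)) by rewrite /c; case: cid.
have /injectivePn[i [j ij cij]] : ~~ injectiveb c.
  apply/injectiveP => /leq_card; rewrite !card_ord; lia.
wlog lij : i j ij cij / (i < j)%N.
  move=> H; case: (ltngtP i j) => l.
  - exact: H l.
  - by apply: H l => //; rewrite eq_sym.
  - by move/val_inj/eqP : l; rewrite (negbTE ij).
have jN := ltn_ord j; have iN := ltn_ord i.
have ej : (j.*2 = (j.-1).*2.+1.+1)%N by lia.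
pose g := a (j.-1).*2.+1; pose g' := a j.*2.+1.
have nC u : ~ (\bigcup_(i in `I_N) C i) u -> ~ C (c j) u.
  by move=> nu Cu; apply: nu; exists (c j) => //=; exact: ltn_ord.
have [] := @trap_out _ _ h (C (c j)) g (a j.*2) g' (h (a i.*2)) hc.
- exact: Cc.
- by have /andP[/ltW] := a01 (j.-1).*2.+1.
- by have /andP[_ /ltW] := a01 j.*2.+1.
- by apply/andP; split; apply: mono; lia.
- exact: cE.
- by rewrite -cij; exact: cE.
- move=> /(ioo_mem hc); rewrite /g /g' => H.
  have : a j.-1.*2.+1 < a i.*2 < a j.*2.+1.
    apply: H; first by have /andP[/ltW] := a01 (j.-1).*2.+1.
      by have /andP[_ /ltW] := a01 j.*2.+1.
    by have /andP[u v] := a01 i.*2; rewrite !ltW.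
  move=> /andP[H1 _]; have : a i.*2 < a j.-1.*2.+1 by apply: mono; lia.
  by move=> /(lt_trans H1); rewrite ltxx.
- by apply: nC; apply: Eout; lia.
- by apply: nC; apply: Eout; lia.
Qed.

Lemma increasing_in_infinite (S : set R) M : infinite_set S ->
  exists2 p : seq R, size p = M & sorted <%R p /\ forall x, x \in p -> S x.
Proof.
move=> /infinite_set_fset => /(_ M)[B BS sB].
exists (take M (sort <=%R B)).
  by rewrite size_takel// size_sort.
split.
  apply: take_sorted; rewrite sort_lt_sorted; exact: fset_uniq.
by move=> x /mem_take; rewrite mem_sort => /BS.
Qed.

(** An infinite [F] has infinitely many points inside one edge. Since [E] meets and misses each of
    [2N + 2] disjoint intervals around such points, alternating points can be chosen, against
    [Nconn_alternation]. *)
Lemma finite_of_alternation n (h : 'I_n -> R -> T) g N F : graph_atlas h g ->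
  (forall K (O : nat -> set T),
    (forall i, (i < K)%N -> open (O i) /\ O i `&` F !=set0) ->
    exists2 E, Nconn N E & forall i, (i < K)%N ->
      (exists2 z, O i z & E z) /\ (exists2 z, O i z & ~ E z)) ->
  finite_set F.
Proof.
move=> [hch hcov _ _ _] HF; apply: contrapT => Finf.
pose S i : set R := [set s | 0 < s < 1 /\ F (h i s)].
have [i Si] : exists i, infinite_set (S i).
  apply: contrapT => /forallNP Sfin; apply: Finf.
  have sub : F `<=` \bigcup_(i in [set: 'I_n]) (h i @` (S i `|` [set 0; 1])).
    move=> z Fz; have [i [s [/andP[s0 s1] zs]]] := hcov z; exists i => //.
    exists s => //; rewrite zs in Fz.
    have [->|s0'] := eqVneq s 0; first by right; left.
    have [->|s1'] := eqVneq s 1; first by right; right.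
    by left; split => //; rewrite !lt_neqAle s0 s1 eq_sym s0' s1'.
  apply: sub_finite_set sub _; apply: bigcup_finite => // i _.
  apply: finite_image; rewrite finite_setU; split; last exact: finite_set2.
  exact: contrapT (Sfin i).
pose M := N.*2.+2.
have [p sp [psort pS]] := @increasing_in_infinite (S i) M Si.
pose q := nth (1 : R) (0 :: rcons p 1).
have qsort : sorted <%R (0 :: rcons p 1).
  have : all (fun x => 0 < x < 1) p by apply/allP => x /pS [].
  move: psort; clear -sp; case: p sp => [//|x p] _ /=.
  elim: p x => [|y p IH] x /=; first by move=> _ /andP[/andP[-> ->]].
  move=> /andP[xy ps] /and3P[/andP[x0 x1] y01 al].
  rewrite x0 xy /=.
  by have := IH y ps; rewrite /= y01 al => /(_ isT) /andP[].
have qS k : (k < M)%N -> S i (q k.+1).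
  move=> kM; rewrite /q /= nth_rcons sp kM; apply: pS; apply: mem_nth.
  by rewrite sp.
have qinc k : (k <= M)%N -> q k < q k.+1.
  move=> kM; rewrite /q; have := sorted_ltn_nth lt_trans 1 qsort.
  by apply; rewrite ?inE ?size_rcons/= ?size_rcons ?sp//; lia.
have q0 k : (k <= M.+1)%N -> 0 <= q k.
  elim: k => [|k IH] kM; first by [].
  by apply: le_trans (IH _) (ltW (qinc k _)); lia.
have q1 k : (k <= M)%N -> q (M.+1 - k)%N <= 1.
  elim: k => [|k IH] kM; first by rewrite subn0 /q /= nth_rcons sp ltnn eqxx.
  apply: (le_trans _ (IH (ltnW kM))).
  have -> : (M.+1 - k = (M.+1 - k.+1).+1)%N by lia.
  by apply/ltW/qinc; lia.
have q1' k : (k <= M.+1)%N -> q k <= 1.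
  case: k => [|k] kM; first by rewrite /q /= ler01.
  by have := q1 (M - k)%N; rewrite (_ : (M.+1 - (M - k) = k.+1)%N); [apply|]; lia.
pose lo k := (q k + q k.+1) / 2.
have lo01 k : (k <= M)%N -> 0 <= lo k <= 1.
  move=> kM; have H4 := q0 k (leqW kM); have H3 := q0 k.+1 kM.
  have H2 := q1' k (leqW kM); have H1 := q1' k.+1 kM.
  by rewrite /lo; apply/andP; split; lra.
pose O k := ioo (h i) (lo k) (lo k.+1).
have [|E NE EO] := HF M O.
  move=> k kM; split.
    have [_ _ ho] := hch i; apply: ho.
      by have /andP[] := lo01 k (ltnW kM).
    by have /andP[] := lo01 k.+1 kM.
  have [_ Fq] := qS k kM; exists (h i (q k.+1)); split => //.
  exists (q k.+1) => //=; rewrite /lo.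
  by have := qinc k (ltnW kM); have := qinc k.+1 kM => ? ?; apply/andP; split; lra.
have aP k : exists s, (k < M)%N -> lo k < s < lo k.+1 /\
    (if odd k then ~ E (h i s) else E (h i s)).
  have [kM|] := boolP (k < M)%N; last by exists 0.
  have [[z [s /= s1 <-] Ez] [z' [s' /= s'1 <-] Ez']] := EO k kM.
  by case: (odd k); [exists s'|exists s].
pose a0 k := projT1 (cid (aP k)).
have a0P k : (k < M)%N -> lo k < a0 k < lo k.+1 /\
    (if odd k then ~ E (h i (a0 k)) else E (h i (a0 k))).
  by rewrite /a0; case: cid.
pose a k := if (k < M)%N then a0 k else 1 / 2.
apply: (@Nconn_alternation N E (h i) a (hch i) NE).
- move=> k; rewrite /a; case: ifP => kM; last by apply/andP; split; lra.
  have [/andP[u v] _] := a0P k kM.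
  have /andP[? _] := lo01 k (ltnW kM); have /andP[_ ?] := lo01 k.+1 kM.
  by apply/andP; split; lra.
- move=> k kM; rewrite /a !ifT; [|rewrite /M; lia..].
  have [|/andP[_ u] _] := a0P k; first by rewrite /M; lia.
  have [|/andP[v _] _] := a0P k.+1; first by rewrite /M; lia.
  exact: lt_trans u v.
- move=> k kN; rewrite /a ifT; last by rewrite /M; lia.
  by have [|_] := a0P k.*2; [rewrite /M; lia|rewrite odd_double].
- move=> k kN; rewrite /a ifT; last by rewrite /M; lia.
  by have [|_] := a0P k.*2.+1; [rewrite /M; lia|rewrite /= odd_double].
Qed.

(** Otherwise points lying in all [E l] and points missing some [E l] alternate towards the start of
    the germ. One late term decides finitely many of them at once and alternates too often. *)
Lemma germ_of_accumulation N (E : nat -> set T) h : chart h ->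
  (forall l, Nconn N (E l)) -> (forall l, E l.+1 `<=` E l) ->
  (forall e, 0 < e -> exists2 s, 0 < s < e & forall l, E l (h s)) ->
  exists2 d, 0 < d <= 1 & forall s, 0 < s < d -> forall l, E l (h s).
Proof.
move=> hc NE Edec acc; apply: contrapT => Hn.
have Emono k l : E (k + l)%N `<=` E l.
  by elim: k => [|k IH]//; apply: subset_trans (Edec _) IH.
have inP e : exists s, 0 < e -> 0 < s < e /\ forall l, E l (h s).
  have [e0|] := ltP 0 e; last by exists 0.
  by have [s s0 Es] := acc e e0; exists s.
have outP e : exists s, 0 < e <= 1 -> 0 < s < e /\ exists l, ~ E l (h s).
  have [e0|e0] := boolP (0 < e <= 1); last by exists 0.
  apply: contrapT => /forallNP H; apply: Hn; exists e => // s se l.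
  apply: contrapT => nE; apply: (H s) => _; split => //; by exists l.
pose cin e := projT1 (cid (inP e)); pose cout e := projT1 (cid (outP e)).
have cinP e : 0 < e -> 0 < cin e < e /\ forall l, E l (h (cin e)).
  by rewrite /cin; case: cid.
have coutP e : 0 < e <= 1 -> 0 < cout e < e /\ exists l, ~ E l (h (cout e)).
  by rewrite /cout; case: cid.
pose b := fix b k := match k with 0%N => cout 1
  | k'.+1 => if odd k' then cout (b k') else cin (b k') end.
have b01 k : 0 < b k < 1.
  elim: k => [|k /andP[b0 b1]] /=.
    by have [|] := coutP 1; first by rewrite ltr01 lexx.
  case: (odd k).
    have [|/andP[u v] _] := coutP (b k); first by rewrite b0 ltW.
    by rewrite u (lt_trans v).
  by have [/andP[u v] _] := cinP _ b0; rewrite u (lt_trans v).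
have bdec k : b k.+1 < b k.
  have /andP[b0 b1] := b01 k; rewrite /=; case: (odd k).
    by have [|/andP[]] := coutP (b k); first by rewrite b0 ltW.
  by have [/andP[]] := cinP _ b0.
have bin k : odd k -> forall l, E l (h (b k)).
  case: k => [//|k] /= ok; rewrite (negbTE ok).
  by have /andP[b0 _] := b01 k; have [] := cinP _ b0.
have bout k : ~~ odd k -> exists l, ~ E l (h (b k)).
  case: k => [_|k] /=.
    by have [|] := coutP 1; first by rewrite ltr01 lexx.
  rewrite negbK => ->; have /andP[b0 b1] := b01 k.
  by have [|] := coutP (b k); first by rewrite b0 ltW.
have lP k : exists l, ~~ odd k -> ~ E l (h (b k)).
  have [ok|/bout[l nE]] := boolP (odd k); first by exists 0%N.
  by exists l.
pose l k := projT1 (cid (lP k)).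
pose L := (\sum_(k < N.*2.+2) l k)%N.
have LP k : (k < N.*2.+2)%N -> ~~ odd k -> ~ E L (h (b k)).
  move=> kM ok EL; have := projT2 (cid (lP k)) ok; apply; rewrite -/(l k).
  have -> : E (l k) = E (0 + l k)%N by rewrite add0n.
  have le : (l k <= L)%N by rewrite /L (bigD1 (Ordinal kM))//= leq_addr.
  by rewrite add0n; apply: (Emono (L - l k)%N); rewrite subnK.
apply: (@Nconn_alternation N (E L) h (fun k => b (N.*2.+1 - k)%N) hc (NE L)).
- by move=> k; exact: b01.
- move=> k kN; have -> : (N.*2.+1 - k = (N.*2.+1 - k.+1).+1)%N by lia.
  exact: bdec.
- move=> k kN; apply: bin; rewrite oddB; last by lia.
  by rewrite /= !odd_double.
- move=> k kN; apply: LP; first by lia.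
  by rewrite oddB; [rewrite /= !odd_double|lia].
Qed.

Lemma chain_connected (B : nat -> set T) : (forall k, connected (B k)) ->
  (forall k, B k `&` B k.+1 !=set0) -> connected (\bigcup_k B k).
Proof.
move=> Bc BB.
pose U k := \bigcup_(i in `I_k.+1) B i.
have Uc k : connected (U k).
  elim: k => [|k IH].
    rewrite /U (_ : `I_1 = [set 0%N]) ?bigcup_set1//.
    by apply/seteqP; split => i /=; rewrite ltnS leqn0 => /eqP.
  have -> : U k.+1 = U k `|` B k.+1.
    apply/seteqP; split => z.
      move=> [i /=]; rewrite ltnS leq_eqVlt => /predU1P[->|ik] Bz; first by right.
      by left; exists i.
    move=> [[i /= ik Bz]|Bz]; last by exists k.+1 => /=.
    by exists i => //=; exact: ltnW.
  apply: connectedU => //; have [z [z1 z2]] := BB k.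
  by exists z; split => //; exists k => /=.
have [z [z0 _]] := BB 0%N.
have -> : \bigcup_k B k = \bigcup_k U k.
  apply/seteqP; split => w.
    by move=> [k _ Bw]; exists k => //; exists k => /=.
  by move=> [k _ [i _ Bw]]; exists i.
apply: bigcup_connected => // ; exists z => k _; by exists 0%N.
Qed.

(** Iterates whose times agree modulo [t] form a chain, consecutive links sharing an iterate of
    [w]. *)
Lemma orbit_Nconn (f : T -> T) (A : set T) k0 t : continuous f -> connected A ->
  (0 < t)%N -> iter t f @` A `&` A !=set0 ->
  Nconn t (\bigcup_(n in [set n | (k0 <= n)%N]) iter n f @` A).
Proof.
move=> cf cA t0 [w [[u Au uw] Aw]].
have citer m : continuous (iter m f).
  elim: m => [|m IH]; first by move=> z; exact: cvg_id.
  by move=> z; apply: continuous_comp; [exact: IH|exact: cf].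
exists (fun i => \bigcup_k iter (k0 + i + k * t)%N f @` A); split.
  move=> i _; apply: chain_connected => k.
    apply: connected_continuous_connected => //.
    exact/continuous_subspaceT/citer.
  exists (iter (k0 + i + k * t)%N f w); split; first by exists w.
  exists u => //; rewrite -uw -iterD; congr (iter _ f u); lia.
apply/seteqP; split => z.
  move=> [n /= kn Az]; exists ((n - k0) %% t)%N => /=; first by rewrite ltn_mod.
  exists ((n - k0) %/ t)%N => //.
  have := divn_eq (n - k0) t => e; have <- // : n = (k0 + (n - k0) %% t + (n - k0) %/ t * t)%N by lia.
by move=> [i /= it [k _ Az]]; exists (k0 + i + k * t)%N => //=; lia.
Qed.

End Alternation.

(** * Shadowing *)

Section Compactness.
Context (T : topologicalType).

Lemma decreasing_le (C : nat -> set T) : (forall l, C l.+1 `<=` C l) ->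
  forall k l, (k <= l)%N -> C l `<=` C k.
Proof.
move=> Cdec k l /subnK <-; elim: (l - k)%N => [|m IH]//.
by apply: subset_trans (Cdec _) IH.
Qed.

Lemma nested_nonempty (C : nat -> set T) : compact [set: T] ->
  (forall l, closed (C l)) -> (forall l, C l !=set0) ->
  (forall l, C l.+1 `<=` C l) -> \bigcap_l C l !=set0.
Proof.
move=> cT Ccl C0 Cdec.
pose F : set_system T := filter_from setT C.
have FF : ProperFilter F.
  apply: filter_from_proper => //; apply: filter_from_filter; first by exists 0%N.
  move=> i j _ _; exists (maxn i j) => // z Cz.
  by split; apply: (decreasing_le Cdec) Cz; rewrite ?leq_maxl ?leq_maxr.
have [|p [_ clp]] := cT F FF; first by exists 0%N.
exists p => l _; apply: (Ccl l) => B pB.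
by apply: clp => //; exists l.
Qed.

Lemma closed_nonclosure_disjoint (C : nat -> set T) (O : set T) :
  compact [set: T] -> (forall l, C l.+1 `<=` C l) -> open O ->
  \bigcap_l closure (C l) `<=` O -> exists l, C l `<=` O.
Proof.
move=> cT Cdec Oo CO; apply: contrapT => /forallNP H.
have [||| z zC] := @nested_nonempty (fun l => closure (C l) `&` ~` O) cT.
- by move=> l; apply: closedI; [exact: closed_closure|exact: open_closedC].
- move=> l; have /existsNP[z /not_implyP[Cz Oz]] := H l.
  by exists z; split => //; exact: subset_closure.
- move=> l z [Cz Oz]; split => //; apply: closure_subset Cz; exact: Cdec.
have Oz : O z by apply: CO => l _; have [] := zC l I.
by have [] := zC 0%N I.
Qed.

End Compactness.

Section Metric.
Context (R : realType) (T : metricType R).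

Lemma finite_radius (F : set T) (P : T -> R -> Prop) : finite_set F ->
  (forall b r r', P b r -> r' <= r -> P b r') ->
  (forall b, F b -> exists2 r, 0 < r & P b r) ->
  exists2 r, 0 < r & forall b, F b -> P b r.
Proof.
move=> /finite_seqP[s ->] Pm; elim: s => [|b s IH] HP.
  by exists 1 => // b; rewrite /= in_nil.
have [|r r0 rP] := IH; first by move=> c cs; apply: HP; rewrite /= inE cs orbT.
have [|r' r'0 r'P] := HP b; first by rewrite /= mem_head.
exists (Num.min r r'); first by rewrite lt_min r0.
move=> c /=; rewrite inE => /predU1P[->|cs].
  by apply: Pm r'P _; rewrite ge_min lexx orbT.
by apply: Pm (rP _ cs) _; rewrite ge_min lexx.
Qed.

(** If [b'] differs from [f b], continuity keeps the image of a small ball at [b] away from [b'];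
    finiteness makes the radius uniform. For a map this forces orbits near [F] to follow orbits in
    [F]; for the identity it separates the points of [F]. *)
Lemma separating_radius (f : T -> T) (F : set T) : continuous f ->
  finite_set F -> exists2 r, 0 < r & forall b b' z, F b -> F b' ->
    ball b r z -> ball b' r (f z) -> f b = b'.
Proof.
move=> cf Ffin.
have [||r r0 rP] := @finite_radius F (fun b r => forall b' z, F b' ->
    ball b r z -> ball b' r (f z) -> f b = b') Ffin.
- move=> b r r' H r'r b' z Fb' bz b'z; apply: (H b' z) => //.
    exact: le_ball bz.
  exact: le_ball b'z.
- move=> b Fb.
  have [||r r0 rP] := @finite_radius F (fun b' r => forall z,
      ball b r z -> ball b' r (f z) -> f b = b') Ffin.
  + move=> b' r r' H r'r z bz b'z; apply: (H z).
      exact: le_ball bz.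
    exact: le_ball b'z.
  + move=> b' _; have [e|/eqP ne] := pselect (f b = b'); first by exists 1.
    pose d := mdist (f b) b' / 2.
    have d0 : 0 < d by rewrite divr_gt0// mdist_gt0.
    have /nbhs_ballP[r /= r0 rd] : \forall z \near b, ball (f b) d (f z).
      by apply: cf; exact: nbhsx_ballx.
    exists (Num.min r d); first by rewrite lt_min r0.
    move=> z bz b'z; exfalso.
    have bfz : ball (f b) d (f z).
      by apply: rd; apply: le_ball bz; rewrite ge_min lexx.
    have b'fz : ball b' d (f z) by apply: le_ball b'z; rewrite ge_min lexx orbT.
    have := ball_triangle bfz (ball_sym b'fz).
    by rewrite -splitr ballEmdist /= ltxx.
  + by exists r => // b' z Fb' bz; apply: rP.
by exists r => // b b' z Fb Fb' bz; apply: (rP b Fb).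
Qed.

(* When the closures of [D l] shrink to a finite set [F], an orbit segment
   inside [D l] starting near [x] must follow the orbit of [x] in [F]. *)
Lemma shadowing (f : T -> T) (D : nat -> set T) (x y : T) : compact [set: T] ->
  continuous f -> (forall l, D l.+1 `<=` D l) ->
  finite_set (\bigcap_l closure (D l)) -> x <> y ->
  (forall l U V, nbhs x U -> nbhs y V -> exists w w' t,
    [/\ U w /\ U w', forall k, (k <= t)%N -> D l (iter k f w),
        forall k, (k <= t)%N -> D l (iter k f w'),
        U (iter t f w) & V (iter t f w')]) -> False.
Proof.
move=> cT cf Ddec; set F := \bigcap_l _ => Ffin xy H.
have [r1 r10 r1P] := separating_radius cf Ffin.
have cid' : continuous (@id T) by move=> z; exact: cvg_id.
have [r2 r20 r2P] := separating_radius cid' Ffin.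
pose r := Num.min r1 r2.
have r0 : 0 < r by rewrite lt_min r10.
have rr1 : r <= r1 by rewrite ge_min lexx.
have rr2 : r <= r2 by rewrite ge_min lexx orbT.
have Fx : F x.
  move=> l _ U xU; have [w [w' [t [[Uw _] Dw _ _ _]]]] := H l U setT xU filterT.
  by exists w; split => //; exact: (Dw 0%N).
have Fy : F y.
  move=> l _ V yV; have [w [w' [t [_ _ Dw _ Vw]]]] := H l setT V filterT yV.
  by exists (iter t f w'); split => //; exact: Dw.
have [l Dl] : exists l, D l `<=` \bigcup_(b in F) (ball b r)°.
  apply: closed_nonclosure_disjoint => //.
    by apply: bigcup_open => b _; exact: open_interior.
  by move=> b Fb; exists b => //; apply: nbhsx_ballx.
have Dl' z : D l z -> exists2 b, F b & ball b r z.
  by move=> /Dl[b Fb /interior_subset bz]; exists b.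
have [w [w' [t [[xw xw'] Dw Dw' xt yt]]]] :=
  H l (ball x r) (ball y r) (nbhsx_ballx _ _ r0) (nbhsx_ballx _ _ r0).
have follow v : ball x r v -> (forall k, (k <= t)%N -> D l (iter k f v)) ->
    forall k, (k <= t)%N -> F (iter k f x) /\ ball (iter k f x) r (iter k f v).
  move=> xv Dv; elim=> [|k IH] kt //.
  have [Fk bk] := IH (ltnW kt).
  have [b Fb bv] := Dl' _ (Dv _ kt).
  have e : f (iter k f x) = b.
    by apply: (r1P _ _ (iter k f v)) => //; apply: le_ball rr1 _ _.
  by rewrite /= e.
have [Ft bt] := follow w xw Dw t (leqnn t).
have [_ bt'] := follow w' xw' Dw' t (leqnn t).
have e1 : iter t f x = x.
  by apply: (r2P _ _ (iter t f w)) => //; apply: le_ball rr2 _ _.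
have e2 : iter t f x = y.
  by apply: (r2P _ _ (iter t f w')) => //; apply: le_ball rr2 _ _.
by apply: xy; rewrite -e1.
Qed.

(** Near a limit point each [E L] has points that some later term loses. For finitely many
    neighbourhoods a single late [E L] thus meets and misses each of them, and
    [finite_of_alternation] applies. *)
Lemma finite_limit_dec n (h : 'I_n -> R -> T) g N (E : nat -> set T) :
  graph_atlas h g -> (forall l, Nconn N (E l)) ->
  (forall l, E l.+1 `<=` E l) ->
  finite_set (\bigcap_l closure (E l `\` \bigcap_k E k)).
Proof.
move=> hg NE Edec; apply: (finite_of_alternation (N := N) hg) => K O HO.
have zP i : exists l, (i < K)%N -> exists2 z, O i z & ~ E l z.
  have [iK|] := boolP (i < K)%N; last by exists 0%N.
  have [Oo [z [Oz Fz]]] := HO i iK.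
  have [w [[Ew nE] Ow]] := Fz 0%N I (O i) (open_nbhs_nbhs (conj Oo Oz)).
  have /existsNP[l /not_implyP[_ nl]] := nE.
  by exists l => _; exists w.
pose l i := projT1 (cid (zP i)).
pose L := (\sum_(i < K) l i)%N.
exists (E L) => // i iK; split.
  have [Oo [z [Oz Fz]]] := HO i iK.
  have [w [[Ew _] Ow]] := Fz L I (O i) (open_nbhs_nbhs (conj Oo Oz)).
  by exists w.
have [w Ow nE] := projT2 (cid (zP i)) iK; exists w => // EL; apply: nE.
apply: (decreasing_le Edec) EL; rewrite -/(l i).
by rewrite /L (bigD1 (Ordinal iK))//= leq_addr.
Qed.

Lemma finite_limit_inc n (h : 'I_n -> R -> T) g N (E : nat -> set T) :
  graph_atlas h g -> (forall l, Nconn N (E l)) ->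
  (forall l, E l `<=` E l.+1) ->
  finite_set (\bigcap_l closure (\bigcup_k E k `\` E l)).
Proof.
move=> hg NE Einc; apply: (finite_of_alternation (N := N) hg) => K O HO.
have Emono k l : (k <= l)%N -> E k `<=` E l.
  by move=> /subnK <-; elim: (l - k)%N => [|m IH]//; apply: subset_trans IH (Einc _).
have zP i : exists l, (i < K)%N -> exists2 z, O i z & E l z.
  have [iK|] := boolP (i < K)%N; last by exists 0%N.
  have [Oo [z [Oz Fz]]] := HO i iK.
  have [w [[[l _ Ew] nE] Ow]] := Fz 0%N I (O i) (open_nbhs_nbhs (conj Oo Oz)).
  by exists l => _; exists w.
pose l i := projT1 (cid (zP i)).
pose L := (\sum_(i < K) l i)%N.
exists (E L) => // i iK; split; last first.
  have [Oo [z [Oz Fz]]] := HO i iK.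
  have [w [[Ew nE] Ow]] := Fz L I (O i) (open_nbhs_nbhs (conj Oo Oz)).
  by exists w.
have [w Ow El] := projT2 (cid (zP i)) iK; exists w => //.
apply: Emono El; rewrite -/(l i).
by rewrite /L (bigD1 (Ordinal iK))//= leq_addr.
Qed.

Lemma chart_affine (h : R -> T) t c : chart h -> 0 <= t <= 1 ->
  0 <= t + c <= 1 -> c != 0 -> chart (fun s => h (t + s * c)).
Proof.
move=> [ch hi ho] /andP[t0 t1] /andP[tc0 tc1] c0.
have in01 s : 0 <= s <= 1 -> 0 <= t + s * c <= 1.
  by move=> /andP[s0 s1]; apply/andP; split; nra.
split.
- move=> s; apply: (@cvg_comp _ _ _ (fun s => t + s * c) h _ (nbhs (t + s * c)));
    last exact: ch.
  by apply: cvgD; [exact: cvg_cst|apply: cvgMl; exact: cvg_id].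
- move=> s u /in01 s01 /in01 u01 /(hi _ _ s01 u01) /addrI.
  by move=> /(mulIf c0).
move=> a b a0 b1.
have [ab|ba] := ltP a b; last first.
  suff -> : ioo (fun s => h (t + s * c)) a b = set0 by exact: open0.
  rewrite -subset0 => z [s /= /andP[as_ sb] _]; move: (lt_trans as_ sb).
  by rewrite ltNge ba.
have [cp|cn] := ltP 0 c.
  suff -> : ioo (fun s => h (t + s * c)) a b = ioo h (t + a * c) (t + b * c).
    by apply: ho; nra.
  apply/seteqP; split => z [s /= /andP[as_ sb] <-].
    by exists (t + s * c) => //=; apply/andP; split; nra.
  exists ((s - t) / c) => /=.
    by rewrite ltr_pdivlMr// ltr_pdivrMr//; apply/andP; split; lra.
  by rewrite divfK// addrC subrK.
have cn' : c < 0 by rewrite lt_neqAle c0.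
suff -> : ioo (fun s => h (t + s * c)) a b = ioo h (t + b * c) (t + a * c).
  by apply: ho; nra.
apply/seteqP; split => z [s /= /andP[as_ sb] <-].
  by exists (t + s * c) => //=; apply/andP; split; nra.
exists ((s - t) / c) => /=.
  by rewrite ltr_ndivlMr// ltr_ndivrMr//; apply/andP; split; lra.
by rewrite divfK// addrC subrK.
Qed.

End Metric.

(** * Germs *)

Section Germs.
Context (R : realType) (T : metricType R).

Definition germs_at (J : finType) (c : J -> R -> T) (ok : pred J) (b : T) :=
  (forall j, ok j -> chart (c j) /\ c j 0 = b) /\
  forall e, 0 < e <= 1 -> \forall z \near b,
    z = b \/ exists j s, [/\ ok j, 0 < s < e & z = c j s].

(** An arc through [b] gives a germ in each direction, indexed by a boolean; [ok] discards arcs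
    missing [b] and directions in which the arc stops at [b]. Removing the closed far parts [D i]
    leaves a neighbourhood of [b]. *)
Lemma germs_exist n (h : 'I_n -> R -> T) g b : graph_atlas h g ->
  exists (c : 'I_n * bool -> R -> T) ok, germs_at c ok b.
Proof.
move=> [hch hcov _ _ _].
pose on i t := 0 <= t <= 1 /\ h i t = b.
have tP i : exists t, (exists t, on i t) -> on i t.
  by have [[t ont]|no] := pselect (exists t, on i t); [exists t|exists 0].
pose t i := projT1 (cid (tP i)).
have tE i u : on i u -> on i (t i).
  by move=> onu; apply: (projT2 (cid (tP i))); exists u.
have tU i u : on i u -> u = t i.
  move=> onu; have [t01 et] := tE i u onu; have [u01 eu] := onu.
  by apply: (chart_inj (hch i)) => //; rewrite eu et.
pose ok (j : 'I_n * bool) := `[< on j.1 (t j.1) >] &&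
  (if j.2 then t j.1 < 1 else 0 < t j.1).
pose c (j : 'I_n * bool) s := h j.1 (t j.1 + s * (if j.2 then 1 - t j.1 else - t j.1)).
exists c, ok; split.
  move=> [i d] /andP[/asboolP[/= /andP[t0 t1] ht]] td; split; last first.
    by rewrite /c /= mul0r addr0.
  apply: chart_affine => //=; first by rewrite t0.
    by case: (d); apply/andP; split; lra.
  case: (d) td => ?; first by rewrite subr_eq0 gt_eqF.
  by rewrite oppr_eq0 gt_eqF.
move=> e /andP[e0 e1].
pose D i := if `[< on i (t i) >] then
    (if 0 < t i then icc (h i) 0 (t i - e * t i) else set0) `|`
    (if t i < 1 then icc (h i) (t i + e * (1 - t i)) 1 else set0)
  else icc (h i) 0 1.
have Dcl i : closed (D i).
  rewrite /D; case: ifP => _; last (apply: icc_closed; exact: chart_cont (hch i)).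
  by apply: closedU; case: ifP => _; try exact: closed0;
    (apply: icc_closed; exact: chart_cont (hch i)).
have nb : ~ (\bigcup_(i in [set: 'I_n]) D i) b.
  move=> [i _]; rewrite /D; case: asboolP => [ont|non]; last first.
    by move=> [u /= u01 hu]; apply: non; apply: (@tE i u).
  have [/andP[t0 t1] _] := ont.
  move=> [|]; case: ifP => // tt [u /= /andP[u0 u1] hu].
    have ut : u = t i by apply: tU; split => //; apply/andP; split; nra.
    nra.
  have ut : u = t i by apply: tU; split => //; apply/andP; split; nra.
  nra.
have opD : open (~` \bigcup_(i in [set: 'I_n]) D i).
  by apply: closed_openC; apply: closed_bigcup => [|i _]; [exact: finite_finset|exact: Dcl].
apply: filterS (open_nbhs_nbhs (conj opD nb)) => z nz.
have [i [s [s01 zs]]] := hcov z.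
have nDi : ~ D i z by move=> Dz; apply: nz; exists i.
move: nDi; rewrite /D; case: asboolP => [ont|non]; last first.
  by move=> ni; exfalso; apply: ni; exists s.
move=> /not_orP[n1 n2].
have /andP[s0 s1] := s01.
have [/andP[t0 t1] ht] := ont.
have [st|ts|est] := ltgtP s (t i).
- right; have tp : 0 < t i by exact: le_lt_trans st.
  exists (i, false), ((t i - s) / t i); split.
  + by rewrite /ok /= tp andbT; apply/asboolP.
  + rewrite ltr_pdivlMr// ltr_pdivrMr// mul0r; apply/andP; split; first lra.
    rewrite ltrBlDr -ltrBlDl ltNge; apply/negP => le; apply: n1; rewrite tp.
    by exists s => //=; apply/andP; split.
  + by rewrite zs /c /= mulrN divfK ?gt_eqF// subKr.
- right; have tp : t i < 1 by exact: lt_le_trans s1.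
  have tp' : 0 < 1 - t i by rewrite subr_gt0.
  exists (i, true), ((s - t i) / (1 - t i)); split.
  + by rewrite /ok /= tp andbT; apply/asboolP.
  + rewrite ltr_pdivlMr// ltr_pdivrMr// mul0r; apply/andP; split; first lra.
    rewrite ltrBlDl ltNge; apply/negP => le; apply: n2; rewrite tp.
    by exists s => //=; apply/andP; split.
  + by rewrite zs /c /= divfK ?gt_eqF// addrC subrK.
- by left; rewrite zs est.
Qed.

(** Failure on every germ at some scale would be failure on all at the least scale. [Q] depends on
    the scale so that it can also demand late times. *)
Lemma germ_frequently (J : finType) (c : J -> R -> T) ok b (Q : R -> T -> Prop) :
  germs_at c ok b ->
  (forall e e' z, e <= e' -> Q e z -> Q e' z) ->
  (forall e U, 0 < e <= 1 -> nbhs b U -> exists z, [/\ U z, z <> b & Q e z]) ->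
  exists2 j, ok j & forall e, 0 < e <= 1 ->
    exists s, 0 < s < e /\ Q e (c j s).
Proof.
move=> [cok cnb] Qm Hf; apply: contrapT => Hn.
have eP j : exists e, 0 < e <= 1 /\ (ok j -> forall s, 0 < s < e -> ~ Q e (c j s)).
  have [okj|/negP nok] := boolP (ok j); last by exists 1; rewrite ltr01 lexx.
  apply: contrapT => /forallNP H; apply: Hn; exists j => // e e01.
  have /not_andP[//|/not_implyP[_ /existsNP[s /not_implyP[se /contrapT Qs]]]] := H e.
  by exists s.
pose e j := projT1 (cid (eP j)).
pose m := \big[Num.min/1]_(j : J) e j.
have m1 : m <= 1.
  rewrite /m; elim/big_ind: _ => [//|x y x1 _|j _]; first by rewrite ge_min x1.
  by have [/andP[]] := projT2 (cid (eP j)).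
have m0 : 0 < m.
  rewrite /m; elim/big_ind: _ => [//|x y x0 y0|j _]; first by rewrite lt_min x0.
  by have [/andP[]] := projT2 (cid (eP j)).
have me j : m <= e j by rewrite /m (bigD1 j)//= ge_min lexx.
have m01 : 0 < m <= 1 by rewrite m0.
have [z [zn zb Qz]] := Hf m _ m01 (cnb m m01).
case: zn => [//|[j [s [okj /andP[s0 sm] zs]]]].
have [_ /(_ okj s)] := projT2 (cid (eP j)); apply.
  by rewrite s0 (lt_le_trans sm)//; exact: me.
by rewrite -zs; apply: Qm Qz; exact: me.
Qed.

End Germs.

(** * Nested periodic subgraphs *)

Section Iterates.
Context (T : topologicalType) (f : T -> T).

Lemma iter_continuous m : continuous f -> continuous (iter m f).
Proof.
move=> cf; elim: m => [|m IH]; first by move=> z; exact: cvg_id.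
by move=> z; apply: continuous_comp; [exact: IH|exact: cf].
Qed.

Lemma image_iterD a b (A : set T) :
  iter (a + b) f @` A = iter a f @` (iter b f @` A).
Proof.
apply/seteqP; split => z.
  by move=> [u Au <-]; exists (iter b f u); [exists u|rewrite iterD].
by move=> [_ [u Au <-] <-]; exists u => //; rewrite iterD.
Qed.

Lemma omega_limit_iter z p j (U : set T) N : continuous f ->
  omega_limit_of f z p -> nbhs (iter j f p) U ->
  exists2 r, (N <= r)%N & U (iter (j + r) f z).
Proof.
move=> cf omega nU.
have nU' : nbhs p (iter j f @^-1` U) by apply: iter_continuous.
have [|_ [[r /= Nr <-] Ur]] := omega N.+1 _ _ nU'; first by [].
by exists r; [exact: ltnW|rewrite iterD].
Qed.

End Iterates.

Lemma middle_of_three (R : realType) (xi : nat -> R) :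
  xi 0%N <> xi 1%N -> xi 0%N <> xi 2%N -> xi 1%N <> xi 2%N ->
  exists a b c, xi a < xi b < xi c.
Proof.
move=> /eqP n01 /eqP n02 /eqP n12.
have [l01|l01|/eqP] := ltgtP (xi 0%N) (xi 1%N); last by rewrite (negbTE n01).
- have [l12|l12|/eqP] := ltgtP (xi 1%N) (xi 2%N); last by rewrite (negbTE n12).
    by exists 0%N, 1%N, 2%N; rewrite l01.
  have [l02|l02|/eqP] := ltgtP (xi 0%N) (xi 2%N); last by rewrite (negbTE n02).
    by exists 0%N, 2%N, 1%N; rewrite l02.
  by exists 2%N, 0%N, 1%N; rewrite l02.
- have [l12|l12|/eqP] := ltgtP (xi 1%N) (xi 2%N); last by rewrite (negbTE n12).
    have [l02|l02|/eqP] := ltgtP (xi 0%N) (xi 2%N); last by rewrite (negbTE n02).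
      by exists 1%N, 0%N, 2%N; rewrite l01.
    by exists 1%N, 2%N, 0%N; rewrite l12.
  by exists 2%N, 1%N, 0%N; rewrite l12.
Qed.

Lemma ordered_of_disjoint (R : realType) (T : metricType R) (h : R -> T)
    (S1 S2 : set T) (u1 u2 v1 v2 : R) : chart h -> connected S1 ->
  connected S2 -> S1 `<=` ioo h 0 1 -> S2 `<=` ioo h 0 1 ->
  S1 `&` S2 = set0 -> 0 < u1 < 1 -> 0 < u2 < 1 -> 0 < v1 < 1 -> 0 < v2 < 1 ->
  S1 (h u1) -> S2 (h u2) -> S1 (h v1) -> S2 (h v2) -> u1 <= u2 -> v1 < v2.
Proof.
move=> hc c1 c2 s1 s2 d /andP[? ?] /andP[? ?] /andP[? ?] /andP[? ?].
move=> Su1 Su2 Sv1 Sv2 u12.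
have no w : S1 (h w) -> S2 (h w) -> False.
  by move=> a b; have : (S1 `&` S2) (h w) by []; rewrite d.
rewrite ltNge; apply/negP => v21.
have [le|gt] := leP u1 v2.
  by apply: (no v2) => //; apply: (@between _ _ h S1 0 1 u1 v2 v1) => //; rewrite le.
by apply: (no u1) => //; apply: (@between _ _ h S2 0 1 v2 u1 u2) => //; rewrite u12 ltW.
Qed.

Section Nested.
Context (R : realType) (T : metricType R) (f : T -> T) (cf : continuous f).
Context (J : nat -> set T) (m : nat -> nat).
Context (Jc : forall n, compact (J n)) (Jconn : forall n, connected (J n))
  (m0 : forall n, (0 < m n)%N)
  (Jdisj : forall n, trivIset `I_(m n) (fun i => iter i f @` J n))
  (Jper : forall n, iter (m n) f @` J n = J n)
  (Jdec : forall n, J n.+1 `<=` J n)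
  (minf : m @ \oo --> \oo)
  (p : T) (Jp : forall n, J n p).

Local Notation F i n := (iter i f @` J n).

Lemma FD i k n : F (i + k * m n)%N n = F i n.
Proof.
elim: k => [|k IH]; first by rewrite mul0n addn0.
by rewrite mulSn addnCA addnC image_iterD Jper.
Qed.

Lemma Fmod i j n : (i = j %[mod m n])%N -> F i n = F j n.
Proof.
move=> e; rewrite (divn_eq i (m n)) (divn_eq j (m n)) e.
by rewrite ![(_ * m n + _)%N]addnC !FD.
Qed.

Lemma Fmeet i j n z : F i n z -> F j n z -> (i = j %[mod m n])%N.
Proof.
rewrite -(@Fmod (i %% m n)%N) ?modn_mod// -(@Fmod (j %% m n)%N j) ?modn_mod//.
by move=> Fi Fj; apply: (Jdisj (n := n)); rewrite /= ?ltn_mod//; exists z.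
Qed.

Lemma Jle n k : (n <= k)%N -> J k `<=` J n.
Proof. exact: decreasing_le. Qed.

Lemma Fle i n k : (n <= k)%N -> F i k `<=` F i n.
Proof. by move=> nk; apply: image_subset; exact: Jle. Qed.

Lemma Fp i n : F i n (iter i f p). Proof. by exists p. Qed.

Lemma m_dvd n k : (n <= k)%N -> (m n %| m k)%N.
Proof.
move=> nk; have pk : F (m k) k p by rewrite Jper.
have p0 : F 0%N n p by exists p.
by have := Fmeet (Fle nk pk) p0; rewrite mod0n => /eqP.
Qed.

Lemma m_large M : exists n, forall k, (n <= k)%N -> (M < m k)%N.
Proof.
have [n _ nP] : (m x @[x --> \oo]) (fun n => (M < n)%N) := minf (nbhs_infty_gt M).
by exists n => k nk; apply: nP.
Qed.

Lemma eq_of_mod i j : (forall n, (i = j %[mod m n])%N) -> i = j.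
Proof.
move=> e; have [n nP] := m_large (i + j)%N.
have := e n; rewrite !modn_small//; have := nP n (leqnn n); lia.
Qed.

Lemma iter_p_inj i j : iter i f p = iter j f p -> i = j.
Proof.
move=> e; apply: eq_of_mod => n; apply: (@Fmeet _ _ _ (iter i f p)).
  exact: Fp.
by rewrite e; exact: Fp.
Qed.

Lemma F_closed i n : closed (F i n).
Proof.
apply: compact_closed; first exact: metric_hausdorff.
apply: continuous_compact; last exact: Jc.
exact/continuous_subspaceT/iter_continuous.
Qed.

Lemma F_connected i n : connected (F i n).
Proof.
apply: connected_continuous_connected; first exact: Jconn.
exact/continuous_subspaceT/iter_continuous.
Qed.

(** A cycle with more members than there are ends of edges has a member containing no end, and
    [trap] confines it. *)
Lemma inside_edge N (h : 'I_N -> R -> T) g : graph_atlas h g ->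
  exists n0 t0 i, F t0 n0 `<=` ioo (h i) 0 1.
Proof.
move=> [hch hcov _ _ _].
have [n0 n0P] := m_large (#|{: 'I_N * bool}|).
have mn0 := n0P n0 (leqnn n0).
pose v (j : 'I_N * bool) := h j.1 (if j.2 then 1 else 0).
have [t tP] : exists t : 'I_(m n0), forall j, ~ F t n0 (v j).
  apply: contrapT => /forallNP H.
  have jP (t : 'I_(m n0)) : exists j, F (nat_of_ord t) n0 (v j).
    by have /existsNP[j /contrapT Fj] := H t; exists j.
  pose j t := projT1 (cid (jP t)).
  have jE (t : 'I_(m n0)) : F (nat_of_ord t) n0 (v (j t)) by rewrite /j; case: cid.
  have inj : injective j.
    move=> t t' e; apply/val_inj => /=.
    have := jE t; rewrite e => Ft; have := Fmeet Ft (jE t').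
    by rewrite !modn_small.
  by have := leq_card _ inj; rewrite card_ord leqNgt mn0.
exists n0, t.
have [i [s [/andP[s0 s1] zs]]] := hcov (iter t f p).
exists i.
have Ft : F t n0 (h i s) by rewrite -zs; exact: Fp.
have n0' : ~ F t n0 (h i 0) by exact: (tP (i, false)).
have n1' : ~ F t n0 (h i 1) by exact: (tP (i, true)).
apply: (@trap _ _ (h i) _ 0 s 1 (hch i)) => //; first exact: F_connected.
rewrite !lt_neqAle s0 s1 !andbT; apply/andP; split; apply/eqP => e.
  by apply: n0'; rewrite e.
by apply: n1'; rewrite -e.
Qed.

Context (N : nat) (h : 'I_N -> R -> T) (g : 'I_N -> T -> R)
  (hg : graph_atlas h g) (n0 t0 : nat) (i0 : 'I_N)
  (Hedge : F t0 n0 `<=` ioo (h i0) 0 1) (z0 : T)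
  (omega : omega_limit_of f z0 p).

(** Three distinct points of the orbit of [p] lie in one member inside an edge. By convexity the
    middle one is interior to the member, and the orbit of [z0] accumulates there. *)
Lemma enters_cycle n : exists r i, F i n (iter r f z0).
Proof.
wlog nn0 : n / (n0 <= n)%N.
  move=> H; have [|r [i Fi]] := H (maxn n n0); first exact: leq_maxr.
  by exists r, i; apply: Fle Fi; exact: leq_maxl.
have [hch _ _ _ _] := hg.
pose t k := (t0 + k * m n)%N.
have Ft k : F t0 n (iter (t k) f p) by rewrite -(FD t0 k); exact: Fp.
have inE : F t0 n `<=` ioo (h i0) 0 1 by apply: (subset_trans _ Hedge); exact: Fle.
have xiP k : exists s : R, 0 < s < 1 /\ h i0 s = iter (t k) f p.
  by have [s s01 <-] := inE _ (Ft k); exists s.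
pose xi k := projT1 (cid (xiP k)).
have xi01 k : 0 < xi k < 1 by rewrite /xi; case: cid => s [].
have xiE k : h i0 (xi k) = iter (t k) f p by rewrite /xi; case: cid => s [].
have inj k l : k != l -> xi k <> xi l.
  move=> /eqP kl e; apply: kl; have := iter_p_inj; have := xiE k; rewrite e xiE.
  by move=> e' /(_ _ _ e') /addnI /eqP; rewrite eqn_pmul2r// => /eqP.
have [a [b [c /andP[ab bc]]]] := @middle_of_three R xi
  (inj 0%N 1%N isT) (inj 0%N 2%N isT) (inj 1%N 2%N isT).
have sub : ioo (h i0) (xi a) (xi c) `<=` F t0 n.
  move=> _ [s /= /andP[as_ sc] <-].
  have /andP[a0 a1] := xi01 a; have /andP[c0 c1] := xi01 c.
  apply: (@between _ _ (h i0) (F t0 n) 0 1 (xi a) s (xi c)) => //.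
  - exact: F_connected.
  - by rewrite xiE.
  - by rewrite xiE.
  - by rewrite !ltW.
have [_ _ ho] := hch i0.
have nb : nbhs (iter (t b) f p) (F t0 n).
  apply: filterS sub _; apply: open_nbhs_nbhs; split.
    by apply: ho; apply: ltW; have /andP[] := xi01 a; have /andP[] := xi01 c.
  by rewrite -xiE; exists (xi b) => //=; rewrite ab.
have [r _ Fr] := omega_limit_iter 0%N cf omega nb.
by exists (t b + r)%N, t0.
Qed.

Lemma eventually_in_cycle n : exists r a, forall q, (r <= q)%N ->
  F (a + (q - r))%N n (iter q f z0).
Proof.
have [r [a Fa]] := enters_cycle n; exists r, a => q rq.
by rewrite addnC image_iterD; exists (iter r f z0) => //; rewrite -iterD subnK.
Qed.

Lemma near_in_J n : exists rho, \forall z \near p,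
  forall r, (rho <= r)%N -> iter r f z0 = z -> J n z.
Proof.
have [rho [a ra]] := eventually_in_cycle n; exists rho.
pose D := \bigcup_(i in [set i | (0 < i < m n)%N]) F i n.
have Dcl : closed D.
  apply: closed_bigcup => [|i _]; last exact: F_closed.
  apply: (@sub_finite_set _ _ `I_(m n)); last exact: finite_II.
  by move=> i /= /andP[].
have nD : ~ D p.
  move=> [i /= /andP[i0' im] Fi]; have p0 : F 0%N n p by exists p.
  have := Fmeet Fi p0; rewrite mod0n modn_small// => e.
  by rewrite e in i0'.
apply: filterS (open_nbhs_nbhs (conj (closed_openC Dcl) nD)) => z nz r rr rz.
have := ra r rr; rewrite rz; set i := (a + (r - rho))%N.
rewrite (@Fmod i (i %% m n)) ?modn_mod//.
have [->|ip] := posnP (i %% m n)%N; first by move=> [u Ju <-].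
by move=> Fz; exfalso; apply: nz; exists (i %% m n)%N => //=; rewrite ip ltn_mod m0.
Qed.

(** The orbit of [p] is infinite, so the orbit of [z0] hits [p] at most once. *)
Lemma z0_recurrent (U : set T) M : nbhs p U ->
  exists r, [/\ (M <= r)%N, U (iter r f z0) & iter r f z0 <> p].
Proof.
move=> pU; have [r Mr Ur] := @omega_limit_iter _ f z0 p 0%N U M cf omega pU.
have [e|ne] := pselect (iter r f z0 = p); last by exists r.
have [r' rr' Ur'] := @omega_limit_iter _ f z0 p 0%N U r.+1 cf omega pU.
exists r'; split => //; first by lia.
move=> e'; have : iter (r' - r) f p = iter 0 f p.
  by rewrite -{1}e -iterD subnK ?e'// ltnW.
by move=> /iter_p_inj; lia.
Qed.

Lemma approaching_germ : exists2 c : R -> T, chart c /\ c 0 = p &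
  forall e M, 0 < e <= 1 ->
    exists r s, [/\ (M <= r)%N, 0 < s < e & iter r f z0 = c s].
Proof.
have [c [ok gc]] := germs_exist p hg.
(* The inequality [1 <= r%:R * e] expresses late times by a condition monotone in the scale. *)
have [|e U e01 pU|j okj jP] := @germ_frequently _ _ _ c ok p
  (fun e z => exists2 r : nat, 1 <= r%:R * e & z = iter r f z0) gc.
- move=> e e' z ee' [r re ->]; exists r => //; apply: le_trans re _.
  by rewrite ler_wpM2l.
- pose M := Num.bound (e^-1); have /andP[e0 _] := e01.
  have [r [Mr Ur rp]] := z0_recurrent M pU.
  exists (iter r f z0); split => //; exists r => //.
  rewrite -ler_pdivrMr// div1r; apply: le_trans (ltW (archi_boundP _)) _.
    by rewrite invr_ge0 ltW.
  by rewrite ler_nat.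
exists (c j); first by have [+ _] := gc; apply.
move=> e M /andP[e0 e1].
pose e' := Num.min e (M.+1%:R^-1).
have e'0 : 0 < e' <= 1.
  by rewrite lt_min e0 invr_gt0 ltr0n/= ge_min e1.
have [s [/andP[s0 se] [r re zr]]] := jP e' e'0.
exists r, s; split; [|by rewrite s0 (lt_le_trans se)// ge_min lexx|by []].
have : 1 <= r%:R * M.+1%:R^-1 :> R.
  by apply: le_trans re _; rewrite ler_wpM2l// ge_min lexx orbT.
rewrite ler_pdivlMr ?ltr0n// mul1r ler_nat; lia.
Qed.

(* The germ joins [p] to a point of the orbit of [z0]; at most one such point
   has trivial phase at all levels. *)
Lemma phased_arc n (U : set T) : nbhs p U -> exists A z k1,
  [/\ connected A, A p /\ A z, A `<=` U, A `<=` J n &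
    forall k, (k1 <= k)%N -> exists i t1, ~~ (m k %| i)%N /\
      forall t, (t1 <= t)%N -> F (t + i)%N k (iter t f z)].
Proof.
move=> pU; have [c [hc c0] cP] := approaching_germ.
have [rho near_p] := near_in_J n.
have cp : (fun s => c s) @ (0 : R) --> p by rewrite -c0; apply: chart_cont hc 0.
have accJ e : 0 < e -> exists2 s, 0 < s < e & J n (c s).
  move=> e0.
  have /nbhs_ballP[d /= d0 dP] := cp _ near_p.
  have [|r [s [rr /andP[s0 se] rs]]] := cP (Num.min (Num.min d e) 1) rho.
    by rewrite !lt_min d0 e0 ltr01 ge_min lexx orbT.
  move: se; rewrite !lt_min => /andP[/andP[sd se] _].
  exists s; first by rewrite s0.
  apply: (dP s _ r rr rs); rewrite /ball /= sub0r normrN gtr0_norm//.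
have [d /andP[d0 d1] dP] := initial_arc hc (@Jconn n) accJ.
have /nbhs_ballP[e /= e0 eP] := cp _ pU.
pose eta := Num.min (Num.min d e) 1.
have eta01 : 0 < eta <= 1 by rewrite !lt_min d0 e0 ltr01 ge_min lexx orbT.
have arc s : 0 < s < eta -> [/\ connected (icc c 0 s), icc c 0 s p,
    icc c 0 s (c s), icc c 0 s `<=` U & icc c 0 s `<=` J n].
  rewrite !lt_min => /andP[s0 /andP[/andP[sd se] s1]]; split.
  - exact: icc_connected (chart_cont hc).
  - by exists 0 => //=; rewrite lexx ltW.
  - by exists s => //=; rewrite lexx ltW.
  - move=> _ [u /= /andP[u0 us] <-]; apply: eP.
    by rewrite /ball /= sub0r normrN ger0_norm// (le_lt_trans us).
  - move=> _ [u /= /andP[u0 us] <-].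
    have [->|un0] := eqVneq u 0; first by rewrite c0.
    by apply: dP; rewrite lt_neqAle eq_sym un0 u0 (le_lt_trans us).
(* A bad time is one of trivial phase at all levels. Two bad times agree modulo every [m k], so of
   two points found on the germ one is good. *)
pose bad r := forall k, exists t, F t k (iter (t + r) f z0).
have bad1 r r' : bad r -> bad r' -> (r < r')%N -> False.
  move=> br br' rr'; suff : (r' - r = 0)%N by lia.
  apply: eq_of_mod => k; have [t Ft] := br k; have [t' Ft'] := br' k.
  have up a b q : F a k (iter b f z0) -> F (q + a)%N k (iter (q + b) f z0).
    by move=> Fa; rewrite image_iterD iterD; exists (iter b f z0).
  have H1 := up _ _ (t' + (r' - r))%N Ft; have H2 := up _ _ t Ft'.
  have etr : (t' + (r' - r) + (t + r) = t + (t' + r'))%N by lia.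
  rewrite etr in H1; have := Fmeet H1 H2.
  have -> : (t' + (r' - r) + t = (r' - r) + (t + t'))%N by lia.
  rewrite -{2}[(t + t')%N]add0n => /eqP; rewrite eqn_modDr => /eqP //.
have [r [s [seta rs nbad]]] : exists r s, [/\ 0 < s < eta, iter r f z0 = c s & ~ bad r].
  have [r [s [_ seta rs]]] := cP eta 0%N eta01.
  have [r' [s' [rr' s'eta rs']]] := cP eta r.+1 eta01.
  have [br|nb] := pselect (bad r); last by exists r, s.
  by exists r', s'; split => // br'; exact: (bad1 r r').
have [k1 /forallNP k1P] := (existsNP _).2 (fun H : forall k, exists t, F t k (iter (t + r) f z0) => nbad H).
have [Ac Ap Az AU AJ] := arc s seta.
exists (icc c 0 s), (iter r f z0), k1; split => //; first by rewrite rs.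
move=> k k1k; have [rk [a ra]] := eventually_in_cycle k.
have mk := m0 k.
(* This is [a + r - rk] modulo [m k], the phase at time zero of the point [iter r f z0], written
   without subtraction. *)
pose i := (a + r + rk * (m k).-1)%N.
have key t : (rk <= t)%N -> F (t + i)%N k (iter (t + r) f z0).
  move=> rt; have := ra (t + r)%N; rewrite (@Fmod _ (t + i)%N).
    by apply; lia.
  have -> : (t + i = (a + (t + r - rk)) + rk * m k)%N.
    by rewrite /i -{2}(prednK mk) mulnS; lia.
  by apply/eqP; rewrite -[X in X == _ %[mod _]]addn0 eqn_modDl mod0n modnMl.
exists i, rk; split; last by move=> t rt; rewrite -iterD; exact: key.
apply/negP => mi; apply: (k1P rk).
have FK := key rk (leqnn _); rewrite (@Fmod _ rk) in FK; last first.
  by apply/eqP; rewrite -[X in _ == X %[mod _]]addn0 eqn_modDl mod0n.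
exact: (Fle k1k FK).
Qed.

End Nested.

Lemma finite_nat_bounded (I : set nat) : finite_set I ->
  exists M, forall i, I i -> (i <= M)%N.
Proof.
move=> /finite_seqP[s ->]; exists (\max_(i <- s) i)%N => i is_.
by rewrite (big_rem i)//= leq_maxl.
Qed.

(** * Independence for two points of nested periodic subgraphs *)

Section NestedPair.
Context (R : realType) (T : metricType R) (f : T -> T) (cf : continuous f).
Context (J : nat -> set T) (m : nat -> nat)
  (Jc : forall n, compact (J n)) (Jconn : forall n, connected (J n))
  (m0 : forall n, (0 < m n)%N)
  (Jdisj : forall n, trivIset `I_(m n) (fun i => iter i f @` J n))
  (Jper : forall n, iter (m n) f @` J n = J n)
  (Jdec : forall n, J n.+1 `<=` J n)
  (minf : m @ \oo --> \oo)
  (x y : T) (Jx : forall n, J n x) (Jy : forall n, J n y)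
  (N : nat) (h : 'I_N -> R -> T) (g : 'I_N -> T -> R)
  (hg : graph_atlas h g) (n0 t0 : nat) (i0 : 'I_N)
  (Hedge : iter t0 f @` J n0 `<=` ioo (h i0) 0 1) (zx zy : T)
  (omegax : omega_limit_of f zx x) (omegay : omega_limit_of f zy y).

Local Notation F i n := (iter i f @` J n).

Let modF : forall i j n, (i = j %[mod m n])%N -> F i n = F j n := Fmod Jper.
Let meetF i j n z : F i n z -> F j n z -> (i = j %[mod m n])%N.
Proof. exact: (Fmeet m0 Jdisj Jper). Qed.
Let leF i n k : (n <= k)%N -> F i k `<=` F i n.
Proof. exact: (Fle Jdec). Qed.
Let dvdm n k : (n <= k)%N -> (m n %| m k)%N.
Proof. exact: (m_dvd m0 Jdisj Jper Jdec Jx). Qed.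

(* Both arcs issued from [x] and [y] are eventually stretched to the right of
   the leftmost member of a cycle inside an edge, hence over a common member. *)
Lemma common_cover n (U1 U2 : set T) : (n0 <= n)%N -> nbhs x U1 -> nbhs y U2 ->
  exists A B k t, [/\ A `<=` U1 `&` J n, B `<=` U2 `&` J n, (n <= k)%N,
    (0 < t)%N & J k `<=` iter t f @` A /\ J k `<=` iter t f @` B].
Proof.
move=> nn0 xU1 yU2.
have [A [zA [kA [Ac [Ax AzA] AU AJ AP]]]] :=
  phased_arc cf Jc Jconn m0 Jdisj Jper Jdec minf Jx hg Hedge omegax n xU1.
have [B [zB [kB [Bc [By BzB] BU BJ BP]]]] :=
  phased_arc cf Jc Jconn m0 Jdisj Jper Jdec minf Jy hg Hedge omegay n yU2.
pose k1 := maxn (maxn kA kB) n.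
have kA1 : (kA <= k1)%N by rewrite /k1; lia.
have kB1 : (kB <= k1)%N by rewrite /k1; lia.
have nk1 : (n <= k1)%N by rewrite /k1; lia.
have n0k1 : (n0 <= k1)%N by exact: leq_trans nk1.
have [iA [tA [miA PA]]] := AP k1 kA1.
have [iB [tB [miB PB]]] := BP k1 kB1.
have [k2' k2P] := m_large minf (m k1).
pose k2 := maxn k2' k1.
have k12 : (k1 <= k2)%N by rewrite leq_maxr.
have m12 : (m k1 < m k2)%N by apply: k2P; rewrite leq_maxl.
have n0k2 : (n0 <= k2)%N by exact: leq_trans k12.
have md01 : (m n0 %| m k1)%N by exact: dvdm.
have md02 : (m n0 %| m k2)%N by exact: dvdm.
have md12 : (m k1 %| m k2)%N by exact: dvdm.
have hch : chart (h i0) by have [+ _ _ _ _] := hg; apply.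
pose res t := (t %% m n0 == t0 %% m n0)%N.
have inE t k : res t -> (n0 <= k)%N -> F t k `<=` ioo (h i0) 0 1.
  move=> /eqP rt nk; apply: subset_trans (leF nk) _.
  by rewrite (modF rt).
have res_mod t k : (n0 <= k)%N -> res t -> res (t %% m k)%N.
  by move=> nk; rewrite /res modn_dvdm// dvdm.
have xiP t : exists s : R, res t -> 0 < s < 1 /\ h i0 s = iter t f x.
  have [rt|] := boolP (res t); last by exists 0.
  have [|s s01 <-] := @inE t n0 rt (leqnn _) (iter t f x); first by exists x.
  by exists s.
pose xi t := projT1 (cid (xiP t)).
have xi01 t : res t -> 0 < xi t < 1 by rewrite /xi; case: cid => s H /H[].
have xiE t : res t -> h i0 (xi t) = iter t f x.
  by rewrite /xi; case: cid => s H /H[].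
have tP : res (t0 %% m k2)%N by apply: res_mod => //; rewrite /res.
pose o0 := Ordinal (ltn_pmod t0 (m0 k2)).
have [ts ts_min] : exists ts : 'I_(m k2), res ts /\
    forall t : 'I_(m k2), res t -> xi ts <= xi t.
  case: (@Order.TotalTheory.arg_minP _ R _ o0 (fun t : 'I_(m k2) => res t)
    (fun t : 'I_(m k2) => xi t)) => // ts rts H.
  by exists ts; split.
have [rts tsle] := ts_min.
(* The added multiple of [m k2] does not change the member and makes the time late enough for both
   phases. *)
pose t := (ts + (tA + tB) * m k2)%N.
have tAB_t : (tA + tB <= t)%N.
  exact: leq_trans (leq_pmulr _ (m0 k2)) (leq_addl _ _).
have tA_t : (tA <= t)%N by exact: leq_trans (leq_addr _ _) tAB_t.
have tB_t : (tB <= t)%N by exact: leq_trans (leq_addl _ _) tAB_t.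
have tts : (t = ts %[mod m k2])%N by rewrite /t addnC modnMDl.
have modk a b k l : (k <= l)%N -> (a = b %[mod m l])%N -> (a = b %[mod m k])%N.
  move=> kl /eqP e; apply/eqP; rewrite -(modn_dvdm a (dvdm kl)).
  by rewrite (eqP e) modn_dvdm// dvdm.
have rt : res t by rewrite /res (modk _ _ _ _ n0k2 tts).
have right k s (u v : R) : (n0 <= k)%N -> (k <= k2)%N -> res s ->
    (s <> t %[mod m k])%N ->
    0 < u < 1 -> 0 < v < 1 -> F t k (h i0 u) -> F s k (h i0 v) -> u < v.
  move=> nk kk2 rs nst u01 v01 Fu Fv.
  pose s' := (s %% m k2)%N.
  have rs' : res s' by apply: res_mod.
  have ss' : (s = s' %[mod m k2])%N by rewrite /s' modn_mod.
  apply: (@ordered_of_disjoint R T (h i0) (F t k) (F s k) (xi ts) (xi s') u v) => //.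
  - exact: F_connected.
  - exact: F_connected.
  - exact: inE.
  - exact: inE.
  - rewrite -subset0 => z [Ft Fs]; apply: nst.
    exact: (meetF Fs Ft).
  - exact: xi01.
  - exact: xi01.
  - rewrite xiE// (modF (modk _ _ _ _ kk2 tts)); by exists x.
  - rewrite xiE// (modF (modk _ _ _ _ kk2 ss')); by exists x.
  - exact: (tsle (Ordinal (ltn_pmod s (m0 k2)))).
(* [F s2 k2] is another member of level [k2] inside [F t k1]. It lies to the right of [F t k2],
   which contains the image of the origin of the arc, and to the left of [F (t + i) k1], which
   contains the image of its other end; so the image of the arc covers it. *)
pose s2 := (t + m k1)%N.
have rs2 : res s2.
  by rewrite /res /s2 -modnDmr (eqP md01) addn0.
have ns2 : (s2 <> t %[mod m k2])%N.
  rewrite /s2 -[X in _ <> X %[mod _]]addn0 => /eqP; rewrite eqn_modDl mod0n.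
  rewrite modn_small// => /eqP e; by have := m0 k1; rewrite e.
have cover C p z i tz : connected C -> C p -> C z -> C `<=` J n ->
    (forall k, J k p) -> ~~ (m k1 %| i)%N ->
    (forall t, (tz <= t)%N -> F (t + i)%N k1 (iter t f z)) ->
    (tz <= t)%N -> F s2 k2 `<=` iter t f @` C.
  move=> Cc Cp Cz CJ Jp mi Pz tzt w Fw.
  have Ct : iter t f @` C `<=` F t n0.
    by move=> _ [u Cu <-]; apply: (leF nn0); exists u => //; exact: CJ.
  have Ce : iter t f @` C `<=` ioo (h i0) 0 1.
    exact: subset_trans Ct (inE t n0 rt (leqnn _)).
  have Cit u : C u -> exists s : R, 0 < s < 1 /\ h i0 s = iter t f u.
    by move=> Cu; have [|s s01 <-] := Ce (iter t f u); [exists u|exists s].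
  have [a [a01 ae]] := Cit p Cp; have [b [b01 be]] := Cit z Cz.
  have [c c01 ce] := inE s2 k2 rs2 n0k2 w Fw.
  have rti : res (t + i)%N.
    rewrite /res; apply/eqP; rewrite -(eqP rt).
    apply: (@meetF _ _ n0 (iter t f z)); last by apply: Ct; exists z.
    exact: (leF n0k1 (Pz t tzt)).
  have ac : a < c.
    apply: (right k2 s2) => //; first by rewrite ae; exists p.
    by rewrite ce.
  have cb : c < b.
    have nti : (t + i <> t %[mod m k1])%N.
      rewrite -[X in _ <> X %[mod _]]addn0 => /eqP; rewrite eqn_modDl mod0n.
      by move=> e; rewrite /dvdn e in mi.
    have Fw1 : F t k1 (h i0 c).
      rewrite ce (@modF t s2).
        exact: (leF k12 Fw).
      by rewrite /s2 modnDr.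
    apply: (right k1 (t + i)%N) => //.
    by rewrite be; exact: Pz.
  rewrite -ce; apply: (@between _ _ (h i0) (iter t f @` C) 0 1 a c b) => //.
  - apply: connected_continuous_connected => //.
    exact/continuous_subspaceT/iter_continuous.
  - by case/andP: a01.
  - by case/andP: b01.
  - by rewrite ae; exists p.
  - by rewrite be; exists z.
  - by rewrite !ltW.
(* [e + s2] is a multiple of [m k2], so [e] further steps bring the covered member back to
   [J k2]. *)
pose e := (s2 * (m k2).-1)%N.
have eJ : F (e + s2)%N k2 = J k2.
  rewrite (@modF _ 0%N); last first.
    have -> : (e + s2 = s2 * m k2)%N by rewrite /e -{2}(prednK (m0 k2)) mulnS addnC.
    by rewrite modnMl mod0n.
  by apply/seteqP; split => z; [move=> [u Ju <-]|move=> Jz; exists z].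
exists A, B, k2, (e + t)%N; split.
- by move=> z Az; split; [exact: AU|exact: AJ].
- by move=> z Bz; split; [exact: BU|exact: BJ].
- exact: leq_trans nk1 k12.
- rewrite addn_gt0 muln_gt0 /s2 addn_gt0 (m0 k1) orbT /= -subn1 subn_gt0.
  by rewrite (leq_ltn_trans (m0 k1) m12).
- rewrite -eJ (image_iterD f e s2) !(image_iterD f e t).
  split; apply: image_subset.
    exact: (@cover A x zA iA tA Ac Ax AzA AJ Jx miA PA tA_t).
  exact: (@cover B y zB iB tB Bc By BzB BJ Jy miB PB tB_t).
Qed.

(** Both arcs of a stage cover the [J] of the next level, which contains both arcs of the next
    stage. All itineraries occur, and the partial sums of the covering times form the independence
    set. *)
Lemma nested_pair_IT : IT_pair f x y.
Proof.
move=> U1 U2 xU1 yU2.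
have stepP n : exists K : (bool -> set T) * nat * nat, (n0 <= n)%N ->
    [/\ forall b, K.1.1 b `<=` (if b then U1 else U2) `&` J n, (n <= K.1.2)%N,
      (0 < K.2)%N & forall b, J K.1.2 `<=` iter K.2 f @` K.1.1 b].
  have [nn0|] := boolP (n0 <= n)%N; last by exists ((fun=> set0), 0, 0)%N.
  have [A [B [k [t [AU BU nk t0' [JA JB]]]]]] := common_cover nn0 xU1 yU2.
  exists ((fun b => if b then A else B), k, t) => _; split => //; by case.
pose step n := projT1 (cid (stepP n)).
have stepE n : (n0 <= n)%N ->
    [/\ forall b, (step n).1.1 b `<=` (if b then U1 else U2) `&` J n,
      (n <= (step n).1.2)%N,
      (0 < (step n).2)%N &
      forall b, J (step n).1.2 `<=` iter (step n).2 f @` (step n).1.1 b].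
  by rewrite /step; case: cid.
pose lev j := iter j (fun n => (step n).1.2) n0.
have lev0 j : (n0 <= lev j)%N.
  elim: j => [|j IH] //=; have [_ l _ _] := stepE _ IH; exact: leq_trans l.
pose E j := (step (lev j)).1.1; pose tm j := (step (lev j)).2.
have EU j b : E j b `<=` if b then U1 else U2.
  by have [H _ _ _] := stepE _ (lev0 j) => z /H[].
have tm0 j : (0 < tm j)%N by have [] := stepE _ (lev0 j).
have EE j b b' : E j.+1 b' `<=` iter (tm j) f @` E j b.
  have [_ _ _ H] := stepE _ (lev0 j); apply: subset_trans (H b).
  by have [H' _ _ _] := stepE _ (lev0 j.+1) => z /H'[].
pose tau j0 j := (\sum_(i < j) tm (j0 + i))%N.
have tauS j0 j : tau j0 j.+1 = (tau j0.+1 j + tm j0)%N.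
  rewrite /tau big_ord_recl addn0 addnC; congr (_ + _)%N.
  by apply: eq_bigr => i _; rewrite /= /bump /= add1n addSnnS.
have tau_inc j : (tau 0 j < tau 0 j.+1)%N.
  by rewrite /tau big_ord_recr /= -[X in (X < _)%N]addn0 ltn_add2l tm0.
have tau_ge j : (j <= tau 0 j)%N.
  by elim: j => [|j IH] //; apply: leq_ltn_trans (tau_inc j).
have E0 j b : E j b !=set0.
  have [_ _ _ H] := stepE _ (lev0 j).
  by have [w Ew _] := H b x (Jx _); exists w.
have itin q : forall j0 (s : nat -> bool), exists2 w, E j0 (s j0) w &
    forall j, (j <= q)%N -> E (j0 + j)%N (s (j0 + j)%N) (iter (tau j0 j) f w).
  elim: q => [|q IH] j0 s.
    have [w Ew] := E0 j0 (s j0); exists w => // j; rewrite leqn0 => /eqP ->.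
    by rewrite /tau big_ord0 addn0.
  have [w Ew wP] := IH j0.+1 s.
  have [v Ev vw] := EE j0 (s j0) (s j0.+1) w Ew.
  exists v => // -[|j] jq; first by rewrite /tau big_ord0 addn0.
  by rewrite tauS iterD vw -addSnnS; exact: wP.
(* The sum of index 0 is left out because independence sets consist of positive times. *)
exists [set tau 0%N j.+1 | j in setT].
  move=> /finite_nat_bounded[M MP].
  have : (tau 0%N M.+1 <= M)%N by apply: MP; exists M.
  by rewrite leqNgt tau_ge.
split.
  by move=> _ [j _ <-]; apply: leq_trans (tau_ge j.+1).
move=> I Ifin _ Isub S.
have [M MP] := finite_nat_bounded Ifin.
have [w _ wP] := itin M.+1 0%N (fun j => S (tau 0%N j) == ord0).
exists w => i Ii; have [j _ ji] := Isub i Ii.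
have jM : (j.+1 <= M.+1)%N.
  by rewrite ltnS; apply: leq_trans (MP i Ii); rewrite -ji; apply: ltnW (tau_ge j.+1).
have /EU := wP j.+1 jM; rewrite add0n ji /=.
by case: (S i) => [[|[|//]]] k.
Qed.

End NestedPair.

(** * Localization at a germ *)

Section Localization.
Context (R : realType) (T : metricType R) (f : T -> T).

(* [k] is both the length of the words and a lower bound for the times. *)
Definition germ_words (c : R -> T) (e : R) (V : set T) (k : nat) :=
  exists t : nat -> nat, [/\ forall j, (j < k)%N -> (k <= t j)%N,
    forall i j, (i < j < k)%N -> (t i < t j)%N &
    forall s : nat -> bool, exists2 u, 0 < u < e & forall j, (j < k)%N ->
      (if s j then ioo c 0 e else V) (iter (t j) f (c u))].

Definition localized (c : R -> T) (y : T) := forall e V k,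
  0 < e <= 1 -> nbhs y V -> germ_words c e V k.

Lemma germ_words_mono c e e' V V' k k' : e <= e' -> V `<=` V' ->
  (k' <= k)%N -> germ_words c e V k -> germ_words c e' V' k'.
Proof.
move=> ee VV kk [t [tk tinc tw]]; exists t; split.
- by move=> j jk; apply: (leq_trans kk); apply: tk; exact: leq_trans kk.
- by move=> i j /andP[ij jk]; apply: tinc; rewrite ij (leq_trans jk).
- move=> s; have [u /andP[u0 ue] uw] := tw s.
  exists u; first by rewrite u0 (lt_le_trans ue).
  move=> j jk; have := uw j (leq_trans jk kk).
  case: (s j) => [[w /= /andP[w0 we] <-]|/VV//].
  by exists w => //=; rewrite w0 (lt_le_trans we).
Qed.

(** The first time is spent on bringing the orbit to the germ, and the clock restarts there.
    Skipping the next [k] times makes the remaining differences at least [k]. *)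
Lemma indep_germ_words (c : R -> T) e V (I : seq nat) k : uniq I ->
  (k.*2.+2 <= size I)%N ->
  indep [set: T] (fun i => [set z | ioo c 0 e (iter i f z)])
    (fun i => [set z | V (iter i f z)]) I ->
  germ_words c e V k.
Proof.
move=> uI sI ind.
pose p := sort leq I.
have sp : size p = size I by rewrite size_sort.
have psort : sorted ltn p.
  by rewrite ltn_sorted_uniq_leq sort_uniq uI sort_sorted//; exact: leq_total.
have pinc i j : (i < j < size p)%N -> (nth 0%N p i < nth 0%N p j)%N.
  move=> /andP[ij jp]; apply: (sorted_ltn_nth ltn_trans 0%N psort) => //.
  by rewrite inE (ltn_trans ij).
have pge r : (r < size p)%N -> (nth 0%N p 0 + r <= nth 0%N p r)%N.
  elim: r => [|r IH] rp; first by rewrite addn0.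
  rewrite addnS; apply: leq_ltn_trans (IH (ltnW rp)) _.
  by apply: pinc; rewrite ltnSn.
pose t j := (nth 0%N p (k.+1 + j) - nth 0%N p 0)%N.
exists t; split.
- move=> j jk; rewrite /t; have := pge (k.+1 + j)%N; rewrite sp; lia.
- move=> i j /andP[ij jk]; rewrite /t.
  have := pinc (k.+1 + i)%N (k.+1 + j)%N; have := pge (k.+1 + i)%N.
  by rewrite sp; lia.
move=> s.
have [z _ zw] := ind (fun i => if i == nth 0%N p 0 then true
  else s (index i p - k.+1)%N).
have pI r : (r < size p)%N -> nth 0%N p r \in I.
  by move=> rp; rewrite -(mem_sort leq) mem_nth.
have [u /= u0e uz] : ioo c 0 e (iter (nth 0%N p 0) f z).
  have := zw _ (pI 0%N _); rewrite eqxx; apply; rewrite sp; lia.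
exists u => // j jk.
have kj : (k.+1 + j < size p)%N by rewrite sp; lia.
have := zw _ (pI _ kj).
rewrite gtn_eqF; last by apply: pinc; rewrite kj; lia.
rewrite index_uniq//; last by rewrite sort_uniq.
rewrite addKn uz -iterD /t subnK; last by have := pge _ kj; lia.
by case: (s j).
Qed.

(** If each germ failed, the letter at [x] would split into the germs and the point [x] itself, and
    [split_letters] would leave one of these. A germ contradicts its failure. If [x] itself is left,
    two times show that it returns to [x] after their difference, so the word [x] followed by [W]
    cannot occur, as [W] omits [x]. *)
Lemma localization N (h : 'I_N -> R -> T) g x y : graph_atlas h g ->
  IN_pair f x y -> x <> y ->
  exists c, [/\ chart c, c 0 = x & localized c y].
Proof.
move=> hg IN xy.
have [c [ok [cok cnb]]] := germs_exist x hg.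
suff [j okj jP] : exists2 j, ok j & localized (c j) y.
  by have [] := cok j okj; exists (c j).
apply: contrapT => Hn.
have badP j : exists e V k, 0 < e <= 1 /\ nbhs y V /\
    (ok j -> ~ germ_words (c j) e V k).
  have [okj|/negP nok] := boolP (ok j); last first.
    by exists 1, setT, 0%N; split; [rewrite ltr01 lexx|split; [exact: filterT|]].
  apply: contrapT => H; apply: Hn; exists j => // e V k e01 yV.
  apply: contrapT => ng; apply: H; by exists e, V, k; do !split.
pose e j := projT1 (cid (badP j)).
have VP j : exists V k, 0 < e j <= 1 /\ nbhs y V /\
    (ok j -> ~ germ_words (c j) (e j) V k) by rewrite /e; case: cid.
pose V j := projT1 (cid (VP j)).
have kP j : exists k, 0 < e j <= 1 /\ nbhs y (V j) /\
    (ok j -> ~ germ_words (c j) (e j) (V j) k) by rewrite /V; case: cid.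
pose k j := projT1 (cid (kP j)).
have eVk j : 0 < e j <= 1 /\ nbhs y (V j) /\
    (ok j -> ~ germ_words (c j) (e j) (V j) (k j)) by rewrite /k; case: cid.
pose m := \big[Num.min/1]_j e j.
have m1 : m <= 1.
  rewrite /m; elim/big_ind: _ => [//|a b a1 _|j _]; first by rewrite ge_min a1.
  by have [/andP[]] := eVk j.
have m0 : 0 < m.
  rewrite /m; elim/big_ind: _ => [//|a b a0 b0|j _]; first by rewrite lt_min a0.
  by have [/andP[]] := eVk j.
have me j : m <= e j by rewrite /m (bigD1 j)//= ge_min lexx.
pose W := \big[setI/setT]_j V j `&` ~` [set x].
have yW : nbhs y W.
  apply: filterI.
    elim/big_ind: _ => [|A B|j _]; [exact: filterT|exact: filterI|].
    by have [_ []] := eVk j.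
  apply: open_nbhs_nbhs; split; last by move=> /esym.
  by apply: closed_openC; apply: compact_closed (@compact_set1 _ x);
    exact: metric_hausdorff.
have WV j : W `<=` V j by rewrite /W (bigD1 j)//= => z [[]].
pose K := (\max_j k j)%N.
have kK j : (k j <= K)%N by exact: (leq_bigmax j).
pose letters : seq (option ('I_N * bool)) := None :: map some (enum ok).
have [M MP] := @split_letters T _ letters (K.*2.+2).
pose P (l : option ('I_N * bool)) (i : nat) : set T :=
  if l is Some j then [set z | ioo (c j) 0 m (iter i f z)]
  else [set z | iter i f z = x].
have m01 : 0 < m <= 1 by rewrite m0.
have [I MI [_ indI]] := IN _ W (cnb m m01) yW M.+1.
have sI : (M < size (enum_fset I))%N by [].
have ind : indep [set: T] (fun i => [set z | exists2 l, l \in letters & P l i z])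
    (fun i => [set z | W (iter i f z)]) (enum_fset I).
  move=> s; have [||//|z zP] := indI [set` I] _ _ _ (fun i => if s i then ord0 else ord_max).
  - exact: finite_fset.
  - have /fset0Pn[i iI] : I != fset0 by rewrite -cardfs_gt0 (leq_ltn_trans _ MI).
    by exists i.
  exists z => // i iI; have := zP i iI; case: (s i) => /=; last by [].
  move=> [zx|[j [u [okj u0m zu]]]]; first by exists None => //; exact: mem_head.
  exists (Some j); last by exists u.
  by rewrite inE /= map_f// mem_enum.
have [||[j|] lj [I' [I'I uI' sI' ind']]] := MP _ _ _ _ _ _ ind.
- exact: fset_uniq.
- exact: ltnW.
- have okj : ok j.
    move: lj; rewrite inE /= => /mapP[j' ]; rewrite mem_enum => okj' [->].
    exact: okj'.
  have [_ [_ /(_ okj)]] := eVk j; apply.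
  apply: (germ_words_mono (me j) (WV j) (kK j)).
  exact: indep_germ_words ind'.
have [a0 [a1 [a01 aI0 aI1]]] : exists a0 a1, [/\ a0 != a1, a0 \in I' & a1 \in I'].
  case: I' uI' sI' {I'I ind'} => [|a0 [|a1 I']] //= /andP[a01 _] _.
  exists a0, a1; rewrite !inE !eqxx orbT; split => //.
  by move: a01; rewrite inE negb_or => /andP[].
wlog lt : a0 a1 a01 aI0 aI1 / (a0 < a1)%N.
  move=> H; have [l|l|e01] := ltngtP a0 a1; first exact: (H a0 a1).
    by apply: (H a1 a0) => //; rewrite eq_sym.
  by rewrite e01 eqxx in a01.
have [z1 _ z1w] := ind' xpredT.
have [z2 _ z2w] := ind' (fun i => i == a0).
have e1 : iter a0 f z1 = x := z1w a0 aI0.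
have e1' : iter a1 f z1 = x := z1w a1 aI1.
have e2 : iter a0 f z2 = x by have := z2w a0 aI0; rewrite eqxx.
have [_] : W (iter a1 f z2).
  by have := z2w a1 aI1; rewrite eq_sym (negbTE a01).
have e3 : iter (a1 - a0) f x = x by rewrite -{1}e1 -iterD subnK// ltnW.
by apply => /=; rewrite -(subnK (ltnW lt)) iterD e2 e3.
Qed.

End Localization.

(** * Inner and outer coverings *)

Section AlternatingWords.
Context (R : realType) (k M : nat).
Context (L : nat -> R -> bool) (img : R -> Prop).

(* The points of a chain increase strictly because consecutive labels differ. *)
Fixpoint chain (j n : nat) (u : R) : Prop :=
  if n is n'.+1 then exists v, [/\ v <= u, img v, L j v = ~~ odd n' & chain j n' v]
  else True.

Lemma chain_le j n u v : u <= v -> chain j n u -> chain j n v.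
Proof.
by case: n => [//|n] uv [w [wu iw Lw cw]]; exists w; split => //; exact: le_trans uv.
Qed.

Lemma chain_dec j n n' u : (n <= n')%N -> chain j n' u -> chain j n u.
Proof.
move=> /subnK <-; elim: (n' - n)%N => [//|d IH] [w [wu _ _ cw]].
exact/IH/(chain_le wu).
Qed.

(* Along the line the vector of maximal chain lengths is nondecreasing and it
   determines the labels, so few words are realized without a long chain. *)
Lemma long_chain (pt : {ffun 'I_k -> bool} -> R) : ((k * M).+1 < 2 ^ k)%N ->
  (forall w, img (pt w)) -> (forall w (j : 'I_k), L j (pt w) = w j) ->
  exists j u, (j < k)%N /\ chain j M.+1 u.
Proof.
move=> kM ptI ptL; apply: contrapT => Hn.
have noc j u : (j < k)%N -> ~ chain j M.+1 u.
  by move=> jk cu; apply: Hn; exists j, u.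
have exP j u : exists n, ~~ `[< (j < k)%N -> chain j n.+1 u >] || (k <= j)%N.
  have [jk|kj] := ltnP j k; last by exists 0%N; rewrite orbT.
  by exists M; rewrite orbF; apply/asboolPn => /(_ isT); exact: noc.
pose ka j u := ex_minn (exP j u).
have kaP j u : (j < k)%N -> [/\ chain j (ka j u) u, ~ chain j (ka j u).+1 u &
    (ka j u <= M)%N].
  move=> jk; have nkj : (k <= j)%N = false by rewrite leqNgt jk.
  rewrite /ka; case: ex_minnP => n; rewrite nkj orbF => /asboolPn nc nmin.
  split.
  - case: n nc nmin => [//|n] _ nmin; apply: contrapT => nc.
    have : (n.+1 <= n)%N; last by rewrite ltnn.
    by apply: nmin; apply/orP; left; apply/asboolPn => /(_ jk).
  - by move=> cn; apply: nc.
  - apply: nmin; apply/orP; left; apply/asboolPn => /(_ jk); exact: noc.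
(* If the label differed from the parity of the maximal length, [u] itself would prolong the
   chain. *)
have kaL j u : (j < k)%N -> img u -> L j u = odd (ka j u).
  move=> jk iu; have [cu ncu _] := kaP j u jk.
  apply: contrapT => nL; apply: ncu; exists u; split => //.
  by move: nL; case: (L j u); case: (odd _).
have ka_mono j u v : (j < k)%N -> u <= v -> (ka j u <= ka j v)%N.
  move=> jk uv; have [cu _ _] := kaP j u jk; have [_ ncv _] := kaP j v jk.
  rewrite leqNgt; apply/negP => lt; apply: ncv.
  exact: chain_le uv (chain_dec lt cu).
(* All lengths are monotone in [u], so equal sums force equal vectors: at most [k * M + 1] words can
   be realized. *)
pose S u := (\sum_(j < k) ka j u)%N.
have SM u : (S u <= k * M)%N.
  rewrite /S -[X in (_ <= X * _)%N]card_ord -sum_nat_const.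
  by apply: leq_sum => j _; have [] := kaP j u (ltn_ord j).
have inj : injective (fun w => inord (S (pt w)) : 'I_(k * M).+1).
  move=> w w' /(congr1 val); rewrite /= !inordK ?ltnS// => SS.
  wlog le : w w' SS / pt w <= pt w'.
    by move=> H; have [|] := leP (pt w) (pt w'); [exact: H|move=> /ltW /H ->].
  apply/ffunP => j; rewrite -!ptL !kaL ?ltn_ord//; congr (odd _).
  have les (i : 'I_k) : (ka i (pt w) <= ka i (pt w'))%N.
    by apply: ka_mono.
  have [_] := leqif_sum (fun (i : 'I_k) (_ : true) => leqif_eq (les i)).
  by rewrite -/(S (pt w)) -/(S (pt w')) SS eqxx => /esym/forallP/(_ j)/eqP.
have := leq_card _ inj; rewrite card_ffun card_bool !card_ord.
by move=> H; have := leq_trans kM H; rewrite ltnn.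
Qed.

End AlternatingWords.

(** * From localized words to inner or outer coverings *)

Section Scales.
Context (R : realType) (T : metricType R) (f : T -> T) (cf : continuous f).
Context (c : R -> T) (hc : chart c) (y : T) (cy : ~ icc c 0 1 y)
  (loc : localized f c y).

Definition two_arcs (S : set T) (e : R) (k : nat) (t : nat) :=
  exists u1 u1' u2 u2' : R, [/\ 0 < u1 <= u1', u1' < u2 <= u2', u2' < e, (k <= t)%N &
    S `<=` iter t f @` icc c u1 u1' /\ S `<=` iter t f @` icc c u2 u2'].

Definition covers_inner e k := exists p t, 0 < p < e /\
  two_arcs (icc c 0 p) e k t.
Definition covers_outer e k := exists p t, 0 < p < e /\
  two_arcs (c @` [set u | p <= u < 1]) e k t.

Lemma image_arc_compact t u v : compact (iter t f @` icc c u v).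
Proof.
apply: continuous_compact; last exact: icc_compact (chart_cont hc).
exact/continuous_subspaceT/iter_continuous.
Qed.

Lemma image_arc_closed t u v : closed (iter t f @` icc c u v).
Proof.
apply: compact_closed; first exact: metric_hausdorff.
exact: image_arc_compact.
Qed.

Lemma image_arc_connected t u v : connected (iter t f @` icc c u v).
Proof.
apply: connected_continuous_connected; first exact: icc_connected (chart_cont hc).
exact/continuous_subspaceT/iter_continuous.
Qed.

Lemma closed_origin (S : set T) p : 0 < p -> closed S ->
  (forall u, 0 < u <= p -> S (c u)) -> icc c 0 p `<=` S.
Proof.
move=> p0 Scl Sp z [u /= /andP[u0 up] <-].
have [->|un0] := eqVneq u 0; last first.
  by apply: Sp; rewrite lt_neqAle eq_sym un0 u0.
apply: Scl => B /(chart_cont hc) /nbhs_ballP[r /= r0 rB].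
pose v := Num.min p (r / 2).
have v0 : 0 < v by rewrite lt_min p0 divr_gt0.
exists (c v); split; first by apply: Sp; rewrite v0 ge_min lexx.
apply: rB; rewrite /ball /= sub0r normrN gtr0_norm// /v gt_min.
by apply/orP; right; lra.
Qed.

Lemma arc_covers e t u u' : 0 < e <= 1 -> ioo c 0 e (iter t f (c u)) ->
  ~ icc c 0 1 (iter t f (c u')) -> u <= u' -> exists2 p, 0 < p < e &
  icc c 0 p `<=` iter t f @` icc c u u' \/
  c @` [set w | p <= w < 1] `<=` iter t f @` icc c u u'.
Proof.
move=> /andP[e0 e1] [p /= /andP[p0 pe] cp] out uu'; exists p; first by rewrite p0.
have Sp : (iter t f @` icc c u u') (c p).
  by rewrite cp; exists (c u) => //; exists u => //=; rewrite lexx.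
have So : (iter t f @` icc c u u') (iter t f (c u')).
  by exists (c u') => //; exists u' => //=; rewrite lexx andbT.
have [||H|H] := @leave _ _ c _ p 1 (iter t f (c u')) hc
    (@image_arc_connected t u u') (lexx _) _ Sp So.
- by rewrite p0 (lt_le_trans pe).
- move=> [w /= /andP[w0 w1] cw]; apply: out; exists w => //=.
  by rewrite !ltW.
- by left; apply: closed_origin => //; exact: image_arc_closed.
- by right => _ [w /= pw <-]; exact: H.
Qed.

(** Six points mapped alternately into the germ and off the chart bound three disjoint arcs. Each
    image covers an initial segment or the remainder of the chart, and two of the three agree. *)
Lemma covers_inner_or_outer e k : 0 < e <= 1 ->
  covers_inner e k \/ covers_outer e k.
Proof.
move=> e01; have /andP[e0 e1] := e01.
have yV : nbhs y (~` icc c 0 1).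
  apply: open_nbhs_nbhs; split => //; apply: closed_openC.
  exact: icc_closed (chart_cont hc).
have [t [tk _ tw]] := loc (k + 5)%N e01 yV.
pose L j u := `[< ioo c 0 e (iter (t j) f (c u)) >].
have t5 (j : 'I_5) : (j < k + 5)%N by rewrite ltn_addl.
pose img u := 0 < u < e /\ forall j, (j < 5)%N -> ~~ L j u -> ~ icc c 0 1 (iter (t j) f (c u)).
have ptP (w : {ffun 'I_5 -> bool}) : exists u, img u /\ forall j : 'I_5, L j u = w j.
  have [u u0e uw] := tw (fun j => if insub j is Some i then w i else false).
  have H (j : 'I_5) : (if w j then ioo c 0 e else ~` icc c 0 1) (iter (t j) f (c u)).
    by have := uw j (t5 j); rewrite valK.
  exists u; split; last first.
    move=> j; have := H j; rewrite /L; case: (w j) => Hj; first exact/asboolP.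
    apply/negbTE/asboolPn => -[v /= /andP[v0 ve] vE]; apply: Hj; exists v => //=.
    by rewrite !ltW// (lt_le_trans ve).
  split => // j j5 nL; have := H (Ordinal j5); rewrite /=.
  by case: (w _) => // Hj; move: nL; rewrite /L => /asboolPn.
pose pt w := projT1 (cid (ptP w)).
(* Since [5 * 5 + 1 < 2 ^ 5], five times suffice for a chain of six points. *)
have [||j [u [j5 ch]]] := @long_chain R 5 5 L img pt isT.
- by move=> w; rewrite /pt; case: cid => u [].
- by move=> w j; rewrite /pt; case: cid => u [].
move: ch => /= [v6 [_ i6 L6 [v5 [l5 i5 L5 [v4 [l4 i4 L4 [v3 [l3 i3 L3 [v2 [l2 i2 L2 [v1 [l1 i1 L1 _]]]]]]]]]]]].
have ltof a b : a <= b -> L j a != L j b -> a < b.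
  by move=> ab nL; rewrite lt_neqAle ab andbT; apply: contra nL => /eqP ->.
have l23 : v2 < v3 by apply: ltof => //; rewrite L2 L3.
have l45 : v4 < v5 by apply: ltof => //; rewrite L4 L5.
have kt : (k <= t j)%N.
  by apply: leq_trans (tk j _); rewrite ?leq_addr// ltn_addl.
have out v : img v -> L j v = false -> ~ icc c 0 1 (iter (t j) f (c v)).
  by move=> [_ H] Lv; apply: H => //; rewrite Lv.
have inn v : L j v = true -> ioo c 0 e (iter (t j) f (c v)) by move=> /asboolP.
have pos v : img v -> 0 < v by move=> [/andP[]].
have ltv v : img v -> v < e by move=> [/andP[]].
have [p1 p1e c1] := arc_covers (t := t j) e01 (inn _ L1) (out _ i2 L2) l1.
have [p2 p2e c2] := arc_covers (t := t j) e01 (inn _ L3) (out _ i4 L4) l3.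
have [p3 p3e c3] := arc_covers (t := t j) e01 (inn _ L5) (out _ i6 L6) l5.
have inner (a a' b b' p q : R) : img a -> img b' -> a <= a' -> a' < b -> b <= b' ->
    0 < p < e -> 0 < q < e ->
    icc c 0 p `<=` iter (t j) f @` icc c a a' ->
    icc c 0 q `<=` iter (t j) f @` icc c b b' -> covers_inner e k.
  move=> ia ib aa ab bb pe qe cp cq; exists (Num.min p q), (t j).
  have /andP[p0 pe'] := pe; have /andP[q0 qe'] := qe.
  split; first by rewrite lt_min p0 q0 gt_min pe'.
  exists a, a', b, b'; rewrite aa ab bb pos//= ltv//; split => //.
  split; [apply: subset_trans cp|apply: subset_trans cq];
    by move=> z [w /= /andP[w0]]; rewrite le_min => /andP[wp wq] <-;
       exists w => //=; rewrite w0.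
have outer (a a' b b' p q : R) : img a -> img b' -> a <= a' -> a' < b -> b <= b' ->
    0 < p < e -> 0 < q < e ->
    c @` [set w | p <= w < 1] `<=` iter (t j) f @` icc c a a' ->
    c @` [set w | q <= w < 1] `<=` iter (t j) f @` icc c b b' -> covers_outer e k.
  move=> ia ib aa ab bb pe qe cp cq; exists (Num.max p q), (t j).
  have /andP[p0 pe'] := pe; have /andP[q0 qe'] := qe.
  split; first by rewrite lt_max p0 /= gt_max pe'.
  exists a, a', b, b'; rewrite aa ab bb pos//= ltv//; split => //.
  split; [apply: subset_trans cp|apply: subset_trans cq];
    by move=> z [w /= /andP[]]; rewrite ge_max => /andP[wp wq] w1 <-;
       exists w => //=; rewrite w1 andbT.
have l14 : v2 < v5 by apply: lt_le_trans l23 _; apply: le_trans l3 (ltW l45).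
case: c1 c2 c3 => [c1|c1] [c2|c2] [c3|c3].
- by left; apply: (inner v1 v2 v3 v4 p1 p2).
- by left; apply: (inner v1 v2 v3 v4 p1 p2).
- by left; apply: (inner v1 v2 v5 v6 p1 p3).
- by right; apply: (outer v3 v4 v5 v6 p2 p3).
- by left; apply: (inner v3 v4 v5 v6 p2 p3).
- by right; apply: (outer v1 v2 v5 v6 p1 p3).
- by right; apply: (outer v1 v2 v3 v4 p1 p2).
- by right; apply: (outer v1 v2 v3 v4 p1 p2).
Qed.

Lemma two_arcs_mono S e e' k k' t : e <= e' -> (k' <= k)%N ->
  two_arcs S e k t -> two_arcs S e' k' t.
Proof.
move=> ee kk [u1 [u1' [u2 [u2' [? ? ue ? ?]]]]].
exists u1, u1', u2, u2'; split => //; first exact: lt_le_trans ee.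
exact: leq_trans kk _.
Qed.

(** Both alternatives grow stronger as [e] decreases and [k] increases, so one failure of the inner
    one yields the outer one at all scales. *)
Lemma inner_or_outer : (forall e k, 0 < e <= 1 -> covers_inner e k) \/
  (forall e k, 0 < e <= 1 -> covers_outer e k).
Proof.
have [|/existsNP[e0 /existsNP[k0 /not_implyP[/andP[e00 e01] ni]]]] :=
  pselect (forall e k, 0 < e <= 1 -> covers_inner e k); first by left.
right => e k /andP[e_gt0 e_le1].
pose e' := Num.min e e0.
have e'01 : 0 < e' <= 1 by rewrite lt_min e_gt0 e00 ge_min e_le1.
have [|] := covers_inner_or_outer (k + k0)%N e'01.
  move=> [p [t [/andP[p0 pe] H]]]; exfalso; apply: ni; exists p, t; split.
    by rewrite p0 (lt_le_trans pe)// ge_min lexx orbT.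
  by apply: two_arcs_mono H; rewrite ?ge_min ?lexx ?orbT// leq_addl.
move=> [p [t [/andP[p0 pe] H]]]; exists p, t; split.
  by rewrite p0 (lt_le_trans pe)// ge_min lexx.
by apply: two_arcs_mono H; rewrite ?ge_min ?lexx// leq_addr.
Qed.

End Scales.

(** * Transitive arcs *)

Section Retraction.
Context (R : realType) (T : metricType R).
Implicit Types c : R -> T.

(** The inverse of the chart on [c [0, d]], collapsing everything else to 0. The default value
    agrees with the parameter of [c 0], so continuity can fail only at [c d]. *)
Definition retract c (d : R) (z : T) : R := xget 0 [set s | 0 <= s <= d /\ c s = z].

Lemma retract_id c d s : chart c -> d <= 1 -> 0 <= s <= d -> retract c d (c s) = s.
Proof.
move=> hc d1 /andP[s0 sd]; rewrite /retract; case: xgetP => [u -> [/andP[u0 ud] cu]|].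
  by apply: (chart_inj hc) => //; apply/andP; split=> //; [exact: le_trans d1|exact: le_trans d1].
by move=> /(_ s); case; split => //; rewrite s0.
Qed.

Lemma retract_gt0 c d z : 0 < retract c d z -> retract c d z <= d /\ c (retract c d z) = z.
Proof.
rewrite /retract; case: xgetP => [u -> [/andP[_ ud] cu]//|]; by rewrite ltxx.
Qed.

Lemma retract_ge0 c d z : 0 <= retract c d z.
Proof. by rewrite /retract; case: xgetP => [u _ [/andP[]]|]. Qed.

Lemma retract_continuous c d z : chart c -> d <= 1 -> z <> c d ->
  {for z, continuous (retract c d)}.
Proof.
move=> hc d1 zd; apply/cvgrPdist_lt => /= eta eta0.
have [r0|r0] := ltP 0 (retract c d z).
  have [rd cr] := retract_gt0 r0; set r := retract c d z in r0 rd cr *.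
  have {}rd : r < d.
    by rewrite lt_neqAle rd andbT; apply/eqP => re; apply: zd; rewrite -cr re.
  pose a := Num.max 0 (r - eta); pose b := Num.min d (r + eta).
  have a0 : 0 <= a by rewrite le_max lexx.
  have bd : b <= d by rewrite ge_min lexx.
  have arb : a < r < b by rewrite gt_max lt_min r0 rd; apply/andP; split; lra.
  have : nbhs z (ioo c a b).
    apply: open_nbhs_nbhs; split; first by case: hc => _ _; apply => //; exact: le_trans d1.
    by exists r.
  apply: filterS => _ [s /= /andP[as_ sb] <-].
  rewrite retract_id//; last by rewrite (le_trans a0 (ltW as_)) (le_trans (ltW sb)).
  move: as_ sb; rewrite gt_max lt_min => /andP[_ h1] /andP[_ h2].
  by rewrite ltr_norml; apply/andP; split; lra.
have {}r0 : retract c d z = 0 by apply/le_anti; rewrite r0 retract_ge0.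
rewrite r0.
have : nbhs z (~` icc c eta d).
  apply: open_nbhs_nbhs; split.
    by apply: closed_openC; exact: icc_closed (chart_cont hc).
  move=> [s /= /andP[es sd] cs].
  suff : s = 0 by move=> s0; move: es; rewrite s0 leNgt eta0.
  by rewrite -r0 -cs retract_id// sd andbT; apply: le_trans es; exact: ltW.
apply: filterS => w nw; rewrite sub0r normrN ger0_norm ?retract_ge0//.
rewrite ltNge; apply/negP => er; apply: nw.
have r_gt0 : 0 < retract c d w by apply: lt_le_trans er.
by have [? ?] := retract_gt0 r_gt0; exists (retract c d w) => //=; rewrite er.
Qed.

(** If [c d] is missed, [phi] is continuous, positive at [e1] and negative at [e2]. Its zero is a
    positive parameter, where the retraction inverts the chart, hence a fixed point. *)
Lemma crossing_upper c (g : T -> T) (e1 q e2 d : R) : chart c -> continuous g ->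
  0 < e1 -> e1 < q < e2 -> q < d <= 1 -> g (c e1) = c q -> g (c e2) = c q ->
  (forall u, e1 <= u <= e2 -> g (c u) <> c u) -> (g @` icc c e1 e2) (c d).
Proof.
move=> hc cg e10 /andP[e1q qe2] /andP[qd d1] g1 g2 nofix.
apply: contrapT => nS.
pose phi u := retract c d (g (c u)) - u.
have phic : {within `[e1, e2], continuous phi}.
  apply: continuous_in_subspaceT => u; rewrite inE /= in_itv /= => uE.
  apply: cvgB; last exact: cvg_id.
  apply: (@continuous_comp _ _ _ (g \o c) (retract c d)).
    by apply: continuous_comp; [exact: (chart_cont hc)|exact: cg].
  apply: retract_continuous => //= E; apply: nS; exists (c u) => //.
  by exists u.
have q0 : 0 <= q by rewrite ltW// (lt_trans e10).
have rq : retract c d (c q) = q by rewrite retract_id// q0 ltW.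
have [||u] := @IVT R phi e1 e2 0 _ phic; first by rewrite ltW// (lt_trans e1q).
  by rewrite /phi g1 g2 rq ge_min le_max; apply/andP; split; apply/orP; [right|left]; lra.
rewrite in_itv /= => uE /eqP; rewrite subr_eq0 => /eqP ru.
have /andP[e1u _] := uE.
have : 0 < retract c d (g (c u)) by rewrite ru (lt_le_trans e10).
by move=> /retract_gt0[_]; rewrite ru => /esym /(nofix u uE).
Qed.

(* Without the full arc in the image, the retraction of the chart onto [c [0, d]]
   turns the map into a one-dimensional one, which has a fixed point. *)
Lemma crossing c (g : T -> T) (e1 q e2 : R) : chart c -> continuous g ->
  0 < e1 -> e1 < q < e2 -> e2 < 1 -> g (c e1) = c q -> g (c e2) = c q ->
  (forall u, e1 <= u <= e2 -> g (c u) <> c u) ->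
  ioo c 0 1 `<=` g @` icc c e1 e2.
Proof.
move=> hc cg e10 /andP[e1q qe2] e21 g1 g2 nofix _ [d /= /andP[d0 d1] <-].
have [qd|dq|<-] := ltgtP q d; last first.
- by exists (c e1) => //; exists e1 => //=; rewrite lexx ltW// (lt_trans e1q).
(* Points below [q] lie above it in the reversed chart. *)
- pose c' s := c (1 + s * -1).
  have cE u : c' (1 - u) = c u by rewrite /c'; congr c; lra.
  have hc' : chart c'.
    by apply: chart_affine; rewrite ?ler01 ?lexx ?addrN ?lexx ?ler01// oppr_eq0 oner_eq0.
  have [||||||z [u /= uE uz] zd] := @crossing_upper c' g (1 - e2) (1 - q) (1 - e1) (1 - d) hc' cg.
  + by lra.
  + by apply/andP; split; lra.
  + by apply/andP; split; lra.
  + by rewrite !cE.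
  + by rewrite !cE.
  + move=> u /andP[ua ub] E; apply: (nofix (1 - u)); first by apply/andP; split; lra.
    by move: E; rewrite /c' -[1 + u * -1]/(1 + u * -1) mulrN1.
  + exists z; last by rewrite zd cE.
    exists (1 - u); first by move/andP: uE => [? ?]; apply/andP; split; lra.
    by rewrite -uz /c'; congr c; lra.
- by apply: (@crossing_upper _ _ _ q); rewrite ?e1q ?qe2 ?qd ?ltW.
Qed.

End Retraction.

(** * Horseshoes from pairs of transitive arcs *)

Section TransitiveArcs.
Context (R : realType) (T : metricType R) (f : T -> T) (cf : continuous f)
  (nh : no_horseshoe f) (c : R -> T) (hc : chart c).

Definition transitive_over (delta : R) (Z : set T) := forall k0 s, 0 < s < delta ->
  exists2 k, (k0 <= k)%N & (iter k f @` Z) (c s).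

Lemma transitive_over_preimage delta Z t E : Z `<=` iter t f @` E ->
  transitive_over delta Z -> transitive_over delta E.
Proof.
move=> ZE Ztr k0 s sd; have [k k0k [z /ZE[w Ew wz] zs]] := Ztr k0 s sd.
exists (k + t)%N; first by rewrite (leq_trans k0k)// leq_addr.
by exists w => //; rewrite iterD wz.
Qed.

Context (delta : R) (delta01 : 0 < delta <= 1).
Context (pairs : forall e, 0 < e <= 1 -> exists Z t,
  two_arcs f c Z e 0 t /\ transitive_over delta Z).

Lemma icc_disjoint (u u' v v' : R) : 0 <= u -> u' < v -> v' <= 1 ->
  icc c u u' `&` icc c v v' = set0.
Proof.
move=> u0 uv v1; apply/seteqP; split => // _ [[a /= /andP[ua au] <-] [b /= /andP[vb bv]]].
move=> /(chart_inj hc); suff ab : a < b.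
  move=> H; have := ab; rewrite H ?ltxx//; apply/andP; split; lra.
by lra.
Qed.

Lemma arc_horseshoe (u u' v v' : R) a b : 0 <= u <= u' -> u' < v -> v <= v' <= 1 ->
  (0 < a)%N -> (0 < b)%N ->
  icc c u u' `|` icc c v v' `<=` iter a f @` icc c u u' ->
  icc c u u' `|` icc c v v' `<=` iter b f @` icc c v v' -> False.
Proof.
move=> /andP[u0 uu] uv /andP[vv v1]; apply: nh.
- exact: icc_closed (chart_cont hc).
- exact: icc_closed (chart_cont hc).
- by exists (c u); exists u => //=; rewrite lexx.
- by exists (c v); exists v => //=; rewrite lexx.
- exact: icc_disjoint.
Qed.

Lemma periodic_or_not : (exists s m, [/\ 0 < s < delta, (0 < m)%N & iter m f (c s) = c s])
  \/ (forall s m, 0 < s < delta -> (0 < m)%N -> iter m f (c s) <> c s).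
Proof.
have [|H] := pselect (exists s m, [/\ 0 < s < delta, (0 < m)%N & iter m f (c s) = c s]).
  by left.
by right => s m sd m0 E; apply: H; exists s, m.
Qed.

(** [q] is chosen between the two arcs. A point of [Z] sent to [c q] has a preimage in each of them,
    and in the absence of periodic points [crossing] applies. *)
Lemma aperiodic_expansion e :
  (forall s m, 0 < s < delta -> (0 < m)%N -> iter m f (c s) <> c s) ->
  0 < e <= delta -> exists e1 e2 k, [/\ 0 < e1, e1 < e2 < e, (0 < k)%N &
   ioo c 0 delta `<=` iter k f @` icc c e1 e2].
Proof.
move=> ap /andP[e0 ed]; have /andP[d0 d1] := delta01.
have [|Z [t [[u1 [u1' [u2 [u2' [/andP[u10 u11] /andP[u12 u22] u2e _ [Z1 Z2]]]]]] Ztr]]] := pairs (e := e).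
  by rewrite e0 (le_trans ed).
pose q := (u1' + u2) / 2.
have [|k k1 [z Zz zq]] := Ztr 1%N q; first by rewrite /q; apply/andP; split; lra.
have [_ [e1 /= /andP[ue1 eu1] <-] E1] := Z1 z Zz.
have [_ [e2 /= /andP[ue2 eu2] <-] E2] := Z2 z Zz.
exists e1, e2, (k + t)%N; split.
- lra.
- by apply/andP; split; lra.
- by rewrite addn_gt0 k1.
pose c' s := c (0 + s * delta).
have hc' : chart c'.
  by apply: chart_affine; rewrite ?add0r ?lexx ?ler01 ?(ltW d0) ?d1 ?gt_eqF.
have cE s : c' (s / delta) = c s by rewrite /c' add0r divfK// gt_eqF.
have K : ioo c' 0 1 `<=` iter (k + t) f @` icc c' (e1 / delta) (e2 / delta).
  apply: (@crossing _ _ c' (iter (k + t) f) (e1 / delta) (q / delta)) => //.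
  - exact: iter_continuous.
  - by rewrite divr_gt0//; lra.
  - by rewrite !ltr_pM2r ?invr_gt0// /q; apply/andP; split; lra.
  - by rewrite ltr_pdivrMr//; lra.
  - by rewrite !cE iterD E1 zq.
  - by rewrite !cE iterD E2 zq.
  - move=> u /andP[ua ub]; apply: ap; last by rewrite addn_gt0 k1.
    move: ua ub; rewrite ler_pdivrMr// ler_pdivlMr// => ua ub.
    by apply/andP; split; lra.
move=> _ [s /= /andP[s0 sd] <-].
have [|_ [u /= /andP[ua ub] <-] us] := K (c s).
  exists (s / delta); last exact: cE.
  by rewrite /= divr_gt0//= ltr_pdivrMr// mul1r.
exists (c (0 + u * delta)) => //; exists (0 + u * delta) => //=.
by move: ua ub; rewrite ler_pdivrMr// ler_pdivlMr// add0r => -> ->.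
Qed.

Lemma avoid_orbit s m : exists2 d, 0 < d <= delta &
  forall i, (i < m)%N -> ~ ioo c 0 d (iter i f (c s)).
Proof.
have /andP[d0 d1] := delta01.
elim: m => [|m [d /andP[d_gt0 dd] IH]]; first by exists delta => //; rewrite d0 lexx.
have [[v /= /andP[v0 vd] cv]|H] := pselect (ioo c 0 d (iter m f (c s))); last first.
  exists d; first by rewrite d_gt0.
  by move=> i; rewrite ltnS leq_eqVlt => /orP[/eqP ->//|]; exact: IH.
exists v; first by rewrite v0 (le_trans (ltW vd)).
move=> i; rewrite ltnS leq_eqVlt => /orP[/eqP ->|im].
  rewrite -cv => /(@ioo_mem _ _ c 0 v v hc (lexx _)).
  by rewrite ltxx andbF => H; suff : false by []; apply: H; lra.
move=> [w /= /andP[w0 wv] cw]; apply: (IH i im); exists w => //=.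
by rewrite w0 (lt_trans wv).
Qed.

(** Once the image of the arc meets the periodic orbit, all later images contain a point off
    [ioo c 0 d]. When a later image also contains [c q], [leave] applies. *)
Lemma periodic_cover s m d q u u' : 0 < s < delta -> (0 < m)%N ->
  iter m f (c s) = c s -> 0 < q < d -> d <= delta ->
  (forall i, ~ ioo c 0 d (iter i f (c s))) ->
  transitive_over delta (icc c u u') -> exists2 k, (0 < k)%N &
   icc c 0 q `<=` iter k f @` icc c u u' \/
   c @` [set v | q <= v < d] `<=` iter k f @` icc c u u'.
Proof.
move=> sd m0 per /andP[q0 qd] dd out tr; have /andP[d0 d1] := delta01.
have [k1 k11 [z Ez zs]] := tr 1%N s sd.
have [|k kk1 Sq] := tr k1 q; first by rewrite q0 (lt_le_trans qd).
exists k; first exact: leq_trans kk1.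
have So : (iter k f @` icc c u u') (iter (k - k1) f (c s)).
  by exists z => //; rewrite -zs -iterD subnK.
have cS := image_arc_connected cf hc (t := k) (u := u) (v := u').
have qd' : 0 < q < d by rewrite q0.
have [H|H] := leave hc cS (le_trans dd d1) qd' Sq So (out _).
- by left; apply: closed_origin => //; exact: image_arc_closed.
- by right => _ [w /= qw <-]; exact: H.
Qed.

(* A late iterate of a transitive arc meets a periodic orbit of the germ, if
   there is one, and then it covers one side of any prescribed point; otherwise
   [crossing] applies. *)
Lemma transitive_pairs_absurd : False.
Proof.
have /andP[d0 d1] := delta01.
have [[s [m [sd m0 per]]]|ap] := periodic_or_not; last first.
  have [|a1 [a2 [k [a10 /andP[a12 a2d] k0 Ha]]]] := aperiodic_expansion ap (e := delta).
    by rewrite d0 lexx.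
  have [|b1 [b2 [l [b10 /andP[b12 b2d] l0 Hb]]]] := aperiodic_expansion ap (e := a1).
    by rewrite a10; lra.
  have sub : icc c b1 b2 `|` icc c a1 a2 `<=` ioo c 0 delta.
    by move=> _ [|] [v /= /andP[va vb] <-]; exists v => //=; apply/andP; split; lra.
  apply: (@arc_horseshoe b1 b2 a1 a2 l k) => //; last 2 first.
  - exact: subset_trans Hb.
  - exact: subset_trans Ha.
  - by apply/andP; split; lra.
  - by apply/andP; split; lra.
have [d /andP[d_gt0 dd] out0] := avoid_orbit s m.
have out i : ~ ioo c 0 d (iter i f (c s)).
  have -> : iter i f (c s) = iter (i %% m) f (c s).
    rewrite {1}(divn_eq i m) addnC iterD.
    suff -> : iter (i %/ m * m) f (c s) = c s by [].
    by elim: (i %/ m)%N => [//|n IH]; rewrite mulSn addnC iterD per.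
  by apply: out0; rewrite ltn_mod.
have arcs e : 0 < e <= d -> exists u1 u1' u2 u2', [/\ 0 < u1 <= u1', u1' < u2 <= u2', u2' < e,
    transitive_over delta (icc c u1 u1') & transitive_over delta (icc c u2 u2')].
  move=> /andP[e0 ed]; have [|Z [t [[u1 [u1' [u2 [u2' [U1 U2 u2e _ [Z1 Z2]]]]]] Ztr]]] := pairs (e := e).
    by rewrite e0; lra.
  exists u1, u1', u2, u2'; split => //.
    exact: transitive_over_preimage Z1 Ztr.
  exact: transitive_over_preimage Z2 Ztr.
have [|v1 [v1' [v2 [v2' [/andP[v10 v11] /andP[v12 v22] v2d V1 V2]]]]] := arcs d.
  by rewrite d_gt0 lexx.
have [|u2 [u2' [u3 [u3' [/andP[u20 u22] /andP[u23 u33] u3v U2 U3]]]]] := arcs v1.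
  by rewrite v10; lra.
have cover a a' : transitive_over delta (icc c a a') -> exists2 k, (0 < k)%N &
   icc c 0 v1 `<=` iter k f @` icc c a a' \/
   c @` [set v | v1 <= v < d] `<=` iter k f @` icc c a a'.
  by apply: (@periodic_cover s m d v1) => //; apply/andP; split; lra.
have low a a' : 0 <= a -> a' <= v1 -> icc c a a' `<=` icc c 0 v1.
  by move=> aa av _ [w /= /andP[wa wb] <-]; exists w => //=; apply/andP; split; lra.
have upp a a' : v1 <= a -> a' < d -> icc c a a' `<=` c @` [set v | v1 <= v < d].
  by move=> aa av _ [w /= /andP[wa wb] <-]; exists w => //=; apply/andP; split; lra.
have lows (a a' b b' : R) k l : 0 < a <= a' -> a' < b -> b <= b' <= v1 ->
    (0 < k)%N -> (0 < l)%N -> icc c 0 v1 `<=` iter k f @` icc c a a' ->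
    icc c 0 v1 `<=` iter l f @` icc c b b' -> False.
  move=> /andP[a0 aa] ab /andP[bb bv] k0 l0 H1 H2.
  have sub : icc c a a' `|` icc c b b' `<=` icc c 0 v1.
    by move=> z [|]; apply: low; lra.
  apply: (@arc_horseshoe a a' b b' k l) => //; last 2 first.
  - exact: subset_trans H1.
  - exact: subset_trans H2.
  - by apply/andP; split; lra.
  - by apply/andP; split; lra.
(* If no arc above [v1] covered the lower part, both would cover the upper part and form a
   horseshoe. Hence the upper part leads to the lower one, every transitive arc eventually covers
   the lower part, and the two arcs below [v1] form a horseshoe. *)
have [l [l0 [w [w' [vw wd ww HV]]]]] : exists l, (0 < l)%N /\ exists w w',
    [/\ v1 <= w, w' < d, w <= w' & icc c 0 v1 `<=` iter l f @` icc c w w'].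
  have [l1 l10 [H1|H1]] := cover _ _ V1.
    by exists l1; split => //; exists v1, v1'; split => //; lra.
  have [l2 l20 [H2|H2]] := cover _ _ V2.
    by exists l2; split => //; exists v2, v2'; split => //; lra.
  have sub : icc c v1 v1' `|` icc c v2 v2' `<=` c @` [set v | v1 <= v < d].
    by move=> z [|]; apply: upp; lra.
  exfalso; apply: (@arc_horseshoe v1 v1' v2 v2' l1 l2) => //; last 2 first.
  - exact: subset_trans H1.
  - exact: subset_trans H2.
  - by apply/andP; split; lra.
  - by apply/andP; split; lra.
have via a a' k : c @` [set v | v1 <= v < d] `<=` iter k f @` icc c a a' ->
    icc c 0 v1 `<=` iter (l + k) f @` icc c a a'.
  move=> H z /HV[z1 /(upp _ _ vw wd)/H[z2 Ez <-] <-].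
  by exists z2 => //; rewrite iterD.
have any a a' : transitive_over delta (icc c a a') -> exists2 k, (0 < k)%N &
   icc c 0 v1 `<=` iter k f @` icc c a a'.
  move=> /cover[k k0 [H|/via H]]; first by exists k.
  by exists (l + k)%N => //; rewrite addn_gt0 l0.
have [k2 k20 H2] := any _ _ U2; have [k3 k30 H3] := any _ _ U3.
by apply: (lows u2 u2' u3 u3' k2 k3) => //; apply/andP; split; lra.
Qed.

End TransitiveArcs.

(** * Outer coverings *)

Section Outer.
Context (R : realType) (T : metricType R) (f : T -> T) (cf : continuous f)
  (cT : compact [set: T]) (N : nat) (h : 'I_N -> R -> T) (g : 'I_N -> T -> R)
  (hg : graph_atlas h g) (nh : no_horseshoe f)
  (c : R -> T) (hc : chart c) (y : T) (cy : ~ icc c 0 1 y) (loc : localized f c y).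

Lemma germ_excursion e V : 0 < e <= 1 -> nbhs y V -> exists u u' t t',
  [/\ 0 < u < e, 0 < u' < e, (t < t')%N,
      ioo c 0 e (iter t f (c u)) /\ ioo c 0 e (iter t' f (c u)) &
      V (iter t f (c u')) /\ ioo c 0 e (iter t' f (c u'))].
Proof.
move=> e01 Vy; have [t [_ tinc tw]] := loc 2 e01 Vy.
have [u ue uw] := tw xpredT; have [u' ue' uw'] := tw (fun j => j == 1%N).
exists u, u', (t 0%N), (t 1%N); split => //; first exact: tinc.
- by split; [exact: uw 0%N _|exact: uw 1%N _].
- by split; [exact: uw' 0%N _|exact: uw' 1%N _].
Qed.

(** One point is in the germ at both times, the other near [y] at the first and in the germ at the
    second. The return at the second time is what keeps both orbits in [D l] up to the visit to
    [y]. *)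
Lemma germ_shadowing (D : nat -> set T) : (forall l, D l.+1 `<=` D l) ->
  finite_set (\bigcap_l closure (D l)) ->
  (forall l, exists2 e, 0 < e <= 1 & forall u t k, 0 < u < e ->
     ioo c 0 e (iter t f (c u)) -> (k <= t)%N -> D l (iter k f (c u))) -> False.
Proof.
move=> Ddec Dfin HD; apply: (@shadowing R T f D (c 0) y) => //.
  by move=> c0y; apply: cy; exists 0 => //=; rewrite lexx ler01.
move=> l U V Ux Vy; have [e /andP[e0 e1] De] := HD l.
have /(chart_cont hc) /nbhs_ballP[r /= r0 rU] := Ux.
pose e' := Num.min e r.
have e'0 : 0 < e' by rewrite lt_min e0.
have ioo_mono : ioo c 0 e' `<=` ioo c 0 e.
  by move=> z [s /= /andP[s0]]; rewrite lt_min => /andP[se _] <-; exists s => //=; rewrite s0.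
have ioU : ioo c 0 e' `<=` U.
  move=> z [s /= /andP[s0]]; rewrite lt_min => /andP[_ sr] <-; apply: rU.
  by rewrite /ball /= sub0r normrN gtr0_norm.
have [|u [u' [t [t' [ue ue' tt [w1 w2] [v1 v2]]]]]] := @germ_excursion e' V _ Vy.
  by rewrite e'0 ge_min e1.
have lt_e v : 0 < v < e' -> 0 < v < e by rewrite lt_min => /and3P[-> ->].
exists (c u), (c u'), t; split => //.
- by split; apply: ioU; [exists u|exists u'].
- by move=> k kt; apply: (De _ t') (lt_e _ ue) (ioo_mono _ w2) _; lia.
- by move=> k kt; apply: (De _ t') (lt_e _ ue') (ioo_mono _ v2) _; lia.
- exact: ioU.
Qed.

Context (outer : forall e k, 0 < e <= 1 -> covers_outer f c e k).

Let M d := icc c d (1 / 2).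
Let H d k0 := \bigcup_(n in [set n | (k0 <= n)%N]) iter n f @` M d.

Lemma outer_arc e k : 0 < e <= 1 / 2 ->
  exists p u u' t, [/\ 0 < p < e, 0 < u <= u', u' < e, (k <= t)%N & c @` [set w | p <= w < 1] `<=` iter t f @` icc c u u'].
Proof.
move=> /andP[e0 e1]; have [|p [t [pe [u1 [u1' [u2 [u2' [/andP[u10 u11] /andP[u12 u22] u2e kt [H1 _]]]]]]]]] :=
  @outer e k _; first by rewrite e0; lra.
by exists p, u1, u1', t; rewrite pe u10 u11; split => //; lra.
Qed.

(** An arc of the germ below [1 / 2] is mapped over [c (1 / 2)]. For [d] at most its left end, [M d]
    contains this arc and so meets its image at the same time [t], whatever [d] and [k] are. *)
Lemma outer_Nconn : exists d0 t, [/\ 0 < d0 < 1 / 2, (0 < t)%N &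
  forall d k, 0 < d <= d0 -> Nconn t (H d k)].
Proof.
have [|p [u [u' [t [/andP[p0 pe] /andP[u0 uu] ue t1 Ht]]]]] := @outer_arc (1 / 2) 1%N.
  by apply/andP; split; lra.
exists u, t; split => //; first by apply/andP; split; lra.
move=> d k /andP[d0 du]; apply: orbit_Nconn => //.
  exact: icc_connected (chart_cont hc).
exists (c (1 / 2)); split; last by exists (1 / 2) => //=; apply/andP; split; lra.
have [|z [w /= /andP[uw wu] <-] zE] := Ht (c (1 / 2)).
  by exists (1 / 2) => //=; apply/andP; split; lra.
by exists (c w) => //; exists w => //=; apply/andP; split; lra.
Qed.

Lemma outer_forward d k0 n z : H d k0 z -> H d k0 (iter n f z).
Proof.
move=> [m /= km [w Mw <-]]; exists (n + m)%N; first by rewrite /= (leq_trans km)// leq_addl.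
by exists w => //; rewrite iterD.
Qed.

(* Otherwise the orbits returning to a short germ avoid a late term of the
   increasing family [H], which is excluded by [germ_shadowing]. *)
Lemma outer_accumulation d0 t : 0 < d0 < 1 / 2 ->
  (forall d k, 0 < d <= d0 -> Nconn t (H d k)) ->
  exists2 d, 0 < d <= d0 & forall e, 0 < e -> exists2 s, 0 < s < e & H d 0 (c s).
Proof.
move=> /andP[d00 d01] HN; apply: contrapT => Hn.
pose d l := d0 / l.+1%:R.
have dP l : 0 < d l <= d0.
  by rewrite /d divr_gt0 ?ltr0n//= ler_pdivrMr ?ltr0n// ler_peMr ?(ltW d00)// ler1n.
pose E l := H (d l) 0.
have Einc l : E l `<=` E l.+1.
  move=> z [n _ [w [s /= /andP[ds s1] <-] <-]]; exists n => //; exists (c s) => //.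
  exists s => //=; rewrite s1 andbT; apply: le_trans ds.
  by rewrite /d ler_pM2l// lef_pV2 ?posrE// ler_nat.
apply: (@germ_shadowing (fun l => \bigcup_k E k `\` E l)).
- by move=> l z [Ez nE]; split => //= /Einc.
- by apply: (finite_limit_inc (N := t) hg) => // l; exact: HN.
move=> l.
have /existsNP[e /not_implyP[e0 ne]] : ~ forall e, 0 < e -> exists2 s, 0 < s < e & E l (c s).
  by move=> Hl; apply: Hn; exists (d l).
pose e' := Num.min e (1 / 2).
have e'0 : 0 < e' by rewrite lt_min e0; lra.
have e'1 : e' <= 1 / 2 by rewrite ge_min lexx orbT.
have e'e : e' <= e by rewrite ge_min lexx.
exists e'; first by rewrite e'0; lra.
move=> u s k /andP[u0 ue] [v /= /andP[v0 ve] cv] ks; split.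
  pose L := Num.truncn (d0 / u).
  exists L => //; apply: outer_forward; exists 0%N => //; exists (c u) => //.
  exists u => //=; apply/andP; split; last lra.
  rewrite /d ler_pdivrMr// mulrC -ler_pdivrMr// ltW//.
  exact: truncnS_gt.
move=> Ek; apply: ne; exists v; first by rewrite v0; lra.
by rewrite /E cv -(subnK ks) iterD; exact: outer_forward.
Qed.

(** The orbit of [M d] sweeps an initial segment at arbitrarily late times, and an outer arc inside
    that segment spreads the sweep over the open chart. So [M d] is transitive, and outer coverings
    provide pairs of arcs over it. *)
Lemma outer_absurd : False.
Proof.
have [d0 [t [d0P t0 HN]]] := outer_Nconn.
have [d dd acc0] := outer_accumulation d0P HN.
have /andP[d_gt0 dd0] := dd; have /andP[_ d01] := d0P.
have Mouter p : p <= d -> M d `<=` c @` [set w | p <= w < 1].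
  by move=> pd _ [w /= /andP[wd w1] <-]; exists w => //=; apply/andP; split; lra.
(* If only time [k] accumulated at the origin, its image of [M d] would contain an initial segment.
   Inside it some arc is mapped over [M d] at a time beyond [k], and [k] more steps reach the
   segment again, now late. *)
have acc k0 : forall e, 0 < e -> exists2 s, 0 < s < e & H d k0 (c s).
  elim: k0 => [//|k IH]; apply: contrapT => /existsNP[e0 /not_implyP[e00 ne]].
  have [e /andP[eps0 _] He] : exists2 e, 0 < e <= 1 &
      forall s, 0 < s < e -> (iter k f @` M d) (c s).
    apply: initial_arc => //.
      exact: (image_arc_connected cf hc).
    move=> e e_gt0; have [|s /andP[s0 se] [n /= kn Hs]] := IH (Num.min e e0).
      by rewrite lt_min e_gt0.
    exists s; first by rewrite s0 (lt_le_trans se)// ge_min lexx.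
    move: kn; rewrite leq_eqVlt => /orP[/eqP -> //|kn]; exfalso; apply: ne.
    exists s; first by rewrite s0 (lt_le_trans se)// ge_min lexx orbT.
    by exists n.
  pose e1 := Num.min e d.
  have e1e : e1 <= e by rewrite ge_min lexx.
  have e1d : e1 <= d by rewrite ge_min lexx orbT.
  have e10 : 0 < e1 by rewrite lt_min eps0.
  have [|p [u [u' [t1 [/andP[p0 pe] /andP[u0 uu] ue kt Ht]]]]] := @outer_arc e1 k.+1.
    by rewrite e10; lra.
  apply: ne; exists (Num.min e e0 / 2); first last.
    have [|w Mw ws] := He (Num.min e e0 / 2).
      rewrite divr_gt0 ?lt_min ?eps0//=.
      by apply: (@le_lt_trans _ _ (e / 2)); [rewrite ler_pM2r// ge_min lexx|lra].
    have [|z [v /= /andP[uv vu] <-] zw] := Ht w; first by apply: (Mouter p) => //; lra.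
    have [|r Mr rv] := He v; first by apply/andP; split; lra.
    exists (k + (t1 + k))%N; first by apply: (leq_trans kt); rewrite addnCA leq_addr.
    by exists r => //; rewrite !iterD rv zw.
  have m0 : 0 < Num.min e e0 by rewrite lt_min eps0.
  have m1 : Num.min e e0 <= e0 by rewrite ge_min lexx orbT.
  by apply/andP; split; lra.
have tr : transitive_over f c 1 (M d).
  move=> k0 s /andP[s0 s1].
  have [delta /andP[delta0 delta1] Hd] : exists2 e, 0 < e <= 1 &
      forall s, 0 < s < e -> forall l : nat, H d k0 (c s).
    apply: (germ_of_accumulation (N := t) (E := fun _ => H d k0)) => //.
    - by move=> _; exact: HN.
    - by move=> l z.
    - by move=> e e0; have [s' s'e Hs] := acc k0 e e0; exists s'.
  pose e1 := Num.min (Num.min delta s) (1 / 2).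
  have e10 : 0 < e1 by rewrite !lt_min delta0 s0; lra.
  have [|p [u [u' [t1 [/andP[p0 pe] /andP[u0 uu] ue kt Ht]]]]] := @outer_arc e1 0%N.
    by rewrite e10 ge_min lexx orbT.
  move: (ue) (pe); rewrite !lt_min => /andP[/andP[ud us] _] /andP[/andP[pd ps] _].
  have [|z [v /= /andP[uv vu] <-] vs] := Ht (c s).
    by exists s => //=; rewrite s1 ltW.
  have [|n /= kn [r Mr rv]] := Hd v _ 0%N; first by apply/andP; split; lra.
  exists (t1 + n)%N; first by rewrite (leq_trans kn)// leq_addl.
  by exists r => //; rewrite iterD rv.
apply: (@transitive_pairs_absurd R T f cf nh c hc 1); first by rewrite ltr01 lexx.
move=> e /andP[e0 e1].
have e2 : 0 < Num.min e d <= 1.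
  by rewrite lt_min e0 d_gt0 ge_min e1.
have [p [t1 [/andP[p0 pe] [u1 [u1' [u2 [u2' [U1 U2 u2e _ [Z1 Z2]]]]]]]]] := outer 0%N e2.
exists (M d), t1; split => //.
exists u1, u1', u2, u2'; split => //.
  by move: u2e; rewrite lt_min => /andP[].
have pd : p <= d by move: pe; rewrite lt_min => /andP[_ /ltW].
by split; apply: subset_trans (Mouter p pd) _.
Qed.

End Outer.

(** * Inner coverings *)

Section CyclicComponents.
Context (T : topologicalType) (f : T -> T) (cf : continuous f) (K : set T)
  (Kf : forall z, K z -> K (f z)) (x : T) (Kx : K x).

Definition orbit_component n := connected_component K (iter n f x).
Local Notation comp := orbit_component.

Definition component_period d := [/\ (0 < d)%N, comp 0 (iter d f x) &
  forall k, (0 < k < d)%N -> ~ comp 0 (iter k f x)].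

Lemma invariant_iter n z : K z -> K (iter n f z).
Proof. by move=> Kz; elim: n => //= n; exact: Kf. Qed.

Lemma orbit_component_refl n : comp n (iter n f x).
Proof. exact/connected_component_refl/invariant_iter. Qed.

Lemma orbit_component_connected n : connected (comp n).
Proof. exact: component_connected. Qed.

Lemma orbit_component_max n A z : connected A -> A `<=` K -> A z -> comp n z ->
  A `<=` comp n.
Proof.
move=> cA AK Az cz w Aw; apply: connected_component_trans cz _.
by apply: (connected_component_max Az).
Qed.

Lemma orbit_component_image m n : iter m f @` comp n `<=` comp (m + n).
Proof.
apply: (@orbit_component_max _ _ (iter (m + n) f x)).
- apply: connected_continuous_connected; first exact: orbit_component_connected.
  exact/continuous_subspaceT/iter_continuous.
- move=> _ [z /connected_component_sub Kz <-]; exact: invariant_iter.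
- exists (iter n f x); first exact: orbit_component_refl.
  by rewrite iterD.
- exact: orbit_component_refl.
Qed.

Lemma orbit_component_shift m i j : comp i (iter j f x) -> comp (m + i) = comp (m + j).
Proof.
move=> cij; apply: same_connected_component; apply: (@orbit_component_image m i).
by exists (iter j f x) => //; rewrite iterD.
Qed.

Lemma component_period_exists t : (0 < t)%N -> comp 0 (iter t f x) ->
  exists2 d, (d <= t)%N & component_period d.
Proof.
move=> t0 ct; pose P n := (0 < n)%N && `[< comp 0 (iter n f x) >].
have exP : exists n, P n by exists t; rewrite /P t0; apply/asboolP.
case: (ex_minnP exP) => d /andP[d0 /asboolP cd] dmin.
exists d; first by apply: dmin; rewrite /P t0; apply/asboolP.
split => // k /andP[k0 kd] ck; have := dmin k.
by rewrite /P k0 leqNgt kd; move=> /(_ (asboolT ck)).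
Qed.

Context (d : nat) (dper : component_period d).

Lemma orbit_component_mod n : comp (n %% d) = comp n.
Proof.
have [_ cd _] := dper.
rewrite {2}(divn_eq n d) addnC; elim: (n %/ d)%N => [|q IH]; first by rewrite mul0n addn0.
have := orbit_component_shift (n %% d + q * d) cd; rewrite addn0 -IH => ->.
by rewrite mulSn addnA addnAC.
Qed.

Lemma orbit_component_eq i j : comp i (iter j f x) <-> (i = j %[mod d])%N.
Proof.
have [d0 cd dmin] := dper; split; last first.
  move=> ij; rewrite -orbit_component_mod ij orbit_component_mod.
  exact: orbit_component_refl.
have dvd n : comp 0 (iter n f x) -> (d %| n)%N.
  move=> cn; apply: contrapT => nd; apply: (dmin (n %% d)%N).
    by rewrite ltn_mod d0 andbT lt0n; exact/negP.
  rewrite (orbit_component_shift 0 cn) add0n -orbit_component_mod.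
  exact: orbit_component_refl.
(* [m + i] is a multiple of [d], so shifting by [m] reduces to the component of index 0. *)
move=> cij; pose m := (i * d.-1)%N.
have mi : (m + i = i * d)%N by rewrite /m addnC -mulnS prednK.
have : comp (m + i) (iter (m + j) f x).
  by rewrite (orbit_component_shift m cij); exact: orbit_component_refl.
rewrite mi -(orbit_component_mod (i * d)) modnMl => /dvd dj.
apply/eqP; rewrite -(eqn_modDl m) mi modnMl eq_sym; exact: dj.
Qed.

Lemma orbit_component_meet i j z : comp i z -> comp j z -> (i = j %[mod d])%N.
Proof.
move=> ci cj; apply/orbit_component_eq.
by apply: connected_component_trans ci _; exact: connected_component_sym.
Qed.

End CyclicComponents.

(** * Inner coverings with boundedly many components *)

Section InnerBounded.
Context (R : realType) (T : metricType R) (f : T -> T) (cf : continuous f)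
  (cT : compact [set: T]) (N : nat) (h : 'I_N -> R -> T) (g : 'I_N -> T -> R)
  (hg : graph_atlas h g) (nh : no_horseshoe f)
  (c : R -> T) (hc : chart c) (y : T) (cy : ~ icc c 0 1 y) (loc : localized f c y).
Context (inner : forall e k, 0 < e <= 1 -> covers_inner f c e k).

Definition germ_orbit e := \bigcup_n iter n f @` icc c 0 e.

Lemma germ_orbit_forward e n z : germ_orbit e z -> germ_orbit e (iter n f z).
Proof.
move=> [m _ [w Aw <-]]; exists (n + m)%N => //; exists w => //.
by rewrite iterD.
Qed.

Lemma germ_orbit_mono e e' : e <= e' -> germ_orbit e `<=` germ_orbit e'.
Proof.
move=> ee z [n _ [w [s /= /andP[s0 se] <-] <-]]; exists n => //.
by exists (c s) => //; exists s => //=; rewrite s0 (le_trans se).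
Qed.

Lemma germ_orbit_germ e s : 0 <= s <= e -> germ_orbit e (c s).
Proof. by move=> se; exists 0%N => //; exists (c s) => //; exists s. Qed.

Lemma inner_arc e k : 0 < e <= 1 -> exists p t, [/\ 0 < p < e, (k <= t)%N &
  icc c 0 p `<=` iter t f @` icc c 0 e].
Proof.
move=> /(@inner _ k)[p [t [pe [u1 [u1' [u2 [u2' [/andP[u10 u11] /andP[u12 u22] u2e kt [H1 _]]]]]]]]].
exists p, t; split => //; apply: subset_trans H1 _.
by apply: image_subset => _ [w /= /andP[w0 w1] <-]; exists w => //=; apply/andP; split; lra.
Qed.

Lemma germ_orbit_return e k : 0 < e <= 1 -> exists2 t, (k <= t)%N &
  orbit_component f (germ_orbit e) (c 0) t (c 0) /\ (iter t f @` icc c 0 e) (c 0).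
Proof.
move=> e01; have [p [t [/andP[p0 pe] kt H]]] := inner_arc k e01.
have c0 : (iter t f @` icc c 0 e) (c 0).
  by apply: H; exists 0 => //=; rewrite lexx ltW.
have /andP[e0 _] := e01.
exists t => //; split => //.
apply: (@orbit_component_max _ f _ _ t (iter t f @` icc c 0 e) (iter t f (c 0))) => //.
- exact: image_arc_connected.
- by move=> z [w Aw <-]; exists t => //; exists w.
- by exists (c 0) => //; exists 0 => //=; rewrite lexx ltW.
- apply: orbit_component_refl; last by apply: germ_orbit_germ; rewrite lexx ltW.
  by move=> z; exact: (@germ_orbit_forward _ 1).
Qed.

Lemma germ_orbit_period e : 0 < e <= 1 ->
  exists d, component_period f (germ_orbit e) (c 0) d.
Proof.
move=> e01; have [t t1 [ct _]] := germ_orbit_return 1 e01.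
have [d _ dP] : exists2 d, (d <= t)%N & component_period f (germ_orbit e) (c 0) d.
  apply: component_period_exists => //.
  by apply: connected_component_sym.
by exists d.
Qed.

Lemma germ_orbit_components e d : 0 < e <= 1 ->
  component_period f (germ_orbit e) (c 0) d ->
  germ_orbit e = \bigcup_(i in `I_d) orbit_component f (germ_orbit e) (c 0) i.
Proof.
move=> /andP[e0 _] dP; have [d0 _ _] := dP.
have fwd z : germ_orbit e z -> germ_orbit e (f z) by exact: (@germ_orbit_forward _ 1).
have x0 : germ_orbit e (c 0) by apply: germ_orbit_germ; rewrite lexx ltW.
apply/seteqP; split; last by move=> z [i _ /connected_component_sub].
move=> z [n _ zn]; exists (n %% d)%N; first by rewrite /= ltn_mod.
rewrite orbit_component_mod//.
apply: (@orbit_component_max _ f _ _ n (iter n f @` icc c 0 e) (iter n f (c 0))) zn => //.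
- exact: image_arc_connected.
- by move=> w ?; exists n.
- by exists (c 0) => //; exists 0 => //=; rewrite lexx ltW.
- exact: orbit_component_refl.
Qed.

(** With at most [M] components at all scales, shadowing forces the intersection of the germ orbits
    to accumulate at [c 0], hence to contain an initial segment. As late images of [c [0, p]]
    contain smaller germs, that arc is transitive over the segment. *)
Lemma bounded_periods_absurd M : (forall e d, 0 < e <= 1 ->
  component_period f (germ_orbit e) (c 0) d -> (d <= M)%N) -> False.
Proof.
move=> HM.
have YN e : 0 < e <= 1 -> Nconn M (germ_orbit e).
  move=> e01; have [d dP] := germ_orbit_period e01.
  have dM := HM e d e01 dP.
  exists (fun i => if (i < d)%N then orbit_component f (germ_orbit e) (c 0) i else set0).
  split; first by move=> i _; case: ifP => _; [exact: component_connected|exact: connected0].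
  rewrite {1}(germ_orbit_components e01 dP); apply/seteqP; split => z.
    by move=> [i /= id Ci]; exists i => /=; [exact: leq_trans dM|rewrite id].
  by move=> [i /= _]; case: ifP => // id Ci; exists i.
pose eps (l : nat) : R := l.+1%:R^-1.
have eps01 l : 0 < eps l <= 1.
  by rewrite invr_gt0 ltr0n/= invf_le1 ?ltr0n// ler1n.
pose E l := germ_orbit (eps l).
have Edec l : E l.+1 `<=` E l.
  by apply: germ_orbit_mono; rewrite lef_pV2 ?posrE ?ltr0n// ler_nat.
have acc e : 0 < e -> exists2 s, 0 < s < e & forall l, E l (c s).
  move=> e0; apply: contrapT => ne.
  apply: (@germ_shadowing R T f cf cT c hc y cy loc (fun l => E l `\` \bigcap_k E k)).
  - by move=> l z [/Edec].
  - by apply: (finite_limit_dec (N := M) hg) => // l; exact: YN.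
  move=> l; have /andP[l0 l1] := eps01 l.
  exists (Num.min e (eps l)); first by rewrite lt_min e0 l0 ge_min l1 orbT.
  move=> u t k /andP[u0]; rewrite lt_min => /andP[ue ul] [v /= /andP[v0]].
  rewrite lt_min => /andP[ve vl] cv kt; split.
    by apply: germ_orbit_forward; apply: germ_orbit_germ; rewrite !ltW.
  move=> Ek; apply: ne; exists v; first by rewrite v0.
  move=> j; rewrite cv -(subnK kt) iterD; apply: germ_orbit_forward.
  exact: Ek.
have [delta delta01 Hd] := germ_of_accumulation (N := M) hc (fun l => YN _ (eps01 l)) Edec acc.
apply: (@transitive_pairs_absurd R T f cf nh c hc delta delta01) => e e01.
have [p [t [/andP[p0 pe] arcs]]] := @inner e 0%N e01.
exists (icc c 0 p), t; split => //.
move=> k0 s sd.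
have p01 : 0 < p <= 1 by have /andP[_ e1] := e01; rewrite p0; lra.
have [q [t' [/andP[q0 qp] kt' H]]] := inner_arc k0 p01.
have [l lq] : exists l, eps l <= q.
  exists (Num.truncn q^-1); rewrite /eps invf_ple ?posrE ?ltr0n//.
  exact/ltW/truncnS_gt.
have [n _ [w Aw ws]] := germ_orbit_mono lq (Hd s sd l).
have [z Az zw] := H w Aw.
exists (n + t')%N; first by rewrite (leq_trans kt')// leq_addl.
by exists z => //; rewrite iterD zw.
Qed.

End InnerBounded.

Section ClosedInvariance.
Context (T : topologicalType) (f : T -> T) (cf : continuous f).

Lemma closure_image (A B : set T) n z : iter n f @` A `<=` B ->
  closure A z -> closure B (iter n f z).
Proof.
move=> AB Az U /(iter_continuous (m := n) cf) /Az[w [Aw Uw]].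
by exists (iter n f w); split => //; apply: AB; exists w.
Qed.

Lemma finite_invariant_periodic (Q : set T) z : finite_set Q -> Q z ->
  (forall w, Q w -> Q (f w)) ->
  exists a q, (0 < q)%N /\ iter q f (iter a f z) = iter a f z.
Proof.
move=> Qfin Qz Qf.
have Qi n : Q (iter n f z) by elim: n => //= n; exact: Qf.
apply: contrapT => Hn; apply: infinite_nat.
have ij : {in setT &, injective (fun n => iter n f z)}.
  move=> i j _ _; wlog ij : i j / (i <= j)%N.
    by move=> H; have /orP[] := leq_total i j => le E; [exact: H|exact/esym/H].
  move=> E; apply/eqP; rewrite eqn_leq ij leqNgt; apply/negP => lt; apply: Hn.
  by exists i, (j - i)%N; rewrite subn_gt0 lt -iterD subnK.
rewrite -(eq_finite_set (inj_card_eq ij)); apply: sub_finite_set Qfin.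
by move=> _ [n _ <-].
Qed.

End ClosedInvariance.

Section Counting.
Context (R : realType) (T : metricType R).

(* A point belongs to at most one of the sets, and every other set accumulating
   at it contains an initial segment of a germ. *)
Lemma disjoint_accumulation (J : finType) (c : J -> R -> T) ok b (C : nat -> set T) k :
  germs_at c ok b -> (forall i, connected (C i)) ->
  (forall i j, (i < k)%N -> (j < k)%N -> C i `&` C j !=set0 -> i = j) ->
  (forall i, closure (C i) b) -> (k <= #|J|.+1)%N.
Proof.
move=> gb Cc Cdis Cb; have [cok _] := gb.
have jP i : exists o : option J, if o is Some j then
    ok j /\ (exists2 d, 0 < d <= 1 & forall s, 0 < s < d -> C i (c j s)) else C i b.
  have [Cib|nCib] := pselect (C i b); first by exists None.
  have [j okj Hj] : exists2 j, ok j & forall e, 0 < e <= 1 -> exists s, 0 < s < e /\ C i (c j s).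
    apply: (germ_frequently (Q := fun _ => C i) gb) => // e U _ /(Cb i)[z [Cz Uz]].
    by exists z; split => // zb; apply: nCib; rewrite -zb.
  exists (Some j); split => //; have [hcj _] := cok j okj.
  apply: initial_arc => // e e0; have [|s [/andP[s0 se] Cs]] := Hj (Num.min e 1).
    by rewrite lt_min e0 ltr01 ge_min lexx orbT.
  by exists s => //; rewrite s0 (lt_le_trans se)// ge_min lexx.
have [lab labP] := choice jP.
have oinj : injective (fun i : 'I_k => lab i).
  move=> i i' oo; apply/val_inj/Cdis => //=.
  have := labP i; have := labP i'; rewrite oo; case: (lab i') => [j|]; last by exists b.
  move=> [_ [d /andP[d0 _] Cd]] [_ [d' /andP[d'0 _] Cd']].
  have m0 : 0 < Num.min d d' by rewrite lt_min d0.
  have m1 : Num.min d d' <= d by rewrite ge_min lexx.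
  have m2 : Num.min d d' <= d' by rewrite ge_min lexx orbT.
  exists (c j (Num.min d d' / 2)); split; [apply: Cd'|apply: Cd]; lra.
by have := leq_card _ oinj; rewrite card_option card_ord.
Qed.

End Counting.

(** * Inner coverings with unbounded periods *)

Section InnerUnbounded.
Context (R : realType) (T : metricType R) (f : T -> T) (cf : continuous f)
  (cT : compact [set: T]) (N : nat) (h : 'I_N -> R -> T) (g : 'I_N -> T -> R)
  (hg : graph_atlas h g)
  (c : R -> T) (hc : chart c).
Context (inner : forall e k, 0 < e <= 1 -> covers_inner f c e k).

Local Notation Y := (germ_orbit f c).
Local Notation comp e := (orbit_component f (Y e) (c 0)).
Local Notation period e := (component_period f (Y e) (c 0)).

(** Inner arcs of shrinking scales are composed. [C n] collects the points following the first [n]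
    scales, and a point common to all [C n] returns ever closer to [c 0] at ever later times. *)
Lemma inner_omega : omega_limit f (c 0).
Proof.
pose P e k (pt : R * nat) := [/\ 0 < pt.1 < e, (k <= pt.2)%N &
  icc c 0 pt.1 `<=` iter pt.2 f @` icc c 0 e].
have nextP e k : exists pt, 0 < e <= 1 -> P e k pt.
  have [e01|] := pselect (0 < e <= 1); last by exists (0, 0%N).
  by have [p [t ?]] := inner_arc inner k e01; exists (p, t).
pose next e k := projT1 (cid (nextP e k)).
have nextE e k : 0 < e <= 1 -> P e k (next e k) by exact: projT2 (cid (nextP e k)).
(* [st n] is the pair of the [n]-th scale and of the total time to reach it *)
pose st := fix st (n : nat) : R * nat := if n is n'.+1 then
  let pt := next (st n').1 n in (Num.min pt.1 n.+1%:R^-1, ((st n').2 + pt.2)%N)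
  else (1, 0%N).
have st01 n : 0 < (st n).1 <= 1.
  elim: n => [|n IH]; first by rewrite /= ltr01 lexx.
  have [/andP[p0 p1] _ _] := nextE _ n.+1 IH; have /andP[_ s1] := IH.
  rewrite [st _]/= lt_min p0 invr_gt0 ltr0n/= ge_min (le_trans (ltW p1))//.
have st_small n : (st n).1 <= n.+1%:R^-1.
  by case: n => [|n]; rewrite /= ?invr1 ?ge_min ?lexx ?orbT.
have st_late n : (n <= (st n).2)%N.
  case: n => [//|n]; have [_ kt _] := nextE _ n.+1 (st01 n).
  by rewrite [st _]/= (leq_trans kt)// leq_addl.
pose S n := icc c 0 (st n).1.
pose C n := [set z | forall i, (i <= n)%N -> S i (iter (st i).2 f z)].
have CS n : S n `<=` iter (st n).2 f @` C n.
  elim: n => [|n IH].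
    by move=> z Sz; exists z => // i; rewrite leqn0 => /eqP ->.
  have [_ _ H] := nextE _ n.+1 (st01 n).
  move=> z Sz; have [|w Sw wz] := H z.
    case: Sz => s /= /andP[s0]; rewrite le_min => /andP[sp _] sz.
    by exists s => //=; rewrite s0.
  have [u Cu uw] := IH w Sw.
  have E : iter (st n.+1).2 f u = z by rewrite [st _]/= addnC iterD uw.
  exists u => // i; rewrite leq_eqVlt => /orP[/eqP ->|]; last exact: Cu.
  by rewrite E.
have [|||z Cz] := @nested_nonempty _ C cT.
- move=> n; rewrite (_ : C n = \bigcap_(i in [set i | (i <= n)%N]) (iter (st i).2 f @^-1` S i)).
    apply: closed_bigI => i _; apply: closed_comp; first by move=> *; exact: iter_continuous.
    exact: icc_closed (chart_cont hc).
  by apply/seteqP; split.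
- move=> n; have /andP[n0 _] := st01 n.
  have [|z Cz _] := CS n (c 0); first by exists 0 => //=; rewrite lexx ltW.
  by exists z.
- by move=> n z Cz i le; apply: Cz; exact: leqW.
exists z => // n _ U /(chart_cont hc)/nbhs_ballP[r /= r0 rU].
pose i := (n + Num.truncn r^-1)%N.
have [s /= /andP[s0 si] cs] := Cz i I i (leqnn i).
exists (iter (st i).2 f z); split.
  by exists (st i).2 => //=; apply: leq_trans (st_late i); rewrite leq_addr.
rewrite -cs; apply: rU; rewrite /ball /= sub0r normrN ger0_norm//.
apply: le_lt_trans si _; apply: le_lt_trans (st_small i) _.
rewrite invf_plt ?posrE ?ltr0n//; apply: lt_le_trans (truncnS_gt _) _.
by rewrite ler_nat ltnS leq_addl.
Qed.

Lemma inner_forward e z : Y e z -> Y e (f z).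
Proof. exact: (@germ_orbit_forward _ _ f c e 1). Qed.

Lemma inner_origin e : 0 < e -> Y e (c 0).
Proof. by move=> e0; apply: germ_orbit_germ; rewrite lexx ltW. Qed.

Lemma germ_orbit_closure_forward e z : closure (Y e) z -> closure (Y e) (f z).
Proof.
apply: (@closure_image _ f cf (Y e) _ 1) => _ [w Yw <-]; exact: inner_forward.
Qed.

Lemma comp_mono e e' n : e <= e' -> comp e n `<=` comp e' n.
Proof.
move=> ee z [C [Cx CY Cc] Cz]; exists C => //; split => //.
exact: subset_trans (germ_orbit_mono ee).
Qed.

Lemma closure_germ_orbit e d : 0 < e <= 1 -> period e d ->
  closure (Y e) = \bigcup_(i in `I_d) closure (comp e i).
Proof.
move=> e01 dP; apply/seteqP; split; last first.
  by move=> z [i _]; apply: closureS; exact: connected_component_sub.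
have Ucl : closed (\bigcup_(i in `I_d) closure (comp e i)).
  by apply: closed_bigcup; [exact: finite_II|move=> i _; exact: closed_closure].
rewrite [X in _ `<=` X](iffLR (closure_id _) Ucl); apply: closureS.
rewrite {1}(germ_orbit_components cf hc e01 dP) => z [i id zi].
by exists i => //; apply: subset_closure.
Qed.

(** A neighbourhood of a meeting point contains points of both components. These are disjoint, so
    the first one, a single connected set, is both met and missed: [finite_of_alternation] applies
    with [N] equal to 1. *)
Lemma meeting_closures_finite e d : 0 < e <= 1 -> period e d ->
  finite_set [set z | exists i j, [/\ (i != j %[mod d])%N,
    closure (comp e i) z & closure (comp e j) z]].
Proof.
move=> /andP[e0 e1] dP; have [d0 _ _] := dP.
pose Q i j := [set z | (i != j %[mod d])%N /\ (closure (comp e i) z /\ closure (comp e j) z)].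
apply: (@sub_finite_set _ _ (\bigcup_(i in `I_d) \bigcup_(j in `I_d) Q i j)).
  move=> z [i [j [ij zi zj]]]; exists (i %% d)%N; first by rewrite /= ltn_mod.
  exists (j %% d)%N; first by rewrite /= ltn_mod.
  have x0 := inner_origin e0; have fwd := @inner_forward e.
  by split; rewrite ?modn_mod// !(orbit_component_mod cf fwd x0 dP).
apply: bigcup_finite => [|i _]; first exact: finite_II.
apply: bigcup_finite => [|j _]; first exact: finite_II.
have [ij|ij] := eqVneq (i %% d)%N (j %% d)%N.
  by rewrite (_ : Q i j = set0)//; apply/seteqP; split => z // [/eqP].
apply: (finite_of_alternation (N := 1) hg) => K O HO; exists (comp e i).
  exists (fun=> comp e i); split; first by move=> _ _; exact: component_connected.
  by apply/seteqP; split => z; [exists 0%N|case].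
move=> k /HO[Ok [z [Oz [_ [zi zj]]]]].
have Oz' : nbhs z (O k) by exact: open_nbhs_nbhs.
split; first by have [w [? ?]] := zi _ Oz'; exists w.
have [w [wj Ow]] := zj _ Oz'; exists w => // wi.
move: ij; rewrite (orbit_component_meet cf (@inner_forward e) (inner_origin e0) dP wi wj).
by rewrite eqxx.
Qed.

Context (unbounded : forall M, exists e d, [/\ 0 < e <= 1, period e d & (M < d)%N]).

(* The orbit components accumulating at a periodic point are permuted by its
   period, and [disjoint_accumulation] bounds their number. *)
Lemma periodic_escapes b q : (0 < q)%N -> iter q f b = b -> exists2 e, 0 < e <= 1 &
  ~ closure (Y e) b.
Proof.
move=> q0 qb; have [cb [ok gb]] := germs_exist b hg.
(* One more than [disjoint_accumulation] permits. A period beyond [M * q] makes the components of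
   index [i + k * q], for [k < M], distinct. *)
pose M := #|[the finType of ('I_N * bool)%type]|.+2.
have [e [d [e01 dP Md]]] := unbounded (M * q)%N.
have /andP[e0 _] := e01.
exists e => // ; rewrite (closure_germ_orbit e01 dP) => -[i _ bi].
have H k : closure (comp e (i + k * q)) b.
  have <- : iter (k * q) f b = b by elim: k => //= k IH; rewrite mulSn iterD IH.
  apply: closure_image bi => //; rewrite addnC.
  exact: (orbit_component_image cf (@inner_forward e) (inner_origin e0)).
have : (M <= M.-1)%N; last by rewrite ltnn.
apply: (disjoint_accumulation gb (C := fun k => comp e (i + k * q))) => //.
  by move=> k; exact: component_connected.
move=> k k' kM k'M [z [zk zk']].
have := orbit_component_meet cf (@inner_forward e) (inner_origin e0) dP zk zk'.
move=> /eqP; rewrite eqn_modDl !modn_small ?eqn_pmul2r// => [/eqP//||];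
  by apply: ltn_trans Md; rewrite ltn_pmul2r.
Qed.

(** The meeting points [Q] form a finite forward invariant set, so their orbits end in cycles, which
    [periodic_escapes] expels from the closures at smaller scales. A meeting point of different
    residues at the smaller scale would still belong to [Q]. *)
Lemma separated_scale e d : 0 < e <= 1 -> period e d -> exists e', [/\ 0 < e' <= e &
  forall z i j, closure (comp e' i) z -> closure (comp e' j) z -> (i = j %[mod d])%N].
Proof.
move=> e01 dP; have Qfin := meeting_closures_finite e01 dP.
set Q := [set z | _] in Qfin.
have Qf z : Q z -> Q (f z).
  have step i : closure (comp e i) z -> closure (comp e i.+1) (f z).
    apply: (@closure_image _ f cf _ _ 1).
    have /andP[e0 _] := e01.
    exact: (@orbit_component_image _ f cf _ (@inner_forward e) _ (inner_origin e0) 1).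
  move=> [i [j [ij zi zj]]]; exists i.+1, j.+1; split; [|exact: step|exact: step].
  by rewrite -addn1 -(addn1 j) eqn_modDr.
have [e1 e10 He1] : exists2 r, 0 < r & forall b, Q b -> ~ closure (Y (Num.min r e)) b.
  apply: (finite_radius (P := fun b r => ~ closure (Y (Num.min r e)) b) Qfin).
    move=> b r r' nb rr cb; apply: nb; apply: closureS cb.
    apply: germ_orbit_mono; rewrite le_min !ge_min lexx orbT andbT rr//.
  move=> b Qb; have [a [q [q0 per]]] := finite_invariant_periodic Qfin Qb Qf.
  have [r /andP[r0 r1] nr] := periodic_escapes q0 per.
  exists r => // cb; apply: nr.
  have : closure (Y (Num.min r e)) (iter a f b).
    by elim: (a) => //= n; exact: germ_orbit_closure_forward.
  by apply: closureS; apply: germ_orbit_mono; rewrite ge_min lexx.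
have /andP[e0 _] := e01.
exists (Num.min e1 e); split; first by rewrite lt_min e10 e0 ge_min lexx orbT.
have le : Num.min e1 e <= e by rewrite ge_min lexx orbT.
move=> z i j zi zj; apply/eqP; apply: contrapT => /negP ij; apply: (He1 z).
  exists i, j; split => //.
    by apply: closureS zi; exact: comp_mono.
  by apply: closureS zj; exact: comp_mono.
by apply: closureS zi; exact: connected_component_sub.
Qed.

End InnerUnbounded.

(** * Maximal invariant subsets and subcontinua *)

Section Core.
Context (R : realType) (T : metricType R) (cT : compact [set: T]).

(** By normality a separation of the intersection extends to disjoint open sets, and by compactness
    some whole [C l] lies in their union. *)
Lemma nested_connected (C : nat -> set T) : (forall l, closed (C l)) ->
  (forall l, connected (C l)) -> (forall l, C l.+1 `<=` C l) ->
  connected (\bigcap_l C l).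
Proof.
move=> Ccl Cc Cdec; apply: contrapT => /connectedPn[E [E0 CE [E1 E2]]].
have capcl : closed (\bigcap_l C l) by apply: closed_bigI => l _.
have sub b : closure (E b) `<=` \bigcap_l C l.
  rewrite [X in _ `<=` X](iffLR (closure_id _) capcl); apply: closureS.
  by rewrite CE; case: b => z; [right|left].
have Ecl b : closed (E b).
  rewrite closure_id; apply/seteqP; split; first exact: subset_closure.
  move=> z zb; have := sub b z zb; rewrite CE; case: b zb => zb [] // zE.
    by have : (E false `&` closure (E true)) z by []; rewrite E2.
  by have : (closure (E false) `&` E true) z by []; rewrite E1.
have EE : E false `&` E true = set0.
  apply/seteqP; split => // z [zf zt].
  by rewrite -E1; split => //; exact: subset_closure.
have /normal_openP nT : normal_space T.
  by apply: compact_normal => //; exact: metric_hausdorff.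
have [U [V [Uo Vo EU EV UV]]] := nT R _ _ (Ecl false) (Ecl true) EE.
have [||l Cl] := @closed_nonclosure_disjoint _ C (U `|` V) cT Cdec.
- exact: openU.
- have -> : \bigcap_l closure (C l) = \bigcap_l C l.
    by apply: eq_bigcapr => l _; rewrite -(iffLR (closure_id _) (Ccl l)).
  by rewrite CE => z [/EU|/EV]; [left|right].
have nU : forall A B : set T, open A -> open B -> A `&` B = set0 -> A `&` closure B = set0.
  move=> A B Ao _ AB; apply/seteqP; split => // z [Az Bz].
  have [w [Bw Aw]] := Bz A (open_nbhs_nbhs (conj Ao Az)).
  by have : (A `&` B) w by []; rewrite AB.
have sUV : separated U V.
  by split; [rewrite setIC; apply: nU => //; rewrite setIC|exact: nU].
have inC b z : E b z -> C l z.
  move=> Ez; have : (\bigcap_l C l) z by rewrite CE; case: b Ez; [right|left].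
  by apply.
have [CU|CV] := connected_subset sUV Cl (Cc l).
  have [z zt] := E0 true; have Uz := CU z (inC true z zt).
  have : (U `&` V) z by split => //; exact: EV.
  by rewrite UV.
have [z zf] := E0 false; have Vz := CV z (inC false z zf).
have : (U `&` V) z by split => //; exact: EU.
by rewrite UV.
Qed.

Context (phi : T -> T) (cphi : continuous phi) (A : set T) (Acl : closed A)
  (AA : phi @` A `<=` A).

Definition core := \bigcap_n iter n phi @` A.

Lemma core_decreasing n : iter n.+1 phi @` A `<=` iter n phi @` A.
Proof.
move=> _ [z Az <-]; exists (phi z); first by apply: AA; exists z.
by rewrite iterSr.
Qed.

Lemma core_closed_terms n : closed (iter n phi @` A).
Proof.
apply: compact_closed; first exact: metric_hausdorff.
apply: continuous_compact; first exact/continuous_subspaceT/iter_continuous.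
exact: (subclosed_compact Acl cT).
Qed.

Lemma core_closed : closed core.
Proof. by apply: closed_bigI => n _; exact: core_closed_terms. Qed.

Lemma core_sub : core `<=` A.
Proof. by move=> z /(_ 0%N I)[w Aw <-]. Qed.

Lemma core_connected : connected A -> connected core.
Proof.
move=> cA; apply: nested_connected => n.
- exact: core_closed_terms.
- apply: connected_continuous_connected => //.
  exact/continuous_subspaceT/iter_continuous.
- exact: core_decreasing.
Qed.

Lemma core_image : phi @` core = core.
Proof.
apply/seteqP; split => z.
  move=> [w wc <-] n _; have [u Au uw] := wc n I.
  by exists (phi u); [apply: AA; exists u|rewrite -iterSr /= uw].
move=> zc.
(* The preimages of [z] within the successive images are nested non-empty closed sets; a common
   point is a preimage in the core. *)
have [|||w wP] := @nested_nonempty _ (fun n => phi @^-1` [set z] `&` iter n phi @` A) cT.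
- move=> n; apply: closedI; last exact: core_closed_terms.
  apply: preimage_closed; first by move=> *; exact: cphi.
  by apply: accessible_closed_set1; apply: hausdorff_accessible; exact: metric_hausdorff.
- move=> n; have [u Au uz] := zc n.+1 I; exists (iter n phi u); split => //=.
  by exists u.
- by move=> n u [uz un]; split => //; exact: core_decreasing.
exists w; first by move=> n _; have [] := wP n I.
by have [] := wP 0%N I.
Qed.

End Core.

(** * Non-degenerate subcontinua of a graph are graphs *)

Section Subcontinuum.
Context (R : realType) (T : metricType R).

Lemma finite_closed (F : set T) : finite_set F -> closed F.
Proof.
apply: (iffLR accessible_finite_set_closed).
by apply: hausdorff_accessible; exact: metric_hausdorff.
Qed.

Lemma finite_connected (F : set T) x : finite_set F -> connected F -> F x -> F = [set x].
Proof.
move=> Ffin cF Fx; apply/esym/cF; first by exists x.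
  exists (~` (F `\` [set x])).
    by apply: closed_openC; apply: finite_closed; exact: finite_setD.
  apply/seteqP; split => z; first by move=> ->; split => // -[_]; exact.
  by move=> [Fz nz]; apply: contrapT => zx; exact: nz.
exists [set x]; first by apply: finite_closed.
by apply/seteqP; split => z; [move=> ->|case].
Qed.

Lemma initial_segment (c : R -> T) (J : set T) : continuous c -> closed J ->
  exists a, [/\ 0 <= a <= 1, (0 < a -> icc c 0 a `<=` J) &
    forall s, 0 < s <= 1 -> (forall u, 0 < u <= s -> J (c u)) -> s <= a].
Proof.
move=> cc Jcl.
(* Adding 0 keeps the supremum meaningful when no initial segment lies in [J]. *)
pose E := [set s : R | s = 0 \/ 0 < s <= 1 /\ forall u, 0 < u <= s -> J (c u)].
have E1 : ubound E 1 by move=> s [->|[/andP[]]].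
have Esup : has_sup E by split; [exists 0; left|exists 1].
have aE s : E s -> s <= sup E by move=> Es; apply: sup_ubound => //; case: Esup.
exists (sup E); split.
- by rewrite aE /=; [apply: sup_le_ub => //; case: Esup|left].
- move=> a0.
  have Jin u : 0 < u < sup E -> J (c u).
    move=> /andP[u0 ua]; have [s Es us] := sup_gt (proj1 Esup) ua.
    case: Es us => [-> |[_ H] us]; first by move=> /(lt_trans u0); rewrite ltxx.
    by apply: H; rewrite u0 ltW.
  have a1 : sup E <= 1 by apply: sup_le_ub => //; case: Esup.
  move=> _ [u /= /andP[u0 ua] <-]; apply: Jcl => B /cc /nbhs_ballP[r /= r0 rB].
  set a := sup E in a0 Jin a1 ua *.
  pose eta := Num.min (1 / 2) (r / 2).
  have eta0 : 0 < eta by rewrite lt_min; apply/andP; split; lra.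
  have eta1 : eta <= 1 / 2 by rewrite ge_min lexx.
  have etar : eta <= r / 2 by rewrite ge_min lexx orbT.
  (* Moving slightly towards the midpoint puts the parameter strictly between 0 and [a], also when
     [u] is an end. *)
  pose v := u + eta * (a / 2 - u).
  exists (c v); split; first by apply: Jin; rewrite /v; apply/andP; split; nra.
  apply: rB; rewrite /ball /= /v opprD addrA subrr sub0r normrN normrM gtr0_norm//.
  have : `|a / 2 - u| <= 1 by rewrite ler_norml; apply/andP; split; lra.
  by move=> H; nra.
- by move=> s s01 Hs; apply: aE; right.
Qed.

Context (N : nat) (h : 'I_N -> R -> T) (g : 'I_N -> T -> R) (hg : graph_atlas h g).

Lemma edge_arc i a b : 0 <= a -> a < b -> b <= 1 ->
  arc_with_endpoints (icc (h i) a b) (h i a) (h i b).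
Proof.
move=> a0 ab b1; have [hch _ hcont gK _] := hg.
have ba : b - a != 0 by rewrite subr_eq0 gt_eqF.
exists (fun t => h i (a + t * (b - a))), (fun z => (g i z - a) / (b - a)); split.
- split.
    apply: continuous_subspaceT => t.
    apply: (@cvg_comp _ _ _ (fun t => a + t * (b - a)) (h i) _ (nbhs (a + t * (b - a))));
      last exact: (chart_cont (hch i)).
    by apply: cvgD; [exact: cvg_cst|apply: cvgMl; exact: cvg_id].
  move=> z; apply: (@continuous_comp (subspace (icc (h i) a b)) R R (g i) (fun u => (u - a) / (b - a))).
    apply: (continuous_subspaceW _ (hcont i)).
    move=> _ [u /= /andP[ua ub] <-]; exists u => //=; apply/andP; split; lra.
  by apply: cvgMl; apply: cvgB; [exact: cvg_id|exact: cvg_cst].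
- move=> t; rewrite in_itv /= => /andP[t0 t1].
  have H : a <= a + t * (b - a) <= b by apply/andP; split; nra.
  split; first by exists (a + t * (b - a)).
  rewrite gK; first by rewrite addrAC subrr add0r mulfK.
  by move: H => /andP[? ?]; apply/andP; split; lra.
- move=> _ [u /= /andP[ua ub] <-]; rewrite gK; last by apply/andP; split; lra.
  rewrite in_itv /= divfK// addrCA subrr addr0; split => //.
  by rewrite divr_ge0/= ?ler_pdivrMr ?subr_ge0 ?subr_gt0//; [lra|exact: ltW].
- by rewrite mul0r addr0 mul1r addrCA subrr addr0.
Qed.

(** As [J] is not inside the open edge, [leave] joins each of its points there to an end of the edge
    within [J]. *)
Lemma edge_trace i (J : set T) : closed J -> connected J -> ~ (J `<=` ioo (h i) 0 1) ->
  exists ab : R * R, [/\ 0 <= ab.1, ab.1 <= ab.2, ab.2 <= 1,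
    (0 < ab.1 -> icc (h i) 0 ab.1 `<=` J) /\ (ab.2 < 1 -> icc (h i) ab.2 1 `<=` J) &
    forall s, 0 < s < 1 -> J (h i s) -> s <= ab.1 \/ ab.2 <= s].
Proof.
move=> Jcl cJ /existsNP[z /not_implyP[Jz nz]]; have [hch _ _ _ _] := hg.
have [full|nfull] := pselect (icc (h i) 0 1 `<=` J).
  (* For an edge contained in [J], the second piece is the whole edge and the first is
     degenerate. *)
  exists (0, 0); rewrite /= lexx ler01 ltxx; split => //.
  by move=> s /andP[s0 _] _; right; exact: ltW.
have [a [/andP[a0 a1] aJ amax]] := initial_segment (chart_cont (hch i)) Jcl.
pose c' s := h i (1 + s * -1).
have cE u : c' (1 - u) = h i u by rewrite /c'; congr (h i); lra.
have hc' : chart c'.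
  by apply: chart_affine; rewrite ?ler01 ?lexx ?mulN1r ?addrN ?lexx ?ler01// oppr_eq0 oner_eq0.
have [a' [/andP[a'0 a'1] a'J a'max]] := initial_segment (chart_cont hc') Jcl.
have bJ : 1 - a' < 1 -> icc (h i) (1 - a') 1 `<=` J.
  move=> lt _ [u /= /andP[u1 u2] <-]; rewrite -cE; apply: a'J; first lra.
  by exists (1 - u) => //=; apply/andP; split; lra.
have ab : a <= 1 - a'.
  rewrite leNgt; apply/negP => lt; apply: nfull => _ [u /= /andP[u0 u1] <-].
  have [ua|au] := leP u a; first by apply: aJ; [lra|exists u => //=; rewrite u0].
  by apply: bJ; [lra|exists u => //=; apply/andP; split; lra].
exists (a, 1 - a'); split => //=; first lra.
move=> s s01 Js; have /andP[s0 s1] := s01.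
have [H|H] := leave (hch i) cJ (lexx _) s01 Js Jz nz.
  by left; apply: amax => //; rewrite s0 ltW.
right; suff : 1 - s <= a' by lra.
apply: a'max; first by apply/andP; split; lra.
move=> u /andP[u0 us]; rewrite /c' mulrN1; apply: H; apply/andP; split; lra.
Qed.

(** Either [J] is a segment of one open edge, or it traces segments at the ends of edges. Dropping
    degenerate traces can lose only finitely many ends of edges; these would form a clopen part of
    [J], so [J] would be finite and reduced to a point, against [x <> y]. *)
Lemma subcontinuum_is_graph (J : set T) x y : compact J -> connected J ->
  J x -> J y -> x <> y -> is_graph J.
Proof.
move=> cpJ cJ Jx Jy xy; have [hch hcov hcont gK hinter] := hg.
have Jcl : closed J by apply: compact_closed => //; exact: metric_hausdorff.
split => //; first by exists x.
have [[i Ji]|nJ] := pselect (exists i, J `<=` ioo (h i) 0 1).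
  have gJ : {within J, continuous (g i)}.
    apply: (continuous_subspaceW _ (hcont i)) => z /Ji[u /= /andP[u0 u1] <-].
    by exists u => //=; rewrite !ltW.
  have J0 : J !=set0 by exists x.
  have [p] := compact_EVT_min J0 cpJ gJ; rewrite inE => Jp pmin.
  have [q] := compact_EVT_max J0 cpJ gJ; rewrite inE => Jq qmax.
  have hgK z : J z -> 0 < g i z < 1 /\ h i (g i z) = z.
    by move=> /Ji[u /= u01 <-]; rewrite gK//; case/andP: u01 => *; rewrite !ltW.
  have [/andP[p0 p1] pE] := hgK p Jp; have [/andP[q0 q1] qE] := hgK q Jq.
  have JE : J = icc (h i) (g i p) (g i q).
    apply/seteqP; split => z.
      move=> Jz; exists (g i z); last by have [] := hgK z Jz.
      by rewrite /= pmin ?qmax// inE.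
    move=> [w /= pwq <-]; apply: (between (hch i) cJ (lexx _) (lexx _) Ji p0 q1 _ _ pwq).
      by rewrite pE.
    by rewrite qE.
  have pq : g i p < g i q.
    rewrite lt_neqAle pmin ?inE// andbT; apply/eqP => e; apply: xy.
    have E z : J z -> z = p.
      move=> Jz; have [_ <-] := hgK z Jz; rewrite -pE; congr (h i).
      by apply/le_anti; rewrite pmin ?inE// {1}e qmax ?inE.
    by rewrite (E x Jx) (E y Jy).
  exists 1%N, (fun=> icc (h i) (g i p) (g i q)), (fun=> h i (g i p)), (fun=> h i (g i q)).
  split.
  - by move=> _; apply: edge_arc => //; exact: ltW.
  - by rewrite {1}JE; apply/seteqP; split => z; [exists ord0|case].
  - by move=> k l kl; exfalso; apply: kl; rewrite !ord1.
have traceP i := edge_trace (i := i) Jcl cJ (fun Ji => nJ (ex_intro _ i Ji)).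
have [ab abP] := choice traceP.
pose lo (j : 'I_N * bool) := if j.2 then (ab j.1).2 else 0.
pose hi (j : 'I_N * bool) := if j.2 then 1 else (ab j.1).1.
pose P (j : 'I_N * bool) := lo j < hi j.
pose A (j : 'I_N * bool) := icc (h j.1) (lo j) (hi j).
have lo0 j : 0 <= lo j.
  by rewrite /lo; case: ifP => // _; have [? ? ? _ _] := abP j.1; lra.
have hi1 j : hi j <= 1.
  by rewrite /hi; case: ifP => // _; have [? ? ? _ _] := abP j.1; lra.
have AJ j : P j -> A j `<=` J.
  case: j => i b; rewrite /P /A /lo /hi /=; have [_ _ _ [? ?] _] := abP i.
  by case: b.
pose U := \bigcup_(j in [set j | P j]) A j.
have UJ : U `<=` J by move=> z [j Pj /AJ]; exact.
have Ucl : closed U.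
  apply: closed_bigcup => [|j _]; first exact: finite_finset.
  exact: icc_closed (chart_cont (hch _)).
have fin : finite_set (J `\` U).
  apply: (@sub_finite_set _ _ (range (fun j : 'I_N * bool => h j.1 (j.2)%:R))); last first.
    exact/finite_image/finite_finset.
  move=> z [Jz nU]; have [i [s [/andP[s0 s1] zE]]] := hcov z.
  have [s0'|sn0] := eqVneq s 0; first by exists (i, false); rewrite //= zE s0'.
  have [s1'|sn1] := eqVneq s 1; first by exists (i, true); rewrite //= zE s1'.
  have {}s0 : 0 < s by rewrite lt_neqAle eq_sym sn0.
  have {}s1 : s < 1 by rewrite lt_neqAle sn1.
  have [a0 ba b1 _ H] := abP i.
  have [||sa|bs] := H s; rewrite -?zE ?s0//; exfalso; apply: nU.
    exists (i, false); first by rewrite /= /P /lo /hi /=; lra.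
    by exists s; rewrite //= /lo /hi /= sa ltW.
  exists (i, true); first by rewrite /= /P /lo /hi /=; lra.
  by exists s; rewrite //= /lo /hi /= bs ltW.
have JU : J = U.
  apply/seteqP; split => // z Jz; apply: contrapT => nUz; apply: xy.
  have JD : J `\` U = J.
    apply: cJ; first by exists z.
    - by exists (~` U); [exact: closed_openC|rewrite setDE].
    - exists (J `\` U); first exact: finite_closed.
      by apply/seteqP; split => w; [case=> ? ?; split|case].
  have Jfin : finite_set J by rewrite -JD.
  have := finite_connected Jfin cJ Jx => JE.
  by move: Jy; rewrite JE.
have meet_same i : A (i, false) `&` A (i, true) = set0 \/
    exists c, [/\ A (i, false) `&` A (i, true) = [set c],
      c = h i (hi (i, false)) & c = h i (lo (i, true))].
  rewrite /A /lo /hi /=; have [a0 ab' b1 _ _] := abP i.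
  have [e|ne] := eqVneq (ab i).1 (ab i).2.
    right; exists (h i (ab i).1); split => //; last by rewrite e.
    apply/seteqP; split => z; last first.
      move=> ->; split; exists (ab i).1 => //=; rewrite ?lexx ?a0//.
      by rewrite e lexx.
    move=> [[u /= /andP[u0 ua] <-] [v /= /andP[vb v1] vu]].
    have uv : v = u by apply: (chart_inj (hch i)) => //; apply/andP; split; lra.
    by congr (h i _); apply/le_anti; rewrite ua e -uv vb.
  left; apply/seteqP; split => // z [[u /= /andP[u0 ua] <-] [v /= /andP[vb v1] vu]].
  have uv : v = u by apply: (chart_inj (hch i)) => //; apply/andP; split; lra.
  have lt : (ab i).1 < (ab i).2 by rewrite lt_neqAle ne.
  by move: vb; rewrite uv => /le_trans/(_ ua); rewrite leNgt lt.
have meet j j' : j != j' -> A j `&` A j' = set0 \/ exists c, [/\ A j `&` A j' = [set c],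
    c = h j.1 (lo j) \/ c = h j.1 (hi j) & c = h j'.1 (lo j') \/ c = h j'.1 (hi j')].
  case: j j' => [i b] [i' b'] jj'.
  have [ii'|ii'] := eqVneq i i'.
    move: jj'; rewrite -ii' => jj'; have := meet_same i.
    have bb' : b' = ~~ b.
      by case: (b) (b') jj' => -[]//; rewrite eqxx.
    rewrite bb'; case: (b) => /=; last first.
      case=> [H|[z [H1 H2 H3]]]; [by left|right; exists z; split => //].
        by right.
      by left.
    rewrite setIC; case=> [H|[z [H1 H2 H3]]]; [by left|right; exists z; split => //].
      by left.
    by right.
  have [->|/set0P[z [[s /= /andP[s0 s1] sz] [t /= /andP[t0 t1] tz]]]] :=
    eqVneq (A (i, b) `&` A (i', b')) set0; first by left.
  right; exists z.
  have l1 := lo0 (i, b); have l2 := hi1 (i, b); have l3 := lo0 (i', b'); have l4 := hi1 (i', b').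
  have s01 : 0 <= s <= 1 by apply/andP; split; lra.
  have t01 : 0 <= t <= 1 by apply/andP; split; lra.
  have st : h i s = h i' t by rewrite sz tz.
  have [se te uniq] := hinter i i' s t (elimN eqP ii') s01 t01 st.
  split.
  - apply/seteqP; split => w.
      move=> [[s' /= /andP[s'0 s'1] sw] [t' /= /andP[t'0 t'1] tw]].
      rewrite /= -sw (uniq s' t') ?sz// ?sw ?tw//; apply/andP; split; lra.
    by move=> ->; split; [exists s|exists t] => //=; apply/andP; split.
  - rewrite -sz /=; case: se => se; rewrite se in s0 s1 *.
      by left; congr (h i _); apply/le_anti; rewrite l1 s0.
    by right; congr (h i _); apply/le_anti; rewrite l2 s1.
  - rewrite -tz /=; case: te => te; rewrite te in t0 t1 *.
      by left; congr (h i' _); apply/le_anti; rewrite l3 t0.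
    by right; congr (h i' _); apply/le_anti; rewrite l4 t1.
exists #|P|, (fun k => A (enum_val k)), (fun k => h (enum_val k).1 (lo (enum_val k))),
  (fun k => h (enum_val k).1 (hi (enum_val k))); split.
- by move=> k; apply: edge_arc => //; exact: (enum_valP k).
- rewrite JU; apply/seteqP; split => z.
    move=> [j Pj Aj]; exists (enum_rank_in Pj j) => //; rewrite enum_rankK_in//.
  by move=> [k _ Ak]; exists (enum_val k) => //; exact: (enum_valP k).
- move=> k l kl; apply: meet; apply/eqP => /enum_val_inj; exact: kl.
Qed.

End Subcontinuum.

(** * Nested periodic subgraphs from inner coverings *)

Section InnerSubgraphs.
Context (R : realType) (T : metricType R) (f : T -> T) (cf : continuous f)
  (cT : compact [set: T]) (N : nat) (h : 'I_N -> R -> T) (g : 'I_N -> T -> R)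
  (hg : graph_atlas h g)
  (c : R -> T) (hc : chart c) (y : T) (cy : ~ icc c 0 1 y) (loc : localized f c y).
Context (inner : forall e k, 0 < e <= 1 -> covers_inner f c e k).
Context (unbounded : forall M, exists e d,
  [/\ 0 < e <= 1, component_period f (germ_orbit f c e) (c 0) d & (M < d)%N]).

Local Notation Y := (germ_orbit f c).
Local Notation comp e := (orbit_component f (Y e) (c 0)).
Local Notation kappa e := (orbit_component f (closure (Y e)) (c 0)).
Local Notation kperiod e := (component_period f (closure (Y e)) (c 0)).

Let Kf e := @germ_orbit_closure_forward R T f cf c e.

Let Kx e : 0 < e -> closure (Y e) (c 0).
Proof. by move=> e0; apply: subset_closure; exact: inner_origin. Qed.

Lemma kappa_mono e e' n : e <= e' -> kappa e n `<=` kappa e' n.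
Proof.
move=> ee z [C [Cx CY Cc] Cz]; exists C => //; split => //.
by apply: subset_trans CY _; apply: closureS; exact: germ_orbit_mono.
Qed.

Lemma germ_sub_kappa e : 0 < e -> icc c 0 e `<=` kappa e 0.
Proof.
move=> e0; apply: (@orbit_component_max _ f _ _ 0 _ (c 0)).
- exact: icc_connected (chart_cont hc).
- by move=> _ [s se <-]; apply: subset_closure; exact: germ_orbit_germ.
- by exists 0 => //=; rewrite lexx ltW.
- exact: (@orbit_component_refl _ f _ (@Kf e) _ (Kx e0) 0).
Qed.

Lemma kappa_return e k : 0 < e <= 1 -> exists2 t, (k <= t)%N &
  kappa e t (c 0) /\ (iter t f @` icc c 0 e) (c 0).
Proof.
move=> e01; have [t kt [ct At]] := germ_orbit_return cf hc inner k e01.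
exists t => //; split => //; have [C [Cx CY Cc] Cz] := ct; exists C => //; split => //.
by apply: subset_trans CY _; exact: subset_closure.
Qed.

Lemma kappa_period e : 0 < e <= 1 -> exists d, kperiod e d.
Proof.
move=> e01; have [t t1 [ct _]] := kappa_return 1 e01.
have [d _ dP] : exists2 d, (d <= t)%N & kperiod e d.
  apply: component_period_exists => //.
  by apply: connected_component_sym.
by exists d.
Qed.

Lemma kappa_period_dvd e e' d d' : 0 < e' -> e' <= e -> kperiod e d -> kperiod e' d' ->
  (d %| d')%N.
Proof.
move=> e'0 ee dP d'P; have e0 : 0 < e by lra.
have [_ cd _] := d'P.
have /(orbit_component_eq cf (@Kf e) (Kx e0) dP) := kappa_mono ee cd.
by rewrite mod0n => /esym/eqP.
Qed.

(** Passing to closures can merge components. At a separated scale the closures form two disjoint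
    closed groups, residue 0 modulo [d0] and the others. The connected [kappa e 0] stays in the
    first, so its period is a multiple of [d0]. *)
Lemma kappa_period_large M : exists2 e, 0 < e <= 1 & forall d, kperiod e d -> (M < d)%N.
Proof.
have [e0 [d0 [e01 d0P Md0]]] := unbounded M.
have [e [/andP[e_gt0 ee0] sep]] := separated_scale cf hg hc unbounded e01 d0P.
have e1 : 0 < e <= 1 by have /andP[_ ?] := e01; rewrite e_gt0; lra.
exists e => // d dP; have [d_gt0 cd _] := dP.
suff : (0 = d %[mod d0])%N.
  rewrite mod0n => /esym/eqP/(dvdn_leq d_gt0); exact: leq_trans.
have [d' d'P] := germ_orbit_period cf hc inner e1.
pose W (b : bool) := \bigcup_(i in [set i | (i < d')%N /\ (i == 0 %[mod d0])%N = b]) closure (comp e i).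
have Wcl b : closed (W b).
  apply: closed_bigcup => [|i _]; last exact: closed_closure.
  by apply: (@sub_finite_set _ _ `I_d'); [move=> i []|exact: finite_II].
have W0 : W true `&` W false = set0.
  apply/seteqP; split => // z [[i [_ i0] zi] [j [_ j0] zj]].
  by move: i0; rewrite (sep z i j zi zj) j0.
have Wsep : separated (W true) (W false).
  by split; rewrite -(iffLR (closure_id _) (Wcl _)).
have KW : kappa e 0 `<=` W true `|` W false.
  move=> z /connected_component_sub; rewrite (closure_germ_orbit cf hc e1 d'P).
  move=> [i id zi]; case E : (i == 0 %[mod d0])%N; [left|right]; by exists i.
have refl n : closure (comp e n) (iter n f (c 0)).
  apply: subset_closure.
  exact: (orbit_component_refl (@inner_forward _ _ f c e) (inner_origin _ _ e_gt0)).
have [H|H] := connected_subset Wsep KW (@component_connected _ _ _).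
  have [i [_ /eqP i0] zi] := H _ cd.
  by rewrite -i0; exact: sep zi (refl d).
have [i [_ i0] zi] := H _ (orbit_component_refl (@Kf e) (Kx e_gt0) 0).
by move: i0; rewrite (sep _ _ _ zi (refl 0%N)) eqxx.
Qed.

Section Scale.
Context (e : R) (d : nat) (e01 : 0 < e <= 1) (dP : kperiod e d).

(** The component is only mapped into itself by [iter d f]; the core restores the equality required
    of a periodic subgraph. Components of the closed set [closure (Y e)] are closed, so the core is
    compact. *)
Definition periodic_core := core (iter d f) (kappa e 0).

Let e0 : 0 < e. Proof. by case/andP: e01. Qed.

Let kimage : iter d f @` kappa e 0 `<=` kappa e 0.
Proof.
have := @orbit_component_image _ f cf _ (@Kf e) _ (Kx e0) d 0.
rewrite addn0 -(orbit_component_mod cf (@Kf e) (Kx e0) dP d) modnn.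
exact.
Qed.

Let kclosed : closed (kappa e 0).
Proof. by apply: component_closed; exact: closed_closure. Qed.

Lemma core_terms n t a : kappa e 0 a -> (n * d <= t)%N -> (t = 0 %[mod d])%N ->
  (iter n (iter d f) @` kappa e 0) (iter t f a).
Proof.
move=> ka nt t0; exists (iter (t - n * d) f a); last first.
  by rewrite -iterM -iterD subnKC.
have E : (t - n * d = 0 %[mod d])%N.
  by apply/eqP; rewrite -(eqn_modDr (n * d)) subnK// t0 mod0n add0n modnMl.
have := @orbit_component_image _ f cf _ (@Kf e) _ (Kx e0) (t - n * d) 0.
rewrite addn0 -(orbit_component_mod cf (@Kf e) (Kx e0) dP (t - _)) E mod0n; apply.
by exists a.
Qed.

Lemma periodic_core_origin : periodic_core (c 0).
Proof.
move=> n _; have [t nt [ct [a Aa aE]]] := kappa_return (n * d) e01.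
have t0 := iffLR (orbit_component_eq cf (@Kf e) (Kx e0) dP t 0) ct.
by have := core_terms (germ_sub_kappa e0 Aa) nt t0; rewrite aE.
Qed.

(** At one late time the constant words bring one point of the germ near [y] and another back to the
    germ. The second shows that this time is a multiple of [d], so the first lies in a deep image of
    the component. *)
Lemma periodic_core_target : periodic_core y.
Proof.
move=> n _; have cl : closed (iter n (iter d f) @` kappa e 0).
  by apply: core_closed_terms => //; exact: iter_continuous.
apply: cl => V Vy.
have [t [kt _ tw]] := loc (n * d).+1 e01 Vy.
have [u /andP[u0 ue] uw] := tw xpred0; have [v /andP[v0 ve] vw] := tw xpredT.
have kt0 := kt 0%N isT; have Vu := uw 0%N isT; have Av := vw 0%N isT.
have germ s : 0 < s < e -> kappa e 0 (c s).
  by move=> /andP[? ?]; apply: germ_sub_kappa => //; exists s => //=; rewrite !ltW.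
exists (iter (t 0%N) f (c u)); split => //; apply: core_terms.
- by apply: germ; rewrite u0.
- exact: ltnW.
have k0 : kappa e 0 (iter (t 0%N) f (c v)) by case: Av => w /= we <-; exact: germ.
apply: (orbit_component_meet cf (@Kf e) (Kx e0) dP _ k0).
rewrite -[X in kappa e X]addn0.
apply: (@orbit_component_image _ f cf _ (@Kf e) _ (Kx e0) (t 0%N) 0).
by exists (c v) => //; apply: germ; rewrite v0.
Qed.

Lemma periodic_core_subgraph : periodic_subgraph f periodic_core d.
Proof.
have [d0 _ _] := dP; have cfd : continuous (iter d f) := iter_continuous cf.
split => //.
- apply: (@subcontinuum_is_graph R T N h g hg periodic_core (c 0) y).
  + by apply: (subclosed_compact _ cT) => //; exact: core_closed.
  + by apply: core_connected => //; exact: component_connected.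
  + exact: periodic_core_origin.
  + exact: periodic_core_target.
  + by move=> E; apply: cy; rewrite -E; exists 0 => //=; rewrite lexx ler01.
- move=> i j /= id jd [z [[u ku uz] [v kv vz]]].
  have ki n w : periodic_core w -> kappa e n (iter n f w).
    move=> kw; rewrite -[X in kappa e X]addn0.
    apply: (@orbit_component_image _ f cf _ (@Kf e) _ (Kx e0) n 0).
    by exists w => //; exact: (core_sub kw).
  have zi : kappa e i z by rewrite -uz; exact: ki.
  have zj : kappa e j z by rewrite -vz; exact: ki.
  have := orbit_component_meet cf (@Kf e) (Kx e0) dP zi zj.
  by rewrite !modn_small.
- exact: core_image.
Qed.

End Scale.

Lemma periodic_core_nested e e' d d' : 0 < e' -> e' <= e -> 0 < e <= 1 ->
  kperiod e d -> kperiod e' d' -> periodic_core e' d' `<=` periodic_core e d.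
Proof.
move=> e'0 ee e01 dP d'P z kz n _; have dd := kappa_period_dvd e'0 ee dP d'P.
have [w kw <-] := kz n I; rewrite -iterM; apply: core_terms => //.
- exact: kappa_mono kw.
- by rewrite leq_mul2l dvdn_leq ?orbT//; case: d'P.
- by rewrite mod0n; apply/eqP; exact: dvdn_mull.
Qed.

Lemma nested_periodic_subgraphs : exists (J : nat -> set T) (m : nat -> nat),
  [/\ forall n, periodic_subgraph f (J n) (m n), forall n, J n.+1 `<=` J n,
      m @ \oo --> \oo & forall n, J n (c 0) /\ J n y].
Proof.
have largeP M : exists e, 0 < e <= 1 /\ forall d, kperiod e d -> (M < d)%N.
  by have [e e01 eM] := kappa_period_large M; exists e.
have [eps epsP] := choice largeP.
pose E := fix E n := if n is n'.+1 then Num.min (E n') (eps n) else eps 0%N.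
have E01 n : 0 < E n <= 1.
  elim: n => [|n /andP[E0 E1]]; first by case: (epsP 0%N).
  have [/andP[p0 _] _] := epsP n.+1.
  by rewrite /= lt_min E0 p0 ge_min E1.
have Eeps n : E n <= eps n by case: n => [|n] //=; rewrite ge_min lexx orbT.
have Edec n : E n.+1 <= E n by rewrite /= ge_min lexx.
have [m mP] := choice (fun n => kappa_period (E01 n)).
exists (fun n => periodic_core (E n) (m n)), m; split.
- by move=> n; exact: periodic_core_subgraph.
- move=> n; apply: periodic_core_nested => //; by have /andP[] := E01 n.+1.
- apply/cvgnyPge => A; exists A => // n /= An.
  have [eps01 large] := epsP n.
  have [d dP] := kappa_period eps01; have nd := large d dP.
  have /andP[En0 _] := E01 n.
  have dm := kappa_period_dvd En0 (Eeps n) dP (mP n).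
  apply: leq_trans An _; apply: leq_trans (ltnW nd) _.
  by apply: dvdn_leq => //; case: (mP n).
- by move=> n; split; [exact: periodic_core_origin|exact: periodic_core_target].
Qed.

End InnerSubgraphs.

(** * The equivalence *)

Section Pairs.
Context (T : topologicalType) (f : T -> T).

Lemma IT_IN x y : IT_pair f x y -> IN_pair f x y.
Proof.
move=> IT U1 U2 xU1 yU2 n; have [I Iinf [Ipos Iind]] := IT U1 U2 xU1 yU2.
have [J JI Jn] := infinite_set_fset n Iinf.
exists J => //; split; first exact: subset_trans JI Ipos.
by move=> K Kfin K0 KJ; apply: Iind => //; exact: subset_trans JI.
Qed.

Lemma IN_pair_sym x y : IN_pair f x y -> IN_pair f y x.
Proof.
move=> IN U1 U2 yU1 xU2 n; have [I nI [Ipos Iind]] := IN U2 U1 xU2 yU1 n.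
exists I => //; split => // J Jfin J0 JI S.
have [z zP] := Iind J Jfin J0 JI (fun i => rev_ord (S i)).
exists z => i Ji; have := zP i Ji; rewrite /= !(tnth_nth set0) /=.
by case: (S i) => [[|[|//]]].
Qed.

End Pairs.

Section Graph.
Context (R : realType) (T : metricType R) (f : T -> T) (cf : continuous f)
  (hT : is_graph [set: T]).

Lemma NS_IT x y : NS_pair f x y -> IT_pair f x y.
Proof.
move=> [_ [zx _ ox] [zy _ oy] [J [m [per dec minf Jxy]]]].
have [N [h [g hg]]] := graph_has_atlas hT.
have Jc n : compact (J n) by have [[]] := per n.
have Jconn n : connected (J n) by have [[]] := per n.
have m0 n : (0 < m n)%N by have [] := per n.
have Jdisj n : trivIset `I_(m n) (fun i => iter i f @` J n) by have [] := per n.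
have Jper n : iter (m n) f @` J n = J n by have [] := per n.
have Jx n : J n x by have [] := Jxy n.
have Jy n : J n y by have [] := Jxy n.
have [n0 [t0 [i0 He]]] := inside_edge cf Jconn m0 Jdisj Jper minf Jx hg.
exact: (nested_pair_IT cf Jc Jconn m0 Jdisj Jper dec minf Jx Jy hg He ox oy).
Qed.

(** If [y] is on the chart, its parameter is positive, and rescaling the chart to half of that
    parameter leaves [y] outside. *)
Lemma localized_away c y : chart c -> c 0 <> y -> localized f c y -> exists c',
  [/\ chart c', c' 0 = c 0, ~ icc c' 0 1 y & localized f c' y].
Proof.
move=> hc c0y loc.
have [a /andP[a0 a1] ya] : exists2 a, 0 < a <= 1 & ~ icc c 0 a y.
  have [[v /= /andP[v0 v1] vy]|ny] := pselect (icc c 0 1 y); last first.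
    by exists 1 => //; rewrite ltr01 lexx.
  have {}v0 : 0 < v.
    by rewrite lt_neqAle v0 andbT; apply/eqP => v0'; apply: c0y; rewrite v0'.
  exists (v / 2); first by apply/andP; split; lra.
  rewrite -vy => /(icc_mem hc (lexx 0)) H.
  have : 0 <= v <= v / 2 by apply: H; [lra|rewrite ltW].
  by move=> /andP[_]; lra.
pose c' s := c (0 + s * a).
have c'E e : ioo c 0 (e * a) `<=` ioo c' 0 e.
  move=> _ [s /= /andP[s0 se] <-]; exists (s / a); last by rewrite /c' add0r divfK// gt_eqF.
  by rewrite /= divr_gt0//= ltr_pdivrMr.
exists c'; split.
- by apply: chart_affine; rewrite ?add0r ?lexx ?ler01 ?(ltW a0) ?a1 ?gt_eqF.
- by rewrite /c' mul0r addr0.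
- move=> [s /= /andP[s0 s1] sy]; apply: ya; exists (0 + s * a) => //=.
  by rewrite add0r mulr_ge0 ?(ltW a0)//= ler_piMl// ltW.
move=> e V k /andP[e0 e1] yV.
have [|t [tk tinc tw]] := loc (e * a) V k _ yV.
  by rewrite mulr_gt0//= (mulr_ile1 (ltW e0) (ltW a0) e1 a1).
exists t; split => // s; have [u ue uw] := tw s.
have [u' u'e u'E] := c'E e _ (ex_intro2 _ _ u ue erefl).
exists u' => // j jk; rewrite u'E; have := uw j jk.
by case: (s j) => // /c'E.
Qed.

Lemma IN_nested x y : topological_entropy R f = 0%E -> x <> y -> IN_pair f x y ->
  omega_limit f x /\ exists (J : nat -> set T) (m : nat -> nat),
  [/\ forall n, periodic_subgraph f (J n) (m n), forall n, J n.+1 `<=` J n,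
      m @ \oo --> \oo & forall n, J n x /\ J n y].
Proof.
move=> h0 xy IN; have nh := zero_entropy_no_horseshoe h0.
have [_ cT _ _] := hT; have [N [h [g hg]]] := graph_has_atlas hT.
have [c0 [hc0 c0x loc0]] := localization hg IN xy.
have [|c [hc cx cy loc]] := localized_away hc0 _ loc0; first by rewrite c0x.
rewrite c0x in cx; rewrite -cx.
have [inner|outer] := inner_or_outer cf hc cy loc; last first.
  by case: (outer_absurd cf cT hg nh hc cy loc outer).
have om := inner_omega cf cT hc inner; split; first exact: om.
apply: (nested_periodic_subgraphs cf cT hg hc cy loc inner) => M.
apply: contrapT => bounded.
apply: (bounded_periods_absurd cf cT hg nh hc cy loc inner (M := M)) => e d e01 dP.
by rewrite leqNgt; apply/negP => Md; apply: bounded; exists e, d.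
Qed.

End Graph.

Theorem theorem1p3 (R : realType) (G : metricType R) (f : G -> G) (x y : G)
    (hG : is_graph [set: G])
    (hf : continuous f)
    (h0 : topological_entropy R f = 0%E)
    (hxy : x <> y) :
  [<-> NS_pair f x y; IN_pair f x y; IT_pair f x y].
Proof.
have IN_NS : IN_pair f x y -> NS_pair f x y.
  move=> IN; have [ox HJ] := IN_nested hf hG h0 hxy IN.
  (* The germ at [x] gives only [omega_limit f x]; exchanging the points gives the statement for
     [y]. *)
  have [oy _] := IN_nested hf hG h0 (nesym hxy) (IN_pair_sym IN).
  by split.
tfae.
- by move=> NS; exact/IT_IN/(NS_IT hf hG).
- by move=> /IN_NS; exact: NS_IT.
- by move=> /IT_IN/IN_NS.
Qed.
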